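(* Let $(M_p)_{p\in\mathbb N}$ be a weight sequence and let $\mathcal{W} = (w_N)_{N\in\mathbb N}$ be an increasing weight system on $\mathbb{R}^d$. Consider the following conditions: (i) $\mathcal{W}$ satisfies $(DN)$. (ii) $\mathcal{B}^{\{M_p\}}_\mathcal{W}(\mathbb{R}^d)$ is boundedly retractive. (iii) $\mathcal{B}^{\{M_p\}}_\mathcal{W}(\mathbb{R}^d)$ is complete. (iv) $\mathcal{B}^{\{M_p\}}_\mathcal{W}(\mathbb{R}^d)$ is regular. (v) $\mathcal{B}^{\{M_p\}}_\mathcal{W}(\mathbb{R}^d)$ satisfies $(wQ)$. Then (i) $\Rightarrow$ (ii) $\Rightarrow$ (iii) $\Rightarrow$ (iv) $\Rightarrow$ (v) $\Rightarrow$ (ii). Moreover, if $M_p$ satisfies $(M.1)$, $(M.2)$, and $(M.3)$, and $\mathcal{W}$ satisfies $$\forall N \in \mathbb{N} \; \exists M \geq N \; \exists C > 0 \; \forall x \in \mathbb{R}^d : \; \sup_{y \in [-1,1]^d} w_N(x +y) \leq Cw_M(x),$$ then (v) $\Rightarrow$ (i).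
   Context: Weight sequences. For a sequence $(M_p)_{p\in\mathbb{N}}$ of positive reals ($\mathbb N=\{0,1,2,\dots\}$) put $m_p := M_p/M_{p-1}$, $p\ge 1$. It is a weight sequence if $m_p\to\infty$. Write $M_\alpha=M_{|\alpha|}$ for $\alpha\in\mathbb{N}^d$. Conditions: $(M.1)$ $M_p^2\le M_{p-1}M_{p+1}$, $p\ge1$; $(M.2)$ $M_{p+q}\le C_0H^{p+q}M_pM_q$ for all $p,q\in\mathbb N$, for some $C_0,H\ge1$; $(M.3)$ $\sum_{p=q}^\infty 1/m_p< Cq/m_q$ for all $q\ge1$, for some $C\ge1$. Weight systems. An increasing weight system on $\mathbb{R}^d$ is a pointwise increasing sequence $\mathcal{W}=(w_N)_{N\in\mathbb N}$ of positive continuous functions on $\mathbb{R}^d$. It satisfies $(DN)$ if $\exists N\,\forall M>N\,\exists K>M\,\exists C>0\,\forall x\in\mathbb{R}^d:\ w_M(x)^2\le C w_N(x)w_K(x)$. Spaces. For a positive continuous function $w$ on $\mathbb R^d$ and $h>0$, $\mathcal{B}^{M_p,h}_w(\mathbb{R}^d)$ is the Banach space of all $\varphi\in C^\infty(\mathbb{R}^d)$ with $\|\varphi\|_{\mathcal{B}^{M_p,h}_w}:=\sup_{\alpha\in\mathbb{N}^d}\sup_{x\in\mathbb{R}^d} h^{|\alpha|}|\varphi^{(\alpha)}(x)|w(x)/M_\alpha<\infty$. Put $\mathcal{B}^{M_p,h}_\mathcal{W}(\mathbb{R}^d):=\varprojlim_{N\in\mathbb N}\mathcal{B}^{M_p,h}_{w_N}(\mathbb{R}^d)$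 (a Fréchet space) and $\mathcal{B}^{\{M_p\}}_\mathcal{W}(\mathbb{R}^d):=\varinjlim_{h\to0^+}\mathcal{B}^{M_p,h}_\mathcal{W}(\mathbb{R}^d)$ (an $(LF)$-space). $(LF)$-spaces. A Hausdorff locally convex space $E$ is an $(LF)$-space, written $E=\varinjlim E_n$, if there is a sequence of Fréchet spaces $E_n\subset E_{n+1}$ with continuous inclusions, $E=\bigcup_n E_n$, carrying the finest locally convex topology making all inclusions $E_n\to E$ continuous. $E$ is regular if every bounded set of $E$ is contained and bounded in some $E_n$. $E$ is boundedly retractive if for every bounded set $B$ of $E$ there is $n$ such that $B\subset E_n$ and $E$ and $E_n$ induce the same topology on $B$. $E$ satisfies $(wQ)$ if for every $n$ there are a neighborhood $U$ of $0$ in $E_n$ and $m>n$ such that for every $k>m$ and every neighborhood $W$ of $0$ in $E_m$ there are a neighborhood $V$ of $0$ in $E_k$ and $C>0$ with $V\cap U\subseteq CW$. These notions do not depend on the choice of defining spectrum. *)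

(* Defs.v *)
From HB Require Import structures.
From mathcomp Require Import all_boot all_order all_algebra.
From mathcomp Require Import complex ring.
From mathcomp Require Import all_classical all_reals all_analysis.

Set Implicit Arguments.
Unset Strict Implicit.
Unset Printing Implicit Defensive.

Import Order.TTheory GRing.Theory Num.Theory numFieldNormedType.Exports.

Local Open Scope classical_set_scope.
Local Open Scope ring_scope.

(* Locally convex topologies on a vector space, given by a base of
   neighbourhoods of 0 made of absolutely convex absorbing sets. *)
Section ZeroBase.
Context (K : numFieldType) (V : lmodType K).

Definition absconvex (U : set V) := forall (a b : K) (x y : V),
  `|a| + `|b| <= 1 -> U x -> U y -> U (a *: x + b *: y).

Record zero_base := ZeroBase {
  zbase : set_system V ;
  zbase_neq0 : exists U, zbase U ;
  zbase_absconvex : forall U, zbase U -> absconvex U ;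
  zbase_absorbing : forall U x, zbase U -> exists2 r : K, 0 < r & U (r *: x) ;
  zbaseI : forall U1 U2, zbase U1 -> zbase U2 ->
    exists2 U, zbase U & U `<=` U1 `&` U2 ;
  zbaseZ : forall U (r : K), zbase U -> 0 < r ->
    exists2 U', zbase U' & forall x, U' x -> U (r *: x) }.

Definition lcs_of (b : zero_base) : Type := V.

End ZeroBase.

Section LcsOf.
Context (K : numFieldType) (V : lmodType K) (b : zero_base V).
Local Notation T := (lcs_of b).

HB.instance Definition _ := GRing.Lmodule.on T.

Let nbhs_lcs (x : T) : set_system T :=
  [set A | exists2 U, zbase b U & forall y, U y -> A (x + y)].

HB.instance Definition _ := hasNbhs.Build T nbhs_lcs.

Let lcs0 U : zbase b U -> U 0.
Proof.
move=> bU; have [r _ Ur] := zbase_absorbing 0 bU.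
by rewrite scaler0 in Ur.
Qed.

Let lcsZ U (a : K) x : zbase b U -> `|a| <= 1 -> U x -> U (a *: x).
Proof.
move=> bU a1 Ux; rewrite -[_ *: _]addr0 -[X in _ + X](scale0r x).
by apply: (zbase_absconvex bU) => //; rewrite normr0 addr0.
Qed.

Let lcs_half U : zbase b U ->
  exists2 U', zbase b U' & forall x y, U' x -> U' y -> U (x + y).
Proof.
move=> bU; have [U' bU' U'U] := zbaseZ bU (ltr0Sn K 1).
exists U' => // x y /U'U Ux /U'U Uy.
have -> : x + y = 2^-1 *: (2%:R *: x) + 2^-1 *: (2%:R *: y).
  by rewrite !scalerA mulVf ?pnatr_eq0// !scale1r.
apply: (zbase_absconvex bU) => //.
by rewrite ger0_norm ?invr_ge0// [leRHS]splitr !mul1r.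
Qed.

Let nbhs_lcs_filter (x : T) : ProperFilter (nbhs x).
Proof.
apply: Build_ProperFilter_ex => [A [U bU UA]|].
  by exists (x + 0); apply: UA; exact: lcs0.
split=> [|A B [U bU UA] [W bW WB]|A B AB [U bU UA]].
- by have [U bU] := zbase_neq0 b; exists U.
- have [X bX XUW] := zbaseI bU bW; exists X => // y /XUW[Uy Wy].
  by split; [exact: UA|exact: WB].
- by exists U => // y /UA/AB.
Qed.

Let nbhs_lcs_singleton (x : T) (A : set T) : nbhs x A -> A x.
Proof. by move=> [U bU UA]; rewrite -[x]addr0; apply: UA; exact: lcs0. Qed.

Let nbhs_lcs_nbhs (x : T) (A : set T) : nbhs x A -> nbhs x (nbhs^~ A).
Proof.
move=> [U bU UA]; have [U' bU' U'U] := lcs_half bU.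
by exists U' => // y Uy; exists U' => // z Uz; rewrite -addrA; apply: UA; exact: U'U.
Qed.

HB.instance Definition _ := Nbhs_isNbhsTopological.Build T
  nbhs_lcs_filter nbhs_lcs_singleton nbhs_lcs_nbhs.

Let lcs_add_continuous : continuous (fun x : T * T => x.1 + x.2).
Proof.
move=> [x y] A /= [U bU UA]; have [U' bU' U'U] := lcs_half bU.
exists ([set x + z | z in U'], [set y + z | z in U']) => /=.
  by split; exists U' => // z Uz; exists z.
move=> [_ _] [/= [s Us <-] [t Ut <-]] /=.
by rewrite addrACA; apply: UA; exact: U'U.
Qed.

Let lcs_scale_continuous : continuous (fun z : K^o * T => z.1 *: z.2).
Proof.
move=> [k x] A /= [U bU UA]; have [U1 bU1 U1U] := lcs_half bU.
have [r r0 U1r] := zbase_absorbing (x : V) bU1.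
have k1 : 0 < `|k| + r by rewrite ltr_wpDl.
have [U2 bU2 U2U1] := zbaseZ bU1 k1.
exists ([set l | `|k - l| < r], [set x + z | z in U2]) => /=.
  by split; [exists r => //=|exists U2 => // z Uz; exists z].
move=> [l _] [/= lr [z Uz <-]] /=.
have -> : l *: (x + z) = k *: x + ((l - k) *: x + l *: z).
  by rewrite scalerDr scalerBl addrA addrCA subrr addr0.
apply: UA; apply: U1U.
  have -> : (l - k) *: x = ((l - k) / r) *: (r *: x).
    by rewrite scalerA divfK// gt_eqF.
  apply: lcsZ => //.
  by rewrite normrM normfV (gtr0_norm r0) ler_pdivrMr// mul1r distrC ltW.
have -> : l *: z = (l / (`|k| + r)) *: ((`|k| + r) *: z).
  by rewrite scalerA divfK// gt_eqF.
apply: lcsZ => //; last exact: U2U1.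
rewrite normrM normfV (gtr0_norm k1) ler_pdivrMr// mul1r.
by rewrite -[l](subKr k) (le_trans (ler_normB _ _))// lerD2l ltW.
Qed.

Let lcs_locally_convex : exists2 B : set_system T,
  (forall A, A \in B -> convex_set A) & basis B.
Proof.
exists [set A | open A /\ convex_set A].
  by move=> A; rewrite inE => -[].
split=> [A []//|x A /= [U bU UA]].
exists (interior [set x + y | y in U]).
  split; last by rewrite /interior/=; exists U => // y Uy; exists y.
  split; first exact: open_interior.
  move=> y z t; rewrite !inE => -[U1 bU1 U1x] [U2 bU2 U2x].
  have [U3 bU3 U3x] := zbaseI bU1 bU2; exists U3 => // u /U3x[/U1x [y' Uy' yE]].
  move=> /U2x [z' Uz' zE].
  exists (t%:num *: y' + (1 - t%:num) *: z').
    apply: (zbase_absconvex bU) => //.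
    by rewrite !ger0_norm ?subr_ge0// addrC subrK.
  rewrite /conv/=.
  have -> : u = t%:num *: u + (1 - t%:num) *: u.
    by rewrite -scalerDl addrC subrK scale1r.
  rewrite addrACA -!scalerDr -yE -zE !scalerDr addrACA; congr (_ + _).
  by rewrite -scalerDl addrC subrK scale1r.
by move=> y /interior_subset [u Uu <-]; exact: UA.
Qed.

(* This factory only builds the translation-invariant uniformity; the other
   components of tvsType are declared separately. *)
HB.instance Definition _ := PreTopologicalLmod_isTvs.Build K T
  lcs_add_continuous lcs_scale_continuous lcs_locally_convex.
HB.instance Definition _ :=
  PreTopologicalNmodule_isTopologicalNmodule.Build T lcs_add_continuous.
HB.instance Definition _ :=
  TopologicalNmodule_isTopologicalLmodule.Build K T lcs_scale_continuous.
HB.instance Definition _ := Uniform_isTvs.Build K T lcs_locally_convex.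

Lemma nbhs0_lcs (A : set T) :
  nbhs (0 : T) A <-> exists2 U, zbase b U & U `<=` A.
Proof.
split=> [[U bU UA]|[U bU UA]]; exists U => // y /UA; rewrite add0r//.
Qed.

End LcsOf.

(* (LF)-spaces. E is the limit, En the defining spectrum of Frechet spaces and
   i n : En n -> E the inclusion; i n @` A is A seen as a subset of E. *)
Section LFSpaces.
Context (K : numFieldType).

Definition lc_bounded (E : tvsType K) (B : set E) : Prop :=
  forall U, nbhs (0 : E) U -> exists2 r : K, 0 < r & B `<=` [set r *: x | x in U].

Definition lc_complete (E : tvsType K) : Prop :=
  forall F : set_system E, ProperFilter F -> cauchy F -> exists x : E, F --> x.

Context (E : tvsType K) (En : nat -> tvsType K) (i : forall n, En n -> E).

Definition lf_regular : Prop :=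
  forall B : set E, lc_bounded B ->
    exists n (A : set (En n)), lc_bounded A /\ @i n @` A = B.

Definition lf_boundedly_retractive : Prop :=
  forall B : set E, lc_bounded B -> exists n,
    B `<=` range (@i n) /\
    [set B `&` O | O in @open E] = [set B `&` @i n @` O | O in @open (En n)].

Definition lf_wQ : Prop :=
  forall n, exists2 U : set (En n), nbhs 0 U &
  exists m, (n < m)%N /\
  forall k, (m < k)%N -> forall W : set (En m), nbhs 0 W ->
  exists2 V : set (En k), nbhs 0 V &
  exists C : K, 0 < C /\
    @i k @` V `&` @i n @` U `<=` [set C *: x | x in @i m @` W].

End LFSpaces.

(* Base of the finest locally convex topology on V making every f i continuous:
   the absolutely convex sets whose preimages are neighbourhoods of 0. They are
   absorbing because the images of the f i cover V. *)
Section FinalBase.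
Context (K : numFieldType) (V : lmodType K) (I : Type) (E : I -> tvsType K).
Context (f : forall i, {linear E i -> V}).
Hypothesis f_cover : forall x, exists i y, f i y = x.

Definition final_zbase : set_system V :=
  [set U | absconvex U /\ forall i, nbhs (0 : E i) (f i @^-1` U)].

Let final_neq0 : exists U, final_zbase U.
Proof. by exists setT; split=> // i; exact: filterT. Qed.

Let final_absorbing U x : final_zbase U -> exists2 r : K, 0 < r & U (r *: x).
Proof.
move=> [_ Unbhs]; have [i [y <-]] := f_cover x.
have := @scale_continuous K (E i) (0, y) (f i @^-1` U).
rewrite /= scale0r => /(_ (Unbhs i))[[A B]/= [[e/= e0 Ae] /nbhs_singleton By]] AB.
exists (e / 2); first by rewrite divr_gt0.
rewrite -linearZ; apply: (AB (e / 2, y)); split=> //=; apply: Ae => /=.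
by rewrite sub0r normrN gtr0_norm ?divr_gt0// ltr_pdivrMr// ltr_pMr// ltr1n.
Qed.

Let final_I U1 U2 : final_zbase U1 -> final_zbase U2 ->
  exists2 U, final_zbase U & U `<=` U1 `&` U2.
Proof.
move=> [c1 n1] [c2 n2]; exists (U1 `&` U2) => //; split=> [a b x y ab|i].
  by move=> [? ?] [? ?]; split; [exact: c1|exact: c2].
by rewrite preimage_setI; exact: filterI.
Qed.

Let final_Z U (r : K) : final_zbase U -> 0 < r ->
  exists2 U', final_zbase U' & forall x, U' x -> U (r *: x).
Proof.
move=> [cU nU] r0; exists [set x | U (r *: x)] => //; split=> [a b x y ab /=|i].
  by move=> Ux Uy; rewrite scalerDr !scalerA ![r * _]mulrC -!scalerA; exact: cU.
have r1 : r^-1 != 0 by rewrite invr_eq0 gt_eqF.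
apply: filterS (nbhs0Z r1 (nU i)) => _ [y Uy <-] /=.
by rewrite linearZ/= scalerA divff ?scale1r// gt_eqF.
Qed.

Definition lc_final : zero_base V :=
  ZeroBase final_neq0 (fun U => @proj1 _ _) final_absorbing final_I final_Z.

End FinalBase.

(* Rcomplex R is the library's alias of R[i] seen as a vector space over R; it
   is the codomain for which the derivative along a real direction is taken. *)
HB.instance Definition _ (R : rcfType) :=
  PseudoMetric.copy (Rcomplex R) (pseudoMetric_normed (Rcomplex R)).
HB.instance Definition _ (R : rcfType) := isPointed.Build (Rcomplex R) 0.
HB.instance Definition _ (R : rcfType) :=
  NormedZmod_PseudoMetric_eq.Build R (Rcomplex R) erefl.

Lemma Rcomplex_normrZ (R : rcfType) (l : R) (z : Rcomplex R) :
  `|l *: z| = `|l| * `|z|.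
Proof.
case: z => a b; rewrite /Num.norm/= !exprMn -mulrDr sqrtrM ?sqr_ge0//.
by rewrite sqrtr_sqr.
Qed.

HB.instance Definition _ (R : rcfType) :=
  PseudoMetricNormedZmod_Lmodule_isNormedModule.Build R (Rcomplex R)
    (@Rcomplex_normrZ R).

Section Smooth.
Context (R : realType) (d : nat).
Local Notation fct := ('rV[R]_d -> Rcomplex R).
Implicit Types (f : fct) (j : 'I_d) (s : seq 'I_d) (alpha : {ffun 'I_d -> nat}).

Definition partial j f : fct := fun x => 'D_(delta_mx 0 j) f x.

(* All iterated partial derivatives exist and are continuous. *)
Definition smooth f : Prop := forall s,
  let g := foldr partial f s in
  continuous g /\ forall j x, derivable g x (delta_mx 0 j).

Definition mlen alpha : nat := (\sum_j alpha j)%N.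

Definition mderiv alpha f : fct :=
  foldr (fun j => iter (alpha j) (partial j)) f (enum 'I_d).

End Smooth.

Lemma Rcomplex_norm_real (R : rcfType) (x : R) : `|x%:C%C : Rcomplex R| = `|x|.
Proof. by rewrite /Num.norm/= expr0n/= addr0 sqrtr_sqr. Qed.

Section SmoothTheory.
Context (R : realType) (d : nat).
Local Notation fct := ('rV[R]_d -> R[i]).
Implicit Types (f g : fct) (a : R[i]) (j : 'I_d) (s : seq 'I_d).

Lemma mulc_continuous a :
  continuous (fun z : Rcomplex R => (a * z : Rcomplex R)).
Proof.
move=> z; have zF := @nbhs_filter (Rcomplex R) z.
rewrite /continuous_at; apply/cvgrPdist_lt => e e0.
have a1 : 0 < `|a : Rcomplex R| + 1 by rewrite ltr_wpDl.
have : \forall t \near z, `|z - t : Rcomplex R| < e / (`|a : Rcomplex R| + 1).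
  have := @nbhsx_ballx R (Rcomplex R) z _ (divr_gt0 e0 a1).
  by rewrite -ball_normE.
apply: filterS => t zt.
have -> : `|(a * z - a * t : Rcomplex R)| = `|a : Rcomplex R| * `|z - t : Rcomplex R|.
  by rewrite -mulrBr; exact: Normc.normcM.
rewrite ltr_pdivlMr// in zt; apply: le_lt_trans zt.
by rewrite mulrC ler_wpM2l// lerDl.
Qed.

Lemma derive_lin (f g : fct) a (x v : 'rV[R]_d) :
  derivable (f : _ -> Rcomplex R) x v -> derivable (g : _ -> Rcomplex R) x v ->
  is_derive x v ((a *: f + g : fct) : _ -> Rcomplex R)
    (a * 'D_v (f : _ -> Rcomplex R) x + 'D_v (g : _ -> Rcomplex R) x).
Proof.
move=> df dg.
have daf : is_derive x v ((a *: f : fct) : _ -> Rcomplex R)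
    (a * 'D_v (f : _ -> Rcomplex R) x : Rcomplex R).
  have Hcvg : (fun h : R => h^-1 *: ((((a *: f : fct) : _ -> Rcomplex R) \o shift x) (h *: v)
     - (a *: f : fct) x : Rcomplex R)) @ (0 : R)^' -->
     (a * 'D_v (f : _ -> Rcomplex R) x : Rcomplex R).
    have -> : (fun h : R => h^-1 *: ((((a *: f : fct) : _ -> Rcomplex R) \o shift x) (h *: v)
     - (a *: f : fct) x : Rcomplex R)) =
     (fun z : Rcomplex R => (a * z : Rcomplex R)) \o
     (fun h : R => h^-1 *: (((f : _ -> Rcomplex R) \o shift x) (h *: v) - f x : Rcomplex R)).
      apply/funext => h /=; rewrite [(a *: f) _]/GRing.scale/= [(a *: f) x]/GRing.scale/=.
      rewrite -[_ *: f x]/(a * f x) -[_ *: f _]/(a * f _) -mulrBr.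
      case: a (f _ - f _) => [a1 a2] [z1 z2].
      by apply/eqP; rewrite eq_complex/=; apply/andP; split; apply/eqP; ring.
    apply: continuous_cvg; first exact: mulc_continuous.
    exact: df.
  apply: DeriveDef; first by apply/cvg_ex; exists (a * 'D_v (f : _ -> Rcomplex R) x).
  exact: cvg_lim Hcvg.
have dg' : is_derive x v (g : _ -> Rcomplex R) ('D_v (g : _ -> Rcomplex R) x).
  exact: derivableP.
exact: (is_deriveD daf dg').
Qed.

Lemma foldr_partial_lin a f g s : smooth f -> smooth g ->
  foldr (@partial R d) (a *: f + g) s =
  a *: (foldr (@partial R d) f s : fct) + (foldr (@partial R d) g s : fct).
Proof.
move=> sf sg; elim: s => [//|j s IH]; rewrite /= IH; apply/funext => x.
have [_ /(_ j x) df] := sf s; have [_ /(_ j x) dg] := sg s.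
rewrite {1}/partial; have [_ ->] := derive_lin a df dg.
by [].
Qed.

Lemma smooth_lin a f g : smooth f -> smooth g -> smooth (a *: f + g).
Proof.
move=> sf sg s /=; rewrite foldr_partial_lin//.
have [cf df] := sf s; have [cg dg] := sg s; split=> [x|j x].
  have ca := @continuous_comp _ (Rcomplex R) (Rcomplex R) _
    (fun z => a * z) x (cf x) (@mulc_continuous a _).
  exact: (@continuousD R (Rcomplex R) _ _ _ x ca (cg x)).
by have [] := derive_lin a (df j x) (dg j x).
Qed.

Lemma foldr_partial0 s : foldr (@partial R d) (0 : fct) s = 0 :> fct.
Proof.
elim: s => [//|j s IH] /=; rewrite IH; apply/funext => x; rewrite /partial.
exact: (@derive_val _ _ _ _ _ _ _ (is_derive_cst (0 : Rcomplex R) x _)).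
Qed.

Lemma smooth0 : smooth (0 : fct).
Proof.
move=> s /=; rewrite foldr_partial0.
by split=> [|j x]; [exact: cst_continuous|exact: derivable_cst].
Qed.

Lemma mderiv_foldr (alpha : {ffun 'I_d -> nat}) f :
  mderiv alpha f =
  foldr (@partial R d) f (flatten [seq nseq (alpha j) j | j <- enum 'I_d]).
Proof.
rewrite /mderiv; elim: (enum _) => [//|j l IH] /=.
by rewrite foldr_cat IH; elim: (alpha j) => [//|n /= ->].
Qed.

Lemma mderiv_lin alpha a f g : smooth f -> smooth g ->
  mderiv alpha (a *: f + g) = a *: (mderiv alpha f : fct) + (mderiv alpha g : fct).
Proof. by move=> sf sg; rewrite !mderiv_foldr foldr_partial_lin. Qed.

Lemma mderiv0 alpha : mderiv alpha (0 : fct) = 0 :> fct.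
Proof. by rewrite mderiv_foldr foldr_partial0. Qed.

End SmoothTheory.

(* m_p = M_p / M_(p-1); only meaningful for p >= 1. *)
Definition wquot (R : realType) (M : nat -> R) (p : nat) : R := M p / M p.-1.

Record weight_sequence (R : realType) := WeightSequence {
  wseq :> nat -> R ;
  wseq_gt0 : forall p, 0 < wseq p ;
  wquot_cvgy : wquot wseq p @[p --> \oo] --> +oo }.

Record weight_system (R : realType) (d : nat) := WeightSystem {
  wsys :> nat -> 'rV[R]_d -> R ;
  wsys_gt0 : forall N x, 0 < wsys N x ;
  wsys_continuous : forall N, continuous (wsys N) ;
  wsys_incr : forall N x, wsys N x <= wsys N.+1 x }.

Section WeightConditions.
Context (R : realType).

Definition cond_M1 (M : weight_sequence R) : Prop :=
  forall p, (0 < p)%N -> M p ^+ 2 <= M p.-1 * M p.+1.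

Definition cond_M2 (M : weight_sequence R) : Prop :=
  exists C0 H : R, [/\ 1 <= C0, 1 <= H &
    forall p q, M (p + q)%N <= C0 * H ^+ (p + q) * M p * M q].

Definition cond_M3 (M : weight_sequence R) : Prop :=
  exists2 C : R, 1 <= C & forall q, (0 < q)%N ->
    (\sum_(q <= p <oo) ((wquot M p)^-1)%:E < (C * q%:R / wquot M q)%:E)%E.

Context (d : nat).

Definition cond_DN (W : weight_system R d) : Prop :=
  exists N, forall M, (N < M)%N -> exists2 K, (M < K)%N &
  exists2 C : R, 0 < C & forall x, W M x ^+ 2 <= C * W N x * W K x.

Definition cube : set 'rV[R]_d := [set y | forall j, -1 <= y 0 j <= 1].

Definition cond_shift (W : weight_system R d) : Prop :=
  forall N, exists2 M, (N <= M)%N & exists2 C : R, 0 < C & forall x,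
    (ereal_sup [set (W N (x + y))%:E | y in cube] <= (C * W M x)%:E)%E.

End WeightConditions.

Section Spaces.
Context (R : realType) (d : nat) (M : weight_sequence R).
Local Notation fct := ('rV[R]_d -> R[i]).

(* The modulus of a derivative is taken in Rcomplex R, hence lies in R. *)
Definition bnorm (h : R) (w : 'rV[R]_d -> R) (f : fct) : \bar R :=
  ereal_sup [set (h ^+ mlen alpha * `|mderiv alpha f x| * w x
                  / M (mlen alpha))%:E | alpha in setT & x in setT].

Context (W : weight_system R d).

Definition BW_pred (h : {posnum R}) : {pred fct} :=
  fun f => `[< smooth f /\ forall N, (bnorm h%:num (W N) f < +oo)%E >].

Lemma bnorm_leP h w f (c : R) : (bnorm h w f <= c%:E)%E <->
  forall alpha x, h ^+ mlen alpha * `|mderiv alpha f x| * w x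
                  / M (mlen alpha) <= c.
Proof.
split=> [fc alpha x|fc].
  rewrite -lee_fin; apply: le_trans fc; apply: ereal_sup_ubound.
  by exists alpha => //; exists x.
by apply: ge_ereal_sup => _ [alpha _ [x _ <-]]; rewrite lee_fin.
Qed.

Lemma bnorm_ltyP h w f : (bnorm h w f < +oo)%E <->
  exists c : R, (bnorm h w f <= c%:E)%E.
Proof.
split=> [|[c fc]]; last by apply: le_lt_trans fc _; exact: ltry.
case: (bnorm h w f) => [r _|//|_]; first by exists r.
by exists 0; rewrite leNye.
Qed.

Lemma bnorm_lin (h : {posnum R}) N f g (a b : R[i]) (cf cg : R) :
  smooth f -> smooth g ->
  (bnorm h%:num (W N) f <= cf%:E)%E -> (bnorm h%:num (W N) g <= cg%:E)%E ->
  (bnorm h%:num (W N) (a *: f + b *: g)%R <=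
    (`|a : Rcomplex R| * cf + `|b : Rcomplex R| * cg)%:E)%E.
Proof.
move=> sf sg /bnorm_leP bf /bnorm_leP bg; apply/bnorm_leP => alpha x.
have -> : mderiv alpha (a *: f + b *: g) =
    a *: (mderiv alpha f : fct) + b *: (mderiv alpha g : fct).
  rewrite mderiv_lin//.
    by rewrite -[b *: g]addr0 mderiv_lin ?mderiv0 ?addr0//; exact: smooth0.
  by rewrite -[b *: g]addr0; apply: smooth_lin => //; exact: smooth0.
set k := fun r : R => h%:num ^+ mlen alpha * r * W N x / M (mlen alpha).
rewrite -/(k _).
have kD r t : k (r + t) = k r + k t by rewrite /k; ring.
have kZ r t : k (r * t) = r * k t by rewrite /k; ring.
have k_le r t : r <= t -> k r <= k t.
  move=> rt; apply: ler_wpM2r; first by rewrite invr_ge0 ltW// wseq_gt0.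
  by apply: ler_wpM2r; [rewrite ltW// wsys_gt0|exact: ler_wpM2l].
have := k_le _ _ (@ler_normD _ (Rcomplex R) (a * mderiv alpha f x) (b * mderiv alpha g x)).
move/le_trans; apply.
have nM (u v : R[i]) : `|(u * v : Rcomplex R)| = `|u : Rcomplex R| * `|v : Rcomplex R|.
  exact: Normc.normcM.
by rewrite kD !nM !kZ lerD// ler_wpM2l//; [exact: bf|exact: bg].
Qed.

Lemma BW_pred_submod h : submod_closed (BW_pred h).
Proof.
split.
  apply/asboolP; split=> [|N]; first exact: smooth0.
  apply/bnorm_ltyP; exists 0; apply/bnorm_leP => alpha x.
  by rewrite mderiv0 [0 x]/= normr0 mulr0 !mul0r.
move=> a f g /asboolP[sf bf] /asboolP[sg bg]; apply/asboolP.
split=> [|N]; first exact: smooth_lin.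
have /bnorm_ltyP[cf fc] := bf N; have /bnorm_ltyP[cg gc] := bg N.
apply/bnorm_ltyP; exists (`|a : Rcomplex R| * cf + `|1 : Rcomplex R| * cg).
by rewrite -[g]scale1r; exact: bnorm_lin.
Qed.

HB.instance Definition _ h :=
  GRing.isSubmodClosed.Build R[i] fct (BW_pred h) (BW_pred_submod h).

Record BW_fun (h : {posnum R}) := BWFun {
  BW_val :> fct ;
  BW_valP : BW_val \in BW_pred h }.

HB.instance Definition _ h := [isSub for @BW_val h].
HB.instance Definition _ h := [Choice of BW_fun h by <:].
HB.instance Definition _ h := [SubChoice_isSubLmodule of BW_fun h by <:].

(* The Frechet space of index h: the projective limit topology is given by the
   increasing sequence of norms bnorm h (W N). *)
Section BW.
Variable h : {posnum R}.

Definition BW_ball (N : nat) (e : R) : set (BW_fun h) :=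
  [set f | (bnorm h%:num (W N) f <= e%:E)%E].

Definition BW_zbase : set_system (BW_fun h) :=
  [set U | exists N e, 0 < e /\ U = BW_ball N e].

Lemma wsys_le N N' x : (N <= N')%N -> W N x <= W N' x.
Proof.
move=> /subnK <-; elim: (_ - _)%N => [//|n IH].
exact/(le_trans IH)/wsys_incr.
Qed.

Lemma BW_smooth (f : BW_fun h) : smooth f.
Proof. by have /asboolP[] := BW_valP f. Qed.

Lemma BW_ball_le N N' e e' : (N <= N')%N -> e' <= e ->
  BW_ball N' e' `<=` BW_ball N e.
Proof.
move=> NN' ee' f; rewrite /BW_ball/= => /bnorm_leP fe; apply/bnorm_leP => alpha x.
apply: le_trans ee'; apply: le_trans (fe alpha x).
apply: ler_wpM2r; first by rewrite invr_ge0 ltW// wseq_gt0.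
by apply: ler_wpM2l; [rewrite mulr_ge0|exact: wsys_le].
Qed.

Let BW_neq0 : exists U, BW_zbase U.
Proof. by exists (BW_ball 0 1), 0%N, 1. Qed.

Let BW_absconvex U : BW_zbase U -> absconvex U.
Proof.
move=> [N [e [e0 ->]]] a b f g ab fe ge; rewrite /BW_ball/=.
apply: le_trans (bnorm_lin a b (@BW_smooth f) (@BW_smooth g) fe ge) _.
rewrite lee_fin -mulrDl -[leRHS]mul1r; apply: ler_wpM2r; first exact: ltW.
by move: ab; rewrite !normc_def -rmorphD/= lecR; case: a; case: b.
Qed.

Let BW_Z_ball N e (r : R[i]) : 0 < r -> 0 < e -> exists2 e', 0 < e' &
  forall f, BW_ball N e' f -> BW_ball N e (r *: f).
Proof.
move=> r0 e0; have r1 : 0 < `|r : Rcomplex R| by rewrite normr_gt0 gt_eqF.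
exists (e / `|r : Rcomplex R|) => [|f fe]; first exact: divr_gt0.
have := bnorm_lin r 0 (@BW_smooth f) (@BW_smooth f) fe fe.
by rewrite normr0 mul0r scale0r !addr0 mulrC divfK// gt_eqF.
Qed.

Let BW_absorbing U f : BW_zbase U -> exists2 r : R[i], 0 < r & U (r *: f).
Proof.
move=> [N [e [e0 ->]]].
have /asboolP[_ /(_ N)/bnorm_ltyP[c fc]] := BW_valP f.
have c1 : 0 < `|c| + 1 by rewrite ltr_wpDl.
have ec : 0 < e / (`|c| + 1) by rewrite divr_gt0.
exists (e / (`|c| + 1))%:C%C; first by rewrite ltcR.
have fc1 : (bnorm h%:num (W N) f <= (`|c| + 1)%:E)%E.
  apply: le_trans fc _; rewrite lee_fin.
  by rewrite (le_trans (ler_norm _))// lerDl.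
have := bnorm_lin (e / (`|c| + 1))%:C%C 0 (@BW_smooth f) (@BW_smooth f) fc1 fc1.
rewrite normr0 mul0r scale0r !addr0.
by rewrite Rcomplex_norm_real (gtr0_norm ec) divfK// gt_eqF.
Qed.

Let BW_I U1 U2 : BW_zbase U1 -> BW_zbase U2 ->
  exists2 U, BW_zbase U & U `<=` U1 `&` U2.
Proof.
move=> [N1 [e1 [e10 ->]]] [N2 [e2 [e20 ->]]].
exists (BW_ball (maxn N1 N2) (Num.min e1 e2)).
  by exists (maxn N1 N2), (Num.min e1 e2); rewrite lt_min e10.
by move=> f fU; split; apply: BW_ball_le fU;
  rewrite ?leq_maxl ?leq_maxr ?ge_min ?lexx ?orbT.
Qed.

Let BW_Z U (r : R[i]) : BW_zbase U -> 0 < r ->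
  exists2 U', BW_zbase U' & forall f, U' f -> U (r *: f).
Proof.
move=> [N [e [e0 ->]]] r0; have [e' e'0 H] := BW_Z_ball N r0 e0.
by exists (BW_ball N e') => //; exists N, e'.
Qed.

Definition BW_base : zero_base (BW_fun h) :=
  ZeroBase BW_neq0 BW_absconvex BW_absorbing BW_I BW_Z.

Definition BW : Type := lcs_of BW_base.

HB.instance Definition _ := Tvs.copy BW (lcs_of BW_base).

End BW.

(* The inductive limit of the spaces BW h over all h > 0. *)
Definition BR_pred : {pred fct} := fun f => `[< exists h, f \in BW_pred h >].

Lemma BW_pred_le (h h' : {posnum R}) f : h'%:num <= h%:num ->
  f \in BW_pred h -> f \in BW_pred h'.
Proof.
move=> hh' /asboolP[sf bf]; apply/asboolP; split=> // N.
have /bnorm_ltyP[c /bnorm_leP fc] := bf N.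
apply/bnorm_ltyP; exists c; apply/bnorm_leP => alpha x.
apply: le_trans (fc alpha x).
apply: ler_wpM2r; first by rewrite invr_ge0 ltW// wseq_gt0.
apply: ler_wpM2r; first by rewrite ltW// wsys_gt0.
by apply: ler_wpM2r => //; rewrite lerXn2r ?nnegrE.
Qed.

Lemma BR_pred_submod : submod_closed BR_pred.
Proof.
split; first by apply/asboolP; exists 1%:pos; exact: rpred0.
move=> a f g /asboolP[h fh] /asboolP[h' gh']; apply/asboolP.
have [hh'|/ltW hh'] := leP h%:num h'%:num; [exists h|exists h'].
  by rewrite rpredD ?rpredZ//; exact: BW_pred_le gh'.
by rewrite rpredD ?rpredZ//; exact: BW_pred_le fh.
Qed.

HB.instance Definition _ :=
  GRing.isSubmodClosed.Build R[i] fct BR_pred BR_pred_submod.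

Record BR_fun := BRFun {
  BR_val :> fct ;
  BR_valP : BR_val \in BR_pred }.

HB.instance Definition _ := [isSub for BR_val].
HB.instance Definition _ := [Choice of BR_fun by <:].
HB.instance Definition _ := [SubChoice_isSubLmodule of BR_fun by <:].

Lemma BW_BR h (f : BW_fun h) : (f : fct) \in BR_pred.
Proof. by apply/asboolP; exists h; exact: BW_valP. Qed.

Definition BW_incl h (f : BW h) : BR_fun := BRFun (BW_BR f).

Lemma BW_incl_linear h : linear (@BW_incl h).
Proof. by move=> a f g; exact/val_inj. Qed.

HB.instance Definition _ h :=
  GRing.isLinear.Build R[i] (BW h) BR_fun _ (@BW_incl h) (@BW_incl_linear h).

Lemma BW_incl_cover f : exists h (g : BW h), BW_incl g = f.
Proof.
have /asboolP[h fh] := BR_valP f.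
by exists h, (BWFun fh); exact/val_inj.
Qed.

Definition BR_base : zero_base BR_fun :=
  lc_final (f := fun h => @BW_incl h : {linear _ -> _}) BW_incl_cover.

Definition BR : Type := lcs_of BR_base.

HB.instance Definition _ := Tvs.copy BR (lcs_of BR_base).

(* Defining spectrum h = 1/(n+1) of BR. *)
Definition BR_step (n : nat) : tvsType R[i] := BW (n.+1%:R^-1)%:pos.

Definition BR_emb (n : nat) (f : BR_step n) : BR := BW_incl f.

End Spaces.

(* Main.v *)
Require Import Defs.
From mathcomp Require Import all_boot all_order all_algebra.
From mathcomp Require Import complex ring lra zify.
From mathcomp Require Import all_classical all_reals all_analysis.

Set Implicit Arguments.
Unset Strict Implicit.
Unset Printing Implicit Defensive.

Import Order.TTheory GRing.Theory Num.Theory numFieldNormedType.Exports.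

Local Open Scope classical_set_scope.
Local Open Scope ring_scope.

(** Condition (wQ) amounts to an inequality between the norms of the steps
    ([norm_wQ]), which follows from (DN) by interpolation and from regularity
    because a failure of it produces a bounded set lying boundedly in no step.
    Conversely, it makes the topologies of all later steps agree on a ball of each
    step. Adding such balls one after the other, with well-chosen radii, yields an
    increasing sequence of absolutely convex sets, absorbing in the union, on each
    of which the topology of the limit is that of one step. Every bounded set and,
    up to closure, every Cauchy filter lives in a multiple of one of these sets;
    hence bounded retractivity and completeness. That completeness implies
    regularity is a gliding hump argument.

    For the necessity of (DN), (M.1) and (M.3) provide a cutoff function (an
    infinite convolution of indicator functions of intervals) with
    [|chi^(p)| <= D 2^-p M_p]. Testing the norm inequality on
    [M_a l^-a cos (l t - a pi / 2)] times a cutoff around [x], with [l] proportional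
    to [m_a], gives [w_N' <= C (t^a w_N + 2^-a w_K)] for all [a]; optimizing over
    [a] and iterating gives (DN). *)

(** A neighborhood of the limit contains a ball of each step, but with radii that vary from step to
    step without control, so a single ball says nothing about the limit topology. Two effects make
    the passage possible. The inequality of (wQ) gives a bound, not smallness; smallness comes from
    moving from [h_m] to [h_(m+1)], where the factor [(h_(m+1) / h_m)^|alpha|] makes high
    derivatives negligible and leaves only finitely many orders, which a later step controls. And
    each ball added to a nested set serves twice: it makes the union absorbing, and it receives the
    error of approximation of any point in the closure of the previous set, so that no closed hulls
    are needed. In the necessity part, the interpolation inequality bounds a power [s + 1] of a
    quotient of weights by a power [s] of another one, where [t <= 2^s]. Such an exponent gain is
    weaker than (DN), but [((s + 1) / s)^s >= 2], so [s] iterations suffice. Dimension zero is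
    treated apart, since there no variable can carry an oscillation. *)

Definition hstep (R : realType) (n : nat) : R := n.+1%:R^-1.

Lemma hstep_gt0 (R : realType) n : 0 < hstep R n.
Proof. by rewrite invr_gt0. Qed.

Lemma hstep_le (R : realType) n n' : (n <= n')%N -> hstep R n' <= hstep R n.
Proof. by move=> nn'; rewrite lef_pV2 ?posrE// ler_nat. Qed.

Lemma hstep_lt (R : realType) n n' : (n < n')%N -> hstep R n' < hstep R n.
Proof. by move=> nn'; rewrite ltf_pV2 ?posrE// ltr_nat. Qed.

Lemma hstep_le1 (R : realType) n : hstep R n <= 1.
Proof. by rewrite invf_le1// ler1n. Qed.

Lemma hstep_small (R : realType) (e : R) : 0 < e -> exists n, hstep R n <= e.
Proof.
move=> e0; have [n _ /(_ n (leqnn n)) ne] := near_infty_natSinv_lt (PosNum e0).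
by exists n; exact: ltW.
Qed.

(** * Norms on the steps *)

Section Seminorms.
Context (R : realType) (d : nat) (M : weight_sequence R) (W : weight_system R d).
Local Notation V := (BR M W).
Local Notation fct := ('rV[R]_d -> R[i]).
Local Notation "c %:V" := (c%:C%C : R[i]) (at level 2, format "c %:V").

(* The steps are handled as subsets [stp n] of the limit, with the closed balls
   [sn n N c] of the norm of index [N] of the step [h = 1 / (n + 1)]. *)
Definition sn (n N : nat) (c : R) : set V :=
  [set f | (bnorm M (hstep R n) (W N) (BR_val f) <= c%:E)%E].

Definition stp (n : nat) : set V := [set f | forall N, exists c, sn n N c f].

Lemma snP n N c f : sn n N c f <-> forall alpha x,
  hstep R n ^+ mlen alpha * `|mderiv alpha (BR_val f) x : Rcomplex R| * W N x
    / M (mlen alpha) <= c.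
Proof. exact: (@bnorm_leP R d M (hstep R n) (W N) (BR_val f) c). Qed.

Lemma BR_smooth (f : V) : smooth (BR_val f).
Proof. by have /asboolP[h] := BR_valP f; move=> /asboolP[]. Qed.

Lemma stpP n f : stp n f <-> BR_val f \in BW_pred M W (n.+1%:R^-1)%:pos.
Proof.
split=> [fn|/asboolP[_ fn] N].
  apply/asboolP; split=> [|N]; first exact: BR_smooth.
  by have [c fc] := fn N; apply/bnorm_ltyP; exists c.
by have /bnorm_ltyP[c fc] := fn N; exists c.
Qed.

Lemma range_emb n : range (@BR_emb R d M W n) = stp n.
Proof.
apply/seteqP; split=> [_ [f _ <-]|f].
  by apply/stpP; exact: BW_valP.
by move=> /stpP fn; exists (BWFun fn) => //; exact/val_inj.
Qed.

Lemma sn_ler n N c c' : c <= c' -> sn n N c `<=` sn n N c'.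
Proof. by move=> cc' f /le_trans; apply; rewrite lee_fin. Qed.

Lemma wfactor_ge0 n (alpha : {ffun 'I_d -> nat}) (r : R) : 0 <= r ->
  0 <= hstep R n ^+ mlen alpha * r.
Proof. by move=> r0; rewrite mulr_ge0// exprn_ge0// ltW// hstep_gt0. Qed.

Lemma sn_mono n N n' N' c : (n <= n')%N -> (N' <= N)%N -> sn n N c `<=` sn n' N' c.
Proof.
move=> nn' NN' f /snP fc; apply/snP => alpha x; apply: le_trans (fc alpha x).
apply: ler_wpM2r; first by rewrite invr_ge0 ltW// wseq_gt0.
apply: ler_pM => //; first exact: wfactor_ge0.
- by rewrite ltW// wsys_gt0.
- by apply: ler_wpM2r => //; rewrite lerXn2r ?nnegrE ?(ltW (hstep_gt0 _ _))// hstep_le.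
- exact: wsys_le.
Qed.

Lemma sn_lin n N (a b : R[i]) (cf cg : R) f g : sn n N cf f -> sn n N cg g ->
  sn n N (`|a : Rcomplex R| * cf + `|b : Rcomplex R| * cg) (a *: f + b *: g).
Proof.
have := @bnorm_lin R d M W (n.+1%:R^-1)%:pos N (BR_val f) (BR_val g) a b cf cg
  (@BR_smooth f) (@BR_smooth g).
exact.
Qed.

Lemma normc_real (r : R) : `|r%:V : Rcomplex R| = `|r|.
Proof. exact: Rcomplex_norm_real. Qed.

Lemma snZ n N (a : R) c f : sn n N c f -> sn n N (`|a| * c) (a%:V *: f).
Proof.
move=> fc; have := @sn_lin n N a%:V 0%:V c c f f fc fc.
by rewrite !normc_real normr0 mul0r addr0 scale0r addr0.
Qed.

Lemma snD n N cf cg f g : sn n N cf f -> sn n N cg g -> sn n N (cf + cg) (f + g).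
Proof.
move=> fc gc; have := @sn_lin n N 1%:V 1%:V cf cg f g fc gc.
by rewrite !normc_real normr1 !mul1r !scale1r.
Qed.

Lemma snB n N cf cg f g : sn n N cf f -> sn n N cg g -> sn n N (cf + cg) (f - g).
Proof.
move=> fc gc; have := @sn_lin n N 1%:V (-1)%:V cf cg f g fc gc.
by rewrite !normc_real normrN !normr1 !mul1r scale1r rmorphN scaleN1r.
Qed.

Lemma sn0 n N c : 0 <= c -> sn n N c 0.
Proof. by move=> c0; apply/snP => alpha x; rewrite mderiv0 [(0 : _ -> _) _]/= normr0 mulr0 !mul0r. Qed.

Lemma sn_ge0 n N c f : sn n N c f -> 0 <= c.
Proof.
move=> /snP /(_ [ffun=> 0%N] 0); apply: le_trans.
by rewrite mulr_ge0// ?invr_ge0 ?(ltW (wseq_gt0 _ _))// mulr_ge0// ?(ltW (wsys_gt0 _ _ _))// wfactor_ge0.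
Qed.

Lemma stp_lin n (a b : R[i]) f g : stp n f -> stp n g -> stp n (a *: f + b *: g).
Proof. by move=> fn gn N; have [c fc] := fn N; have [c' gc] := gn N; eexists; exact: sn_lin fc gc. Qed.

Lemma stpZ n (a : R[i]) f : stp n f -> stp n (a *: f).
Proof. by move=> fn; have := stp_lin a 0 fn fn; rewrite scale0r addr0. Qed.

Lemma stpD n f g : stp n f -> stp n g -> stp n (f + g).
Proof. by move=> fn gn; have := stp_lin 1 1 fn gn; rewrite !scale1r. Qed.

Lemma stpB n f g : stp n f -> stp n g -> stp n (f - g).
Proof. by move=> fn gn; have := stp_lin 1 (-1) fn gn; rewrite scale1r scaleN1r. Qed.

Lemma stp0 n : stp n 0.
Proof. by move=> N; exists 0; exact: sn0. Qed.

Lemma stp_mono n n' : (n <= n')%N -> stp n `<=` stp n'.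
Proof. by move=> nn' f fn N; have [c fc] := fn N; exists c; exact: sn_mono fc. Qed.

Lemma stp_cover f : exists n, stp n f.
Proof.
have /asboolP[h fh] := BR_valP f.
have [n nh] := @hstep_small R h%:num [gt0 of h%:num].
by exists n; apply/stpP; apply: BW_pred_le fh.
Qed.

Lemma sn_pos n N f : stp n f -> exists2 c : R, 0 < c & sn n N c f.
Proof.
move=> /(_ N)[c fc]; exists (c + 1); first by rewrite ltr_wpDl// (sn_ge0 fc).
by apply: sn_ler fc; rewrite lerDl.
Qed.

Lemma nbhs0_step n (A : set (BR_step M W n)) : nbhs 0 A <->
  exists N (e : R), 0 < e /\ forall f, sn n N e (BR_emb f) -> A f.
Proof.
split=> [/nbhs0_lcs[U [N [e [e0 ->]]] UA]|[N [e [e0 fA]]]].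
  by exists N, e; split=> // f fe; exact: UA.
by apply/nbhs0_lcs; exists (BW_ball (W := W) N e); [exists N, e|exact: fA].
Qed.

(** The limit is taken over all real [h > 0]. Every [h] dominates some [1 / (n + 1)], and lowering
    [h] enlarges the space and decreases the norms, so the countable spectrum detects the same
    neighborhoods. *)
Lemma nbhs0_BR (A : set V) : nbhs 0 A <-> exists2 U : set V,
  absconvex U /\ (forall n, exists N (e : R), 0 < e /\ stp n `&` sn n N e `<=` U) & U `<=` A.
Proof.
split=> [/nbhs0_lcs[U [cU nU] UA]|[U [cU nU] UA]].
  exists U => //; split=> // n.
  have [N [e [e0 fU]]] := (@nbhs0_step n _).1 (nU (n.+1%:R^-1)%:pos).
  exists N, e; split=> // f [/stpP fn fe].
  have := fU (BWFun fn); rewrite /preimage/=.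
  by rewrite (_ : BW_incl _ = f); [apply; rewrite (_ : BR_emb _ = f)//; exact/val_inj|exact/val_inj].
apply/nbhs0_lcs; exists U => //; split=> // h.
have [n nh] := @hstep_small R h%:num [gt0 of h%:num].
have [N [e [e0 nNeU]]] := nU n.
apply/nbhs0_lcs; exists (BW_ball (W := W) N e); first by exists N, e.
move=> f fe; apply: nNeU; split.
  by apply/stpP; apply: (@BW_pred_le _ _ _ _ h) (BW_valP f).
apply/snP => alpha x; have /bnorm_leP/(_ alpha x) := fe; apply: le_trans.
apply: ler_wpM2r; first by rewrite invr_ge0 ltW// wseq_gt0.
apply: ler_wpM2r; first by rewrite ltW// wsys_gt0.
by apply: ler_wpM2r => //; rewrite lerXn2r ?nnegrE ?(ltW (hstep_gt0 _ _)).
Qed.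

End Seminorms.

(** * The condition (wQ) as an inequality between norms *)

Section NormWQ.
Context (R : realType) (d : nat) (M : weight_sequence R) (W : weight_system R d).
Local Notation V := (BR M W).
Local Notation "c %:V" := (c%:C%C : R[i]) (at level 2, format "c %:V").
Local Notation sn := (@sn R d M W).
Local Notation stp := (@stp R d M W).

(** By homogeneity the balls of (wQ) may be given the radii [1], [1] and [C]: [N] stands for [U],
    [K] for [V] and [N'] for [W]. *)
Definition norm_wQ : Prop := forall n, exists N m, (n < m)%N /\
  forall k N', (m < k)%N -> exists K (C : R), 0 < C /\
  forall f, stp n f -> sn n N 1 f -> sn k K 1 f -> sn m N' C f.

(** Squaring and applying (DN) to the last weight halves its share: up to a constant, [W N'] is
    below [W N] to the power [1 - 2^-j] times [W K] to the power [2^-j]. A small share is needed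
    because [h_k] may be tiny. *)
Lemma DN_iter N N' j :
  (forall N', (N < N')%N -> exists2 K, (N' < K)%N &
     exists2 C : R, 0 < C & forall x, W N' x ^+ 2 <= C * W N x * W K x) ->
  (N < N')%N -> exists2 K, (N' <= K)%N & exists2 C : R, 0 < C & forall x,
    W N' x ^+ (2 ^ j) <= C * W N x ^+ (2 ^ j).-1 * W K x.
Proof.
move=> DN NN'; elim: j => [|j [K N'K [C C0 IH]]].
  by exists N' => //; exists 1 => // x; rewrite expr1 expr0 !mul1r.
have [K' KK' [C' C'0 H]] := DN K (leq_trans NN' N'K).
exists K'; first by rewrite (leq_trans N'K)// ltnW.
exists (C ^+ 2 * C') => [|x]; first by rewrite mulr_gt0// exprn_gt0.
rewrite expnSr exprM.
have w0 := wsys_gt0 W.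
have : (W N' x ^+ (2 ^ j)) ^+ 2 <= (C * W N x ^+ (2 ^ j).-1 * W K x) ^+ 2.
  by rewrite lerXn2r// nnegrE ?exprn_ge0 ?mulr_ge0 ?exprn_ge0// ltW.
move/le_trans; apply; rewrite exprMn.
apply: (@le_trans _ _ ((C * W N x ^+ (2 ^ j).-1) ^+ 2 * (C' * W N x * W K' x))).
  by rewrite ler_wpM2l// exprn_ge0// mulr_ge0 ?exprn_ge0// ltW.
have -> : (2 ^ j * 2).-1 = ((2 ^ j).-1 * 2).+1.
  by have := expn_gt0 2 j; case: (2 ^ j)%N => // p _; rewrite mulSn.
rewrite [W N x ^+ _.+1]exprS exprM; set Y := _ ^+ _.-1.
by rewrite le_eqVlt; apply/orP; left; apply/eqP; ring.
Qed.

(* [(DN)] is iterated until [h_(n + 1) ^ 2^j <= h_n ^ (2^j - 1) * h_k]. *)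
Lemma DN_norm_wQ : cond_DN W -> norm_wQ.
Proof.
move=> [N DN] n; exists N, n.+1; split=> // k N' nk.
have w0 := wsys_gt0 W; have h0 := hstep_gt0 R.
pose N1 := maxn N' N.+1.
have [j hj] : exists j, hstep R n.+1 ^+ (2 ^ j) <= hstep R n ^+ (2 ^ j).-1 * hstep R k.
  pose q := hstep R n.+1 / hstep R n.
  have q1 : `|q| < 1.
    by rewrite ger0_norm ?divr_ge0 ?(ltW (h0 _))// ltr_pdivrMr// mul1r hstep_lt.
  have /cvgrPdist_le/(_ (hstep R k / hstep R n)) := cvg_expr q1.
  rewrite divr_gt0// => /(_ isT)[p _ /(_ (2 ^ p)%N (ltnW (ltn_expl _ _)))] /(_ isT) hp.
  have q0 : 0 <= q ^+ (2 ^ p) by rewrite exprn_ge0// divr_ge0// ltW.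
  exists p; move: hp; rewrite sub0r normrN (ger0_norm q0).
  rewrite expr_div_n ler_pdivrMr ?exprn_gt0//; move/le_trans; apply.
  have {1}-> : (2 ^ p)%N = (2 ^ p).-1.+1 by rewrite prednK// expn_gt0.
  by rewrite exprS mulrA divfK ?gt_eqF// mulrC.
have [K N'K [C C0 HC]] := @DN_iter N N1 j DN (leq_maxr _ _).
(* The bound by [C] is obtained for a power of the quantity [t]; the maximum with [1] bounds [t]
   itself without extracting a root. *)
exists K, (Num.max C 1); split=> [|f fn /snP fN /snP fK]; first by rewrite lt_max C0.
apply/snP => alpha x; set a := mlen alpha; have M0 := wseq_gt0 M a.
set F := `|_|.
have F0 : 0 <= F by exact: normr_ge0.
apply: (@le_trans _ _ (hstep R n.+1 ^+ a * F * W N1 x / M a)).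
  by rewrite ler_wpM2r ?invr_ge0 ?(ltW M0)// ler_wpM2l ?wfactor_ge0// wsys_le// leq_maxl.
set t := _ / _.
have t0 : 0 <= t by rewrite divr_ge0 ?(ltW M0)// mulr_ge0 ?wfactor_ge0// ltW.
set q := (2 ^ j)%N; have q0 : (0 < q)%N by rewrite expn_gt0.
have tq : t ^+ q <= C.
  set u := hstep R n ^+ a * F * W N x / M a.
  set v := hstep R k ^+ a * F * W K x / M a.
  have u0 : 0 <= u by rewrite divr_ge0 ?(ltW M0)// mulr_ge0 ?wfactor_ge0// ltW.
  have v0 : 0 <= v by rewrite divr_ge0 ?(ltW M0)// mulr_ge0 ?wfactor_ge0// ltW.
  have v1 : v <= 1 := fK alpha x.
  have u1 : u ^+ q.-1 <= 1 by rewrite exprn_ile1// (fN alpha x).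
  apply: (@le_trans _ _ (C * (u ^+ q.-1 * v))); last first.
    by rewrite ger_pMr// -[leRHS]mulr1 ler_pM// exprn_ge0.
  have -> : t ^+ q = (hstep R n.+1 ^+ q) ^+ a * (F / M a) ^+ q * W N1 x ^+ q.
    rewrite -exprM mulnC exprM -!exprMn; congr (_ ^+ _); rewrite /t.
    by rewrite mulrA [LHS]mulrAC.
  have -> : C * (u ^+ q.-1 * v) = (hstep R n ^+ q.-1 * hstep R k) ^+ a
      * (F / M a) ^+ q * (C * W N x ^+ q.-1 * W K x).
    rewrite [(_ * hstep R k) ^+ a]exprMn -exprM [(q.-1 * a)%N]mulnC exprM.
    have -> : (F / M a) ^+ q = F / M a * (F / M a) ^+ q.-1.
      by rewrite -exprS prednK.
    have -> : u = hstep R n ^+ a * (F / M a) * W N x by rewrite /u mulrA mulrAC.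
    by rewrite /v !exprMn; set A := _ ^+ q.-1; set B := _ ^+ q.-1; ring.
  have FM : 0 <= F / M a by rewrite divr_ge0// ltW.
  apply: ler_pM => //.
  - by rewrite mulr_ge0// exprn_ge0// exprn_ge0// ltW.
  - by rewrite exprn_ge0// ltW.
  - by rewrite ler_wpM2r ?exprn_ge0// lerXn2r// nnegrE ?mulr_ge0 ?exprn_ge0// ltW.
rewrite le_max; have [t1|t1] := leP t 1; first by rewrite orbT.
rewrite orbF; apply: le_trans tq; rewrite -(prednK q0) exprS ler_peMr//.
by rewrite exprn_ege1// ltW.
Qed.

Lemma emb_ex n f : stp n f -> exists g : BR_step M W n, BR_emb g = f.
Proof. by rewrite -range_emb => -[g _ <-]; exists g. Qed.

Lemma lf_wQP : lf_wQ (@BR_emb R d M W) <-> norm_wQ.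
Proof.
split=> [wQ n|wQ n].
  have [U U0 [m [nm H]]] := wQ n.
  have [N [e [e0 eU]]] := (nbhs0_step _).1 U0.
  exists N, m; split=> // k N' mk.
  have W0 : nbhs (0 : BR_step M W m) [set g | sn m N' 1 (BR_emb g)].
    by apply/nbhs0_step; exists N', 1.
  have [X X0 [C [C0 HC]]] := H k mk _ W0.
  have [K [e' [e'0 eV]]] := (nbhs0_step _).1 X0.
  pose r := Num.min e e'; have r0 : 0 < r by rewrite lt_min e0.
  exists K, (r^-1 * complex.Re C); split.
    rewrite mulr_gt0 ?invr_gt0//; move: C0; rewrite ltcE/= => /andP[_]//.
  move=> f fn fN fK.
  have rf n' N'' : sn n' N'' 1 f -> sn n' N'' r (r%:V *: f).
    by move=> /(snZ r); rewrite gtr0_norm// mulr1.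
  have rfn : stp n (r%:V *: f) by exact: stpZ.
  have rfk : stp k (r%:V *: f) by apply: stp_mono rfn; rewrite ltnW// (ltn_trans nm).
  have : (@BR_emb R d M W k @` X `&` @BR_emb R d M W n @` U) (r%:V *: f).
    split; [have [g gf] := emb_ex rfk; exists g => //; apply: eV
           |have [g gf] := emb_ex rfn; exists g => //; apply: eU]; rewrite gf.
      by apply: sn_ler (rf _ _ fK); rewrite ge_min lexx orbT.
    by apply: sn_ler (rf _ _ fN); rewrite ge_min lexx.
  move=> /HC[_ [g gW <-] Cg].
  have -> : f = r^-1%:V *: (r%:V *: f).
    by rewrite scalerA -rmorphM mulVf ?gt_eqF// scale1r.
  rewrite -[r^-1 in X in _ X _]ger0_norm ?invr_ge0 ?ltW//; apply: snZ.
  (* The scalar of (wQ) is complex; being positive, it equals its real part. *)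
  have CE := RRe_real (gtr0_real C0).
  have /ltW/ger0_norm <- : 0 < complex.Re C by rewrite -ltcR CE.
  by rewrite -Cg -CE -[X in sn _ _ X]mulr1; apply: snZ.
have [N [m [nm H]]] := wQ n.
exists [set f | sn n N 1 (BR_emb f)]; first by apply/nbhs0_step; exists N, 1.
exists m; split=> // k mk X /nbhs0_step[N' [e [e0 eX]]].
have [K [C [C0 HC]]] := H k N' mk.
exists [set f | sn k K 1 (BR_emb f)]; first by apply/nbhs0_step; exists K, 1.
have C'0 : 0 < C / e by rewrite divr_gt0.
exists (C / e)%:V; split; first by rewrite ltcR.
move=> _ [[g gK <-] [f fN fg]].
have fn : stp n (BR_emb f) by rewrite -range_emb; exists f.
have {}gK : sn k K 1 (BR_emb f) by rewrite fg.
rewrite -fg.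
have fm := stpZ (C / e)^-1%:V (stp_mono (ltnW nm) fn).
exists ((C / e)^-1%:V *: (BR_emb f : V)).
  have [g' g'f] := emb_ex fm; exists g' => //; apply: eX; rewrite g'f.
  have := snZ (C / e)^-1 (HC _ fn fN gK).
  by rewrite gtr0_norm ?invr_gt0// invf_div divfK ?gt_eqF.
by rewrite scalerA -rmorphM divff ?gt_eqF// scale1r.
Qed.

(* On [U], the topologies at 0 of all the steps from [m] on coincide. *)
Definition coarse (m : nat) (U : set V) : Prop :=
  forall k N (eps : R), (m <= k)%N -> 0 < eps -> exists K (delta : R), 0 < delta /\
  forall f, U f -> sn k K delta f -> sn m N eps f.

(** Passing from [m] to [m.+1] turns the bound [C] into smallness at orders [a >= L], through the
    factor [q ^+ a]. At orders below [L] the norms of the steps [m.+1] and [k] are comparable, with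
    constant [r ^+ L]. *)
Lemma wQ_coarse : norm_wQ -> forall n, exists N m, (n < m)%N /\
  coarse m (stp n `&` sn n N 1).
Proof.
move=> wQ n; have [N [m [nm H]]] := wQ n.
exists N, m.+1; split=> [|k N' eps mk e0]; first exact: ltnW.
have [K [C [C0 HC]]] := H k N' mk.
have h0 := hstep_gt0 R; have w0 := wsys_gt0 W.
pose q := hstep R m.+1 / hstep R m.
have q1 : `|q| < 1.
  by rewrite ger0_norm ?divr_ge0 ?(ltW (h0 _))// ltr_pdivrMr// mul1r hstep_lt.
have /cvgrPdist_le/(_ (eps / C)) := cvg_expr q1.
rewrite divr_gt0// => /(_ isT)[L _ HL].
pose r := (hstep R m.+1 / hstep R k).
have r1 : 1 <= r by rewrite ler_pdivlMr// mul1r hstep_le.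
pose delta := Num.min 1 (eps / r ^+ L).
have delta0 : 0 < delta.
  by rewrite lt_min ltr01 divr_gt0// exprn_gt0// (lt_le_trans ltr01).
exists (maxn K N'), delta; split=> // f [fn fN] fK.
have fK1 : sn k K 1 f.
  by apply: sn_ler (sn_mono (leqnn k) (leq_maxl K N') fK); rewrite ge_min lexx.
have /snP fm := HC f fn fN fK1.
have /snP fk := sn_mono (leqnn k) (leq_maxr K N') fK.
apply/snP => alpha x; set a := mlen alpha.
move: {fm fk} (fm alpha x) (fk alpha x); rewrite -/a.
set F := `|_| => fm fk.
have X0 : 0 <= F * W N' x / M a by rewrite divr_ge0 ?mulr_ge0 ?normr_ge0 ?(ltW (w0 _ _)) ?(ltW (wseq_gt0 _ _)).
have XE n' : hstep R n' ^+ a * F * W N' x / M a = hstep R n' ^+ a * (F * W N' x / M a).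
  by rewrite !mulrA.
rewrite !{}XE in fm fk *; move: X0 fm fk; set X := F * _ / _ => X0 fm fk.
have [aL|La] := ltnP a L.
  have -> : hstep R m.+1 ^+ a = r ^+ a * hstep R k ^+ a.
    by rewrite -exprMn divfK// gt_eqF.
  rewrite -mulrA; apply: (@le_trans _ _ (r ^+ L * (eps / r ^+ L))); last first.
    by rewrite mulrC divfK// gt_eqF// exprn_gt0// (lt_le_trans ltr01).
  apply: ler_pM.
  - by rewrite exprn_ge0// (le_trans ler01).
  - by rewrite mulr_ge0// exprn_ge0// ltW.
  - by rewrite ler_weXn2l// ltnW.
  - by apply: le_trans fk _; rewrite ge_min lexx orbT.
have -> : hstep R m.+1 ^+ a = q ^+ a * hstep R m ^+ a.
  by rewrite -exprMn divfK// gt_eqF.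
have := HL a La; rewrite sub0r normrN.
have qa : 0 <= q ^+ a by rewrite exprn_ge0// divr_ge0// ltW.
rewrite (ger0_norm qa) => qe; rewrite -mulrA -[eps](@divfK _ C) ?gt_eqF//.
by apply: ler_pM => //; rewrite mulr_ge0// exprn_ge0// ltW.
Qed.

End NormWQ.

(** * Nested sets *)

Section NestedSets.
Context (R : realType) (d : nat) (M : weight_sequence R) (W : weight_system R d).
Local Notation V := (BR M W).
Local Notation "c %:V" := (c%:C%C : R[i]) (at level 2, format "c %:V").
Local Notation sn := (@sn R d M W).
Local Notation stp := (@stp R d M W).
Local Notation coarse := (@coarse R d M W).
Implicit Types (U A B : set V) (f g x y : V).

(** The dilate [r U] for [r != 0], written as a preimage so that membership needs no witness. *)
Definition sc (r : R) U : set V := [set x | U (r^-1%:V *: x)].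
Definition addset A B : set V := [set x + y | x in A & y in B].
Definition bl n N (e : R) : set V := stp n `&` sn n N e.

Lemma ac_lin U (a b : R) x y : absconvex U -> `|a| + `|b| <= 1 -> U x -> U y ->
  U (a%:V *: x + b%:V *: y).
Proof.
move=> cU ab; apply: cU.
have nE (r : R) : `|r%:V| = `|r|%:V by rewrite normc_def/= expr0n addr0 sqrtr_sqr.
by rewrite !nE -rmorphD/= lecR.
Qed.

Lemma ac_scale U (a : R) x : absconvex U -> `|a| <= 1 -> U x -> U (a%:V *: x).
Proof.
move=> cU a1 Ux; have := @ac_lin U a 0 x x cU.
by rewrite normr0 addr0 scale0r addr0; apply.
Qed.

Lemma ac_opp U x : absconvex U -> U x -> U (- x).
Proof. by move=> cU Ux; rewrite -scaleN1r -(rmorphN1 (real_complex R)); apply: ac_scale; rewrite ?normrN1. Qed.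

Lemma ac_0 U x : absconvex U -> U x -> U 0.
Proof. by move=> cU /(ac_scale cU (a := 0)); rewrite normr0 scale0r; exact. Qed.

Lemma scE r U x : r != 0 -> sc r U (r%:V *: x) = U x.
Proof. by move=> r0; rewrite /sc/= scalerA -rmorphM mulVf// scale1r. Qed.

Lemma sc1 U : sc 1 U = U.
Proof. by apply/funext => x; rewrite /sc/= invr1 scale1r. Qed.

Lemma scV r U x : r != 0 -> sc r U x -> exists2 u, U u & x = r%:V *: u.
Proof. by move=> r0 rx; eexists; [exact: rx|rewrite scalerA -rmorphM divff// scale1r]. Qed.

Lemma sc_mono r s U : absconvex U -> 0 < r -> r <= s -> sc r U `<=` sc s U.
Proof.
move=> cU r0 rs x /(ac_scale cU (a := r / s)).
have s0 := lt_le_trans r0 rs.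
rewrite ger0_norm ?divr_ge0 ?(ltW r0) ?(ltW s0)// ler_pdivrMr// mul1r => /(_ rs).
by rewrite scalerA -rmorphM mulrAC divff ?gt_eqF// mul1r.
Qed.

Lemma sc_add r s U x y : absconvex U -> 0 < r -> 0 < s -> sc r U x -> sc s U y ->
  sc (r + s) U (x + y).
Proof.
move=> cU r0 s0 rx sy; have rs : 0 < r + s by rewrite addr_gt0.
rewrite /sc/= scalerDr.
have := @ac_lin U (r / (r + s)) (s / (r + s)) _ _ cU _ rx sy.
have cE t : t != 0 -> t / (r + s) * t^-1 = (r + s)^-1.
  by move=> t0; rewrite mulrAC divff// mul1r.
rewrite !scalerA -!rmorphM !cE ?gt_eqF//; apply.
rewrite !ger0_norm ?divr_ge0 ?(ltW r0) ?(ltW s0) ?(ltW rs)//.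
by rewrite -mulrDl divff// gt_eqF.
Qed.

Lemma sc_opp r U x : absconvex U -> sc r U x -> sc r U (- x).
Proof. by move=> cU rx; rewrite /sc/= scalerN; exact: ac_opp. Qed.

Lemma sc_sub r s U x y : absconvex U -> 0 < r -> 0 < s -> sc r U x -> sc s U y ->
  sc (r + s) U (x - y).
Proof. by move=> cU r0 s0 rx /(sc_opp cU); exact: sc_add. Qed.

Lemma sc_sub_mono r U U' : U `<=` U' -> sc r U `<=` sc r U'.
Proof. by move=> UU' x /UU'. Qed.

Lemma ac_sc r U : absconvex U -> absconvex (sc r U).
Proof.
move=> cU a b x y ab rx ry; rewrite /sc/= scalerDr.
by rewrite !scalerA ![r^-1%:V * _]mulrC -!scalerA; exact: cU.
Qed.

Lemma ac_addset A B : absconvex A -> absconvex B -> absconvex (addset A B).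
Proof.
move=> cA cB a b _ _ ab [x1 Ax1 [y1 By1 <-]] [x2 Ax2 [y2 By2 <-]].
exists (a *: x1 + b *: x2); first exact: cA.
exists (a *: y1 + b *: y2); first exact: cB.
by rewrite !scalerDr addrACA.
Qed.

Lemma bl_scale n N (s c c' : R) f : 0 < s -> c <= s * c' -> bl n N c f ->
  bl n N c' (s^-1%:V *: f).
Proof.
move=> s0 cc' [fn fc]; split; first exact: stpZ.
apply: sn_ler (snZ s^-1 fc); rewrite gtr0_norm ?invr_gt0// mulrC ler_pdivrMr//.
by rewrite mulrC.
Qed.

Lemma sn_scale n N (s c c' : R) f : 0 < s -> c <= s * c' -> sn n N c f ->
  sn n N c' (s^-1%:V *: f).
Proof.
move=> s0 cc' fc; apply: sn_ler (snZ s^-1 fc).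
by rewrite gtr0_norm ?invr_gt0// mulrC ler_pdivrMr// mulrC.
Qed.

Lemma snV n N (s c : R) f : 0 < s -> sn n N c (s^-1%:V *: f) -> sn n N (s * c) f.
Proof.
move=> s0 /(snZ s); rewrite gtr0_norm// scalerA -rmorphM divff ?gt_eqF// scale1r.
exact.
Qed.

Lemma ac_bl n N e : absconvex (bl n N e).
Proof.
move=> a b f g ab [fn fe] [gn ge]; split; first exact: stp_lin.
have e0 := sn_ge0 fe.
apply: sn_ler (sn_lin a b fe ge); rewrite -mulrDl -[leRHS]mul1r ler_wpM2r//.
by move: ab; rewrite !normc_def -rmorphD/= lecR; case: a; case: b.
Qed.

Lemma bl_mono n N e n' N' e' : (n <= n')%N -> (N' <= N)%N -> e <= e' ->
  bl n N e `<=` bl n' N' e'.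
Proof.
move=> nn' NN' ee' f [fn fe]; split; first exact: stp_mono fn.
by apply: sn_ler ee' _ _; exact: sn_mono fe.
Qed.

Lemma bl0 n N e : 0 < e -> bl n N e 0.
Proof. by move=> e0; split; [exact: stp0|exact: sn0 (ltW e0)]. Qed.

Lemma bl_absorb n N e f : 0 < e -> stp n f -> exists2 r : R, 0 < r & sc r (bl n N e) f.
Proof.
move=> e0 fn; have [c c0 fc] := sn_pos N fn.
exists (c / e); first by rewrite divr_gt0.
apply: (@bl_scale _ _ _ c) => //; first by rewrite divr_gt0.
by rewrite divfK// gt_eqF.
Qed.

Lemma coarse_sc m U r : 0 < r -> coarse m U -> coarse m (sc r U).
Proof.
move=> r0 cU k N eps mk e0; have [K [D [D0 H]]] := cU k N (eps / r) mk (divr_gt0 e0 r0).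
exists K, (r * D); split=> [|f fU fK]; first exact: mulr_gt0.
have := snV r0 (H _ fU (sn_scale r0 (lexx _) fK)).
by rewrite mulrC divfK ?gt_eqF.
Qed.

Lemma sn_least n N f : stp n f -> exists t : R, [/\ 0 <= t, sn n N t f &
  forall c, sn n N c f -> t <= c].
Proof.
move=> /(_ N)[c fc]; have := fun c => @sn_ge0 R d M W n N c f; move: fc.
rewrite /sn/=; case: bnorm => [r||] fc ge0.
- by exists r; split=> [|//|c']; [exact: (ge0 r (lexx _))|rewrite lee_fin].
- by move: fc; rewrite leye_eq.
- by have := ge0 (-1) (leNye _); rewrite ler0N1.
Qed.

(* The ball is so small that, for [x = a + b] small in a later step, a bound [t]
   on the norm of [a] improves to [(t + 1) / 2]; the least one is at most [1]. *)
Lemma sharp_step U m : norm_wQ M W -> absconvex U -> U `<=` stp m -> coarse m U ->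
  exists m' N (e : R), [/\ (m < m')%N, 0 < e & coarse m' (addset U (bl m N e))].
Proof.
move=> wQ cU Um coU.
have [N0 [m' [mm' S]]] := wQ_coarse wQ m.
have half0 : 0 < 2^-1 :> R by rewrite invr_gt0.
(* [d1] is such that elements of [U] below [d1] have norm at most [1/2]. It will be applied to
   [a / (t + 1) = x / (t + 1) - b / (t + 1)], half of [d1] being reserved for each term; this gives
   [t <= (t + 1) / 2]. *)
have [K1 [d1 [d10 H1]]] := coU m' N0 2^-1 (ltnW mm') half0.
pose e := Num.min 1 (d1 / 2).
have e0 : 0 < e by rewrite lt_min ltr01 divr_gt0.
exists m', (maxn N0 K1), e; split=> // k N' eps m'k eps0.
have d20 : 0 < d1 / 2 by rewrite divr_gt0.
have [K [D [D0 HD]]] := S k K1 (d1 / 2) m'k d20.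
have eps2 : 0 < eps / 2 by rewrite divr_gt0.
have [K' [D' [D'0 HD']]] := S k N' (eps / 2) m'k eps2.
exists (maxn K K'), (Num.min D D'); split; first by rewrite lt_min D0.
move=> _ [a Ua [b [bm be] <-]] abD; set x := a + b in abD *.
have am := Um _ Ua.
have [t [t0 ta tmin]] := sn_least N0 am.
have t1 : 0 < t + 1 by rewrite ltr_wpDl.
have xm : stp m x by exact: stpD.
have bN0 : sn m N0 1 b.
  by apply: sn_ler (sn_mono (leqnn m) (leq_maxl N0 K1) be); rewrite ge_min lexx.
have bK1 : sn m' K1 (d1 / 2) b.
  by apply: sn_ler (sn_mono (ltnW mm') (leq_maxr N0 K1) be); rewrite ge_min lexx orbT.
have xt : sn m N0 (t + 1) x by exact: snD.
have xK : sn k K D x.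
  by apply: sn_ler (sn_mono (leqnn k) (leq_maxl K K') abD); rewrite ge_min lexx.
have xK' : sn k K' D' x.
  by apply: sn_ler (sn_mono (leqnn k) (leq_maxr K K') abD); rewrite ge_min lexx orbT.
have t11 : 1 <= t + 1 by rewrite lerDr.
have s1 : sn m' K1 (d1 / 2) ((t + 1)^-1%:V *: x).
  apply: HD; first by apply: bl_scale t1 _ _; last (by split; first exact: xm; exact: xt); rewrite mulr1.
  by apply: sn_scale t1 _ xK; rewrite ler_peMl// ltW.
have s2 : sn m' K1 d1 ((t + 1)^-1%:V *: a).
  have -> : a = x - b by rewrite addrK.
  rewrite scalerBr [X in sn _ _ X]splitr; apply: snB => //.
  by apply: sn_scale t1 _ bK1; rewrite ler_peMl// ltW.
have s3 : sn m N0 ((t + 1) * 2^-1) a.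
  apply: (snV t1); apply: H1 => //; apply: ac_scale => //.
  by rewrite gtr0_norm ?invr_gt0// invf_le1.
have tle1 : t <= 1 by have := tmin _ s3; lra.
(* As [t <= 1], half of [x] lies in the unit ball on which the topologies agree. *)
have s4 : sn m' N' (eps / 2) (2^-1%:V *: x).
  apply: HD'; first by split; [exact: stpZ|apply: sn_scale xt => //; rewrite mulr1; lra].
  by apply: sn_scale xK' => //; rewrite ler_peMl ?ler1n// ltW.
have := @snV m' N' 2 (eps / 2) x ltac:(by []) s4.
by rewrite mulrC divfK.
Qed.

Record nested := Nested {
  nset :> nat -> set V ;
  nidx : nat -> nat ;
  nN : nat -> nat ;
  neps : nat -> R ;
  nset_ac : forall j, absconvex (nset j) ;
  nset0 : forall j, nset j 0 ;
  nset_stp : forall j, nset j `<=` stp (nidx j) ;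
  nset_coarse : forall j, coarse (nidx j) (nset j) ;
  nidx_lt : forall j, (nidx j < nidx j.+1)%N ;
  neps_gt0 : forall j, 0 < neps j ;
  nsetS : forall j, nset j.+1 = addset (nset j) (bl (nidx j) (nN j) (neps j)) }.

Lemma norm_wQ_nested : norm_wQ M W -> inhabited nested.
Proof.
move=> wQ.
pose good (p : set V * nat) := [/\ absconvex p.1, p.1 0, p.1 `<=` stp p.2 & coarse p.2 p.1].
pose next (p q : {p | good p}) := exists N (e : R), [/\ ((sval p).2 < (sval q).2)%N, 0 < e &
  (sval q).1 = addset (sval p).1 (bl (sval p).2 N e)].
have nextE (p : {p | good p}) : {q | next p q}.
  apply: cid; case: p => -[U m] pg; have [cU U0 Um coU] := pg.
  have [m' [N [e [mm' e0 co']]]] := sharp_step wQ cU Um coU.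
  have q : good (addset U (bl m N e), m').
    split=> //=; first by apply: ac_addset => //; exact: ac_bl.
      by exists 0 => //; exists 0; rewrite ?addr0//; exact: bl0.
    move=> _ [x Ux [y [ym _] <-]]; apply: stp_mono (ltnW mm') _ _.
    by apply: stpD => //; exact: Um.
  by exists (exist _ _ q), N, e; split.
have [N0 [m0 [_ S]]] := wQ_coarse wQ 0%N.
have p0 : good (bl 0 N0 1, m0).
  split=> //=; [exact: ac_bl|exact: bl0|].
  by move=> f [f0 _]; exact: stp_mono f0.
have [F [_ HF]] := dependent_choice nextE (exist _ _ p0).
have [N HN] := choice HF.
have [e He] := choice HN.
by constructor; exists (fun j => (sval (F j)).1) (fun j => (sval (F j)).2) N e => j;
  have [? ? ? ?] := proj2_sig (F j); have [? ? ?] := He j.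
Qed.

End NestedSets.

(** * The topology of the limit *)

Lemma nbhs_lcsE (K : numFieldType) (X : lmodType K) (b : zero_base X)
    (x : lcs_of b) (A : set (lcs_of b)) :
  nbhs x A <-> nbhs (0 : lcs_of b) [set y | A (x + y)].
Proof.
split=> [[U bU UA]|/nbhs0_lcs[U bU UA]]; last by exists U.
by apply/nbhs0_lcs; exists U.
Qed.

Section LimitTopology.
Context (R : realType) (d : nat) (M : weight_sequence R) (W : weight_system R d).
Local Notation V := (BR M W).
Local Notation "c %:V" := (c%:C%C : R[i]) (at level 2, format "c %:V").
Local Notation sn := (@sn R d M W).
Local Notation stp := (@stp R d M W).
Local Notation bl := (@bl R d M W).
Local Notation sc := (@sc R d M W).
Local Notation addset := (@addset R d M W).
Implicit Types (A G : set V) (f g x y : V).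

Lemma nbhs_BRE x A : nbhs x A <-> nbhs (0 : V) [set y | A (x + y)].
Proof. exact: nbhs_lcsE. Qed.

Lemma nbhs0_ac G : nbhs (0 : V) G -> exists U : set V,
  [/\ absconvex U, nbhs (0 : V) U, U `<=` G &
      forall n, exists N (e : R), 0 < e /\ bl n N e `<=` U].
Proof.
move=> /nbhs0_BR[U [cU nU] UG]; exists U; split=> //.
by apply/nbhs0_BR; exists U.
Qed.

Lemma nbhs0_sc (r : R) G : 0 < r -> nbhs (0 : V) G -> nbhs (0 : V) (sc r G).
Proof.
move=> r0 /nbhs0_ac[U [cU nU UG bU]]; apply/nbhs0_BR; exists (sc r U) => [|x /UG//].
split=> [|n]; first exact: ac_sc.
have [N [e [e0 eU]]] := bU n; exists N, (r * e); split; first exact: mulr_gt0.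
by move=> x [xn xe]; apply: eU; exact: (@bl_scale _ _ _ _ _ _ _ (r * e)).
Qed.

Lemma nbhs0_half G : nbhs (0 : V) G -> exists U : set V,
  [/\ absconvex U, nbhs (0 : V) U & forall x y, U x -> U y -> G (x + y)].
Proof.
move=> /nbhs0_ac[U [cU nU UG bU]].
have half0 : 0 < 2^-1 :> R by rewrite invr_gt0.
exists (sc 2^-1 U); split; [exact: ac_sc|exact: nbhs0_sc|move=> x y xU yU].
have half1 : 2^-1 + 2^-1 = 1 :> R by rewrite [RHS]splitr !mul1r.
by apply: UG; have := sc_add cU half0 half0 xU yU; rewrite half1 sc1.
Qed.

Lemma bounded_sc (B : set V) G : lc_bounded (B : set (BR M W : tvsType _)) ->
  nbhs (0 : V) G -> exists2 r : R, 0 < r & B `<=` sc r G.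
Proof.
move=> bB /bB[r r0 BrG]; have rE := RRe_real (gtr0_real r0).
have r'0 : 0 < complex.Re r by rewrite -ltcR rE.
exists (complex.Re r) => // x /BrG[y Gy <-].
by rewrite -rE scE// gt_eqF.
Qed.

Lemma emb_nbhs0 n A : nbhs (0 : V) A -> nbhs (0 : BR_step M W n) (@BR_emb R d M W n @^-1` A).
Proof.
move=> /nbhs0_BR[U [_ /(_ n)[N [e [e0 eU]]]] UA].
apply/nbhs0_step; exists N, e; split=> // f fe; apply: UA; apply: eU; split=> //.
by rewrite -range_emb; exists f.
Qed.

Lemma embD n (f g : BR_step M W n) : BR_emb (f + g) = (BR_emb f : V) + BR_emb g.
Proof. exact/val_inj. Qed.

(** [L] is the number of summands and [l] the first index. Peeling off the first summand makes the
    tails available for induction. *)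
Fixpoint sumset (w : nat -> set V) (L l : nat) : set V :=
  if L is L'.+1 then addset (w l) (sumset w L' l.+1) else [set 0].

Section SumSet.
Context (w : nat -> set V) (w_ac : forall i, absconvex (w i)) (w0 : forall i, w i 0).

Lemma sumset_ac L l : absconvex (sumset w L l).
Proof.
elim: L l => [|L IH] l /=; last exact: ac_addset.
by move=> a b x y _ -> ->; rewrite !scaler0 addr0.
Qed.

Lemma sumset_mono L l : sumset w L l `<=` sumset w L.+1 l.
Proof.
elim: L l => [|L IH] l x /=; first by move=> ->; exists 0 => //; exists 0; rewrite ?addr0.
by move=> [a wa [y Ly <-]]; exists a => //; exists y => //; exact: IH.
Qed.

Lemma sumset_le L L' l : (L <= L')%N -> sumset w L l `<=` sumset w L' l.
Proof.
move=> /subnK <-; elim: (_ - _)%N => [//|k IH]; apply: subset_trans IH _.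
exact: sumset_mono.
Qed.

Lemma sumset_term i l : w (l + i)%N `<=` sumset w i.+1 l.
Proof.
elim: i l => [|i IH] l x wx; first by exists x; rewrite ?addn0 in wx *; [|exists 0; rewrite ?addr0].
by exists 0 => //; exists x; rewrite ?add0r//; apply: IH; rewrite addSnnS.
Qed.

End SumSet.

(** Since every ball contains 0, two sums can be given the same length, so the union over all
    lengths is absolutely convex; it contains a ball of every step because [n i >= i]. *)
Lemma nbhs0_sumset (n N : nat -> nat) (e : nat -> R) : (forall i, (i <= n i)%N) ->
  (forall i, 0 < e i) ->
  nbhs (0 : V) [set x | exists L, sumset (fun i => bl (n i) (N i) (e i)) L 0 x].
Proof.
move=> ni e0; pose w i := bl (n i) (N i) (e i).
have wac i : absconvex (w i) by exact: ac_bl.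
have w0 i : w i 0 by exact: bl0.
apply/nbhs0_BR; exists [set x | exists L, sumset w L 0 x] => //; split.
  move=> a b x y ab [L Lx] [L' Ly]; exists (maxn L L'); apply: sumset_ac => //.
    by apply: sumset_le Lx; rewrite ?leq_maxl.
  by apply: sumset_le Ly; rewrite ?leq_maxr.
move=> i; exists (N i), (e i); split=> // x xi; exists i.+1.
by apply: (@sumset_term w w0 i 0); apply: bl_mono xi.
Qed.

(** Evaluations of derivatives are continuous on the limit, since in every step a single norm
    controls them. This is why the norm balls are closed in the limit topology. *)
Lemma nbhs0_deriv (alpha : {ffun 'I_d -> nat}) (y : 'rV[R]_d) (c : R) : 0 < c ->
  nbhs (0 : V) [set f : V | `|mderiv alpha (BR_val f) y : Rcomplex R| <= c].
Proof.
move=> c0; apply/nbhs0_BR; eexists; last exact: subset_refl.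
split=> [a b f g ab /= fc gc|n].
  have -> : mderiv alpha (a *: BR_val f + b *: BR_val g) y =
      a * mderiv alpha (BR_val f) y + b * mderiv alpha (BR_val g) y.
    rewrite mderiv_lin; [|exact: BR_smooth|].
      by rewrite -[b *: _]addr0 mderiv_lin ?mderiv0 ?addr0//; [exact: BR_smooth|exact: smooth0].
    by rewrite -[b *: _]addr0; apply: smooth_lin; [exact: BR_smooth|exact: smooth0].
  have nM (u v : R[i]) : `|(u * v : Rcomplex R)| = `|u : Rcomplex R| * `|v : Rcomplex R|.
    exact: Normc.normcM.
  have := @ler_normD _ (Rcomplex R) (a * mderiv alpha (BR_val f) y) (b * mderiv alpha (BR_val g) y).
  move/le_trans; apply; rewrite !nM.
  apply: (@le_trans _ _ (`|a : Rcomplex R| * c + `|b : Rcomplex R| * c)).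
    by rewrite lerD// ler_wpM2l.
  rewrite -mulrDl -[leRHS]mul1r ler_wpM2r ?(ltW c0)//.
  by move: ab; rewrite !normc_def -rmorphD/= lecR; case: (a); case: (b).
exists 0%N; set h := hstep R n ^+ mlen alpha; set m := M (mlen alpha).
have h0 : 0 < h by rewrite exprn_gt0// hstep_gt0.
have m0 : 0 < m := wseq_gt0 _ _; have w0 := wsys_gt0 W 0 y.
exists (c * (h * W 0 y / m)); split=> [|f [_ /snP/(_ alpha y)]/=].
  by rewrite mulr_gt0// divr_gt0// mulr_gt0.
rewrite -/h -/m; set F := `|_|.
have -> : h * F * W 0 y / m = F * (h * W 0 y / m) by ring.
by rewrite ler_pM2r// divr_gt0// mulr_gt0.
Qed.

Lemma sn_closed n N (c : R) x :
  (forall G, nbhs (0 : V) G -> exists2 z, sn n N c z & G (x - z)) -> sn n N c x.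
Proof.
move=> xG; apply/snP => alpha y; apply/ler_addgt0Pr => e e0.
set h := hstep R n ^+ mlen alpha; set m := M (mlen alpha).
have h0 : 0 < h by rewrite exprn_gt0// hstep_gt0.
have m0 : 0 < m := wseq_gt0 _ _; have w0 := wsys_gt0 W N y.
have k0 : 0 < h * W N y / m by rewrite divr_gt0// mulr_gt0.
have [z zc /= zx] := xG _ (@nbhs0_deriv alpha y _ (divr_gt0 e0 k0)).
have /snP/(_ alpha y) := zc; rewrite -/h -/m => {}zc.
have -> : BR_val x = 1%:C%C *: BR_val (x - z) + BR_val z.
  by rewrite scale1r -[in LHS](subrK z x).
rewrite mderiv_lin; [|exact: BR_smooth|exact: BR_smooth].
rewrite scale1r; set a := mderiv _ _; set b := mderiv _ _.
have kE r : h * r * W N y / m = r * (h * W N y / m) by ring.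
rewrite kE -/b in zc; rewrite kE; rewrite -/a in zx.
apply: (@le_trans _ _ ((`|a y : Rcomplex R| + `|b y : Rcomplex R|) * (h * W N y / m))).
  by rewrite ler_wpM2r ?(ltW k0)//; exact: (@ler_normD _ (Rcomplex R) (a y) (b y)).
by rewrite mulrDl addrC lerD// -ler_pdivlMr.
Qed.

Section Nested.
Context (F : nested M W).

Lemma nidx_ge j : (j <= nidx F j)%N.
Proof. by elim: j => [//|j IH]; exact: leq_ltn_trans (nidx_lt F j). Qed.

Lemma nset_leS j : F j `<=` F j.+1.
Proof.
move=> x Fx; rewrite nsetS; exists x => //; exists 0; last exact: addr0.
by apply: bl0; exact: neps_gt0.
Qed.

Lemma nset_le i j : (i <= j)%N -> F i `<=` F j.
Proof.
move=> /subnK <-; elim: (_ - _)%N => [//|k IH]; apply: subset_trans IH _.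
exact: nset_leS.
Qed.

Lemma bl_nsetS j : bl (nidx F j) (nN F j) (neps F j) `<=` F j.+1.
Proof.
by move=> x xb; rewrite nsetS; exists 0; [exact: nset0|exists x; rewrite ?add0r].
Qed.

(* A neighborhood of 0 in the limit is made of finite sums of elements of balls in
   the steps; their tails are controlled by downward induction, each tail lying
   in a multiple of the next nested set. *)
Lemma limit_coarse j N (eps r : R) : 0 < eps -> 0 < r -> exists2 A, nbhs (0 : V) A &
  forall x, sc r (F j) x -> A x -> sn (nidx F j) N eps x.
Proof.
move=> eps0 r0.
suff: forall eps : {posnum R}, exists2 A, nbhs (0 : V) A &
    forall x, F j x -> A x -> sn (nidx F j) N eps%:num x.
  move=> /(_ (PosNum (divr_gt0 eps0 r0)))[A nA AF].
  exists (sc r A) => [|x rx Ax]; first exact: nbhs0_sc.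
  by have := snV r0 (AF _ rx Ax); rewrite /= mulrC divfK// gt_eqF.
move=> {eps0 r0} {}eps.
(* From the tolerance required at level [l], coarseness of the dilate of [F (j + l)] by [l + 1]
   yields a tolerance at level [l + 1]. It is halved, one half for the summand taken from the ball
   and one for the remaining tail. *)
have step (lp : nat * (nat * {posnum R})) : exists q : nat * {posnum R},
    forall x, sc lp.1.+1%:R (F (j + lp.1)%N) x -> sn (nidx F (j + lp.1).+1) q.1 (q.2%:num *+ 2) x ->
    sn (nidx F (j + lp.1)) lp.2.1 lp.2.2%:num x.
  case: lp => l [K e] /=.
  have co := @coarse_sc _ _ _ _ _ _ l.+1%:R (ltr0Sn _ _) (@nset_coarse _ _ _ _ F (j + l)%N).
  have [K' [D [D0 H]]] := co (nidx F (j + l).+1) K e%:num (ltnW (nidx_lt F _)) [gt0 of e%:num].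
  exists (K', PosNum (divr_gt0 D0 (ltr0Sn R 1))) => x Fx /= xD.
  by apply: H => //; rewrite -[D](@divfK _ 2)// mulr_natr.
have {step}[q Hq] := choice step.
pose p := nat_rect (fun=> (nat * {posnum R})%type) (N, eps) (fun l p => q (l, p)).
pose n i := nidx F (j + i).
pose N' i := maxn (nN F (j + i)) (p i.+1).1.
pose e' i := Num.min (neps F (j + i)) (p i.+1).2%:num.
have e'0 i : 0 < e' i by rewrite lt_min neps_gt0/=.
have ni i : (i <= n i)%N by apply: leq_trans (nidx_ge _); exact: leq_addl.
exists [set x | exists L, sumset (fun i => bl (n i) (N' i) (e' i)) L 0 x].
  exact: nbhs0_sumset.
move=> x Fx [L xL].
suff: forall l x, sc l.+1%:R (F (j + l)%N) x ->
    sumset (fun i => bl (n i) (N' i) (e' i)) L l x -> sn (n l) (p l).1 (p l).2%:num x.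
  by move=> /(_ 0%N x); rewrite sc1 /n addn0 => /(_ Fx xL).
elim: L {x Fx xL} => [|L IH] l x xl /=; first by move=> ->; exact: sn0.
move=> [w [wn wl] [y yL xE]]; have yE : y = x - w by rewrite -xE addrC addKr.
have wF : F (j + l).+1%N w.
  apply: bl_nsetS; apply: (@bl_mono _ _ _ _ (n l) (N' l) (e' l)) => //.
    by rewrite leq_maxl.
  by rewrite ge_min lexx.
(* Each removed summand lies in the next nested set and costs one unit of dilation, whence the
   factor [l + 1] at level [l]. *)
have yl : sc l.+2%:R (F (j + l.+1)%N) y.
  rewrite yE addnS -natr1; apply: sc_sub => //; last by rewrite sc1.
    exact: nset_ac.
  by apply: sc_sub_mono xl; exact: nset_leS.
have := IH _ _ yl yL; rewrite /n addnS => ysn.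
apply: (Hq (l, p l)) => //=; rewrite -/(p l.+1) -xE mulr2n; apply: snD => //.
apply: (@sn_ler _ _ _ _ _ _ (e' l)); first by rewrite ge_min lexx orbT.
apply: (sn_mono (ltnW (nidx_lt F _)) _ wl); exact: leq_maxr.
Qed.

Lemma bl_finite m (H : nat -> set V) L :
  (forall n, exists N (e : R), 0 < e /\ bl m N e `<=` H n) ->
  exists N (e : R), 0 < e /\ forall n, (n <= L)%N -> bl m N e `<=` H n.
Proof.
move=> HH; elim: L => [|L [N [e [e0 IH]]]].
  have [N [e [e0 eH]]] := HH 0%N; exists N, e; split=> // n.
  by rewrite leqn0 => /eqP ->.
have [N' [e' [e'0 eH]]] := HH L.+1.
exists (maxn N N'), (Num.min e e'); split=> [|n]; first by rewrite lt_min e0.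
rewrite leq_eqVlt => /orP[/eqP->|nL]; [apply: subset_trans eH|apply: subset_trans (IH _ nL)].
  by apply: bl_mono; rewrite ?leq_maxr// ge_min lexx orbT.
by apply: bl_mono; rewrite ?leq_maxl// ge_min lexx.
Qed.

(** The ball of index [l] is fitted into [2^-(l+1) F (l + 1)] and into [2^-(l+1) G' n] for the
    finitely many [n <= l]. In a finite sum, the terms of index below [n] then add up inside [F n]
    and the others inside [G n]. A single neighborhood can thus contradict countably many choices at
    once. *)
Lemma nbhs0_addset (G : nat -> set V) : (forall n, nbhs (0 : V) (G n)) ->
  exists2 A, nbhs (0 : V) A & forall n, A `<=` addset (F n) (G n).
Proof.
move=> nG.
have [G' HG'] := choice (fun n => nbhs0_ac (nG n)).
pose h l : R := 2^-1 ^+ l.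
have h0 l : 0 < h l by rewrite exprn_gt0// invr_gt0.
have hS l : h l = h l.+1 + h l.+1 by rewrite [LHS]splitr /h exprS mulrC.
have h1 l : h l <= 1 by rewrite exprn_ile1 ?invr_ge0// invf_le1// ler1n.
have scbl m A r : 0 < r -> (exists N (e : R), 0 < e /\ bl m N e `<=` A) ->
    exists N (e : R), 0 < e /\ bl m N e `<=` sc r A.
  move=> r0 [N [e [e0 eA]]]; exists N, (r * e); split; first exact: mulr_gt0.
  by move=> x xe; apply: eA; exact: (@bl_scale _ _ _ _ _ _ _ (r * e)).
have step l : exists Ne : nat * R, [/\ 0 < Ne.2,
    bl (nidx F l) Ne.1 Ne.2 `<=` sc (h l.+1) (F l.+1) &
    forall n, (n <= l)%N -> bl (nidx F l) Ne.1 Ne.2 `<=` sc (h l.+1) (G' n)].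
  have [|N [e [e0 eG]]] := @bl_finite (nidx F l) (fun n => sc (h l.+1) (G' n)) l.
    by move=> n; apply: scbl => //; have [_ _ _] := HG' n.
  have [|N' [e' [e'0 eF]]] := scbl (nidx F l) (F l.+1) _ (h0 l.+1).
    by exists (nN F l), (neps F l); split; [exact: neps_gt0|exact: bl_nsetS].
  exists (maxn N N', Num.min e e'); split=> /= [||n nl]; first by rewrite lt_min e0.
    apply: subset_trans eF.
    by apply: bl_mono; rewrite ?leq_maxr// ge_min lexx orbT.
  apply: subset_trans (eG _ nl).
  by apply: bl_mono; rewrite ?leq_maxl// ge_min lexx.
have {step}[Ne HNe] := choice step.
pose w i := bl (nidx F i) (Ne i).1 (Ne i).2.
exists [set x | exists L, sumset w L 0 x].
  by apply: nbhs0_sumset => [|i]; [exact: nidx_ge|have [] := HNe i].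
move=> n x [L xL]; have [cG' /nbhs_singleton G'0 G'G _] := HG' n.
have tail L' l y : (n <= l)%N -> sumset w L' l y -> sc (h l) (G' n) y.
  elim: L' l y => [|L' IH] l y nl /=; first by move=> ->; rewrite /sc/= scaler0.
  move=> [a wa [z zL <-]]; rewrite hS; apply: sc_add => //.
    by have [_ _ /(_ _ nl)] := HNe l; exact.
  by apply: IH zL; exact: leqW.
suff: forall l, (l <= n)%N -> forall x, sumset w L l x ->
    addset (sc (h l) (F n)) (G' n) x.
  move=> /(_ 0%N (leq0n _) x xL)[a aF [b bG <-]]; exists a.
    by move: aF; rewrite /h expr0 sc1.
  by exists b => //; exact: G'G.
elim: L {x xL} => [|L IH] l ln x /=.
  move=> ->; exists 0; last by exists 0; rewrite ?addr0.
  by rewrite /sc/= scaler0; exact: nset0.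
have [ln'|nl] := ltnP l n; last first.
  move=> xL; exists 0; first by rewrite /sc/= scaler0; exact: nset0.
  exists x; last exact: add0r.
  have := @tail L.+1 l x nl xL; rewrite -{2}[G' n]sc1; exact: sc_mono.
move=> [a wa [y yL <-]]; have [b bF [c cG bcy]] := IH _ ln' _ yL.
exists (a + b); last by exists c => //; rewrite -addrA bcy.
rewrite hS; apply: sc_add => //; first exact: nset_ac.
have [_ aF _] := HNe l; apply: sc_sub_mono (aF _ wa).
exact: nset_le.
Qed.

(** Two points of [F j] near [x] in the limit are near each other, hence, by coarseness on [2 F j],
    also in a given norm of the step. Norm balls being closed, such a point is near [x] in that
    norm, and the error fits into the ball by which [F j.+1] extends [F j]. *)
Lemma closure_nset j x : (forall G, nbhs (0 : V) G -> addset (F j) G x) -> F j.+1 x.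
Proof.
move=> xcl.
have cF := @nset_ac _ _ _ _ F j.
have approx N eps : 0 < eps -> exists2 u, F j u & sn (nidx F j) N eps (x - u).
  move=> eps0; have [A nA AF] := @limit_coarse j N eps 2 eps0 ltac:(by []).
  have [A' [cA' nA' A'A]] := nbhs0_half nA.
  have [u Fu [y A'y uyx]] := xcl _ nA'; exists u => //.
  apply: sn_closed => G nG.
  have [u' Fu' [y' [Gy' A'y'] u'yx]] := xcl _ (filterI nG nA').
  exists (u' - u); last by rewrite opprB addrA subrK -u'yx addrC addKr.
  have uuy : u' - u = y - y'.
    by apply/eqP; rewrite subr_eq addrAC eq_sym subr_eq [y + u]addrC uyx u'yx.
  apply: AF; last by rewrite uuy; apply: A'A => //; exact: ac_opp.
  by rewrite (_ : 2 = 1 + 1)//; apply: sc_sub => //; rewrite sc1.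
have [u Fu xu] := approx (nN F j) _ (neps_gt0 F j).
rewrite nsetS; exists u => //; exists (x - u); last by rewrite addrC subrK.
(* The point [u] makes only one norm of [x - u] small; the finiteness of each other norm comes from
   another approximant. *)
split=> // N; have [u' Fu' xu'] := approx N 1 ltr01.
have [c uc] := nset_stp Fu N; have [c' uc'] := nset_stp Fu' N.
exists (1 + c' + c); apply: snB => //.
by rewrite -(subrK u' x); exact: snD.
Qed.

(** If no dilate contains [B], then, by [closure_nset], for each [j] some point of [B] divided by
    [j + 1] avoids [F j] plus a neighborhood. A neighborhood inside all these sums would not absorb
    [B]. *)
Lemma bounded_nset (B : set V) : lc_bounded (B : set (BR M W : tvsType _)) ->
  exists2 r : R, 0 < r & exists j, B `<=` sc r (F j).
Proof.
move=> bB; apply: contrapT => nB.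
have bad j : exists bG : V * set V, [/\ B bG.1, nbhs (0 : V) bG.2 &
    ~ addset (F j) bG.2 (j.+1%:R^-1%:V *: bG.1)].
  apply: contrapT => nj; apply: nB; exists j.+1%:R; first by [].
  exists j.+1 => b Bb; rewrite /sc/=; apply: closure_nset => G nG.
  by apply: contrapT => ?; apply: nj; exists (b, G); split.
have {bad}[bG HbG] := choice bad.
have [A nA AF] := @nbhs0_addset (fun j => (bG j).2) ltac:(by move=> n; have [] := HbG n).
have [U [cU nU UA _]] := nbhs0_ac nA.
have [r r0 BrU] := bounded_sc bB nU.
pose j := Num.truncn r.
have [/BrU bU _] := HbG j; apply; apply: AF; apply: UA.
have rj : r <= j.+1%:R by rewrite ltW// truncnS_gt.
exact: sc_mono cU r0 rj _ bU.
Qed.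

Lemma nested_boundedly_retractive : lf_boundedly_retractive (@BR_emb R d M W).
Proof.
move=> B /bounded_nset[r r0 [j BF]]; exists (nidx F j).
have BS x : B x -> stp (nidx F j) x.
  move=> /BF; rewrite -[x in stp _ x](scale1r x) -[1](rmorph1 (real_complex R)).
  rewrite -[X in X%:V *: x](@divff _ r) ?gt_eqF// rmorphM -scalerA => xF.
  exact/stpZ/nset_stp.
split; first by rewrite range_emb.
have cF := @nset_ac _ _ _ _ F j.
apply/seteqP; split=> _ [X + <-]; rewrite openE => oX.
  exists (@BR_emb R d M W (nidx F j) @^-1` X).
    rewrite openE => f /= fO; apply/nbhs_lcsE.
    have : nbhs (BR_emb f : V) X by exact: oX.
    move=> /nbhs_BRE/(@emb_nbhs0 (nidx F j)); apply: filterS => g /=.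
    by rewrite embD.
  apply/seteqP; split=> x; first by move=> [Bx [f fO fx]]; split=> //; rewrite -fx.
  by move=> [Bx Ox]; split=> //; have [f fx] := emb_ex (BS _ Bx); exists f; rewrite //= fx.
(* Points outside [B] belong to [Z] for free, so it is enough to compare the two topologies along
   differences of points of [B], which stay in [2 r F j]. *)
pose Z : set V := [set x | B x -> (@BR_emb R d M W (nidx F j) @` X) x].
exists Z°; first exact: open_interior.
apply/seteqP; split=> x [Bx Ox]; split=> //; first exact: (interior_subset Ox).
have [f fO fx] := Ox; apply/nbhs_BRE.
have /nbhs_lcsE/nbhs0_step[N [e [e0 eO]]] : nbhs f X by exact: oX.
have [A nA AF] := @limit_coarse j N e (r + r) e0 ltac:(by rewrite addr_gt0).
apply: filterS nA => y Ay Bxy /=.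
have yF : sc (r + r) (F j) y.
  have -> : y = (x + y) - x by rewrite addrC addKr.
  by apply: sc_sub => //; exact: BF.
have yS : stp (nidx F j) y.
  have -> : y = (x + y) - x by rewrite addrC addKr.
  by apply: stpB; exact: BS.
have [g gy] := emb_ex yS; exists (f + g); last by rewrite embD fx gy.
by apply: eO; rewrite gy; exact: AF.
Qed.

End Nested.
End LimitTopology.

(** * Regularity *)

Section Cauchy.
Context (K : numFieldType) (X : lmodType K) (b : zero_base X).

Lemma lcs_entourageE (A : set (lcs_of b * lcs_of b)) : entourage A <->
  exists2 U : set (lcs_of b), nbhs (0 : lcs_of b) U & forall x y, U (x - y) -> A (x, y).
Proof.
split=> [[U [U0 UA]]|[U U0 UA]].
  by exists U => // x y Uxy; have := UA (x, y); rewrite !inE; apply.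
by exists U; split=> // -[x y]; rewrite !inE; exact: UA.
Qed.

Lemma lcs_cauchyP (F : set_system (lcs_of b)) : ProperFilter F -> cauchy F <->
  forall G : set (lcs_of b), nbhs (0 : lcs_of b) G ->
  exists2 A, F A & forall x y, A x -> A y -> G (x - y).
Proof.
move=> FF; split=> [cF G G0|H A].
  have [|[P Q] /= [FP FQ] PQ] := cF [set xy | G (xy.1 - xy.2)].
    by apply/lcs_entourageE; exists G.
  exists (P `&` Q); first exact: filterI.
  by move=> x y [Px _] [_ Qy]; exact: (PQ (x, y)).
move=> /lcs_entourageE[U U0 UA]; have [B FB BU] := H U U0.
by exists (B, B) => //= -[x y] [Bx By]; apply: UA; exact: BU.
Qed.

End Cauchy.

Section Regularity.
Context (R : realType) (d : nat) (M : weight_sequence R) (W : weight_system R d).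
Local Notation V := (BR M W).
Local Notation "c %:V" := (c%:C%C : R[i]) (at level 2, format "c %:V").
Local Notation sn := (@sn R d M W).
Local Notation stp := (@stp R d M W).
Local Notation bl := (@bl R d M W).
Local Notation sc := (@sc R d M W).
Local Notation BRemb n := (@BR_emb R d M W n).
Implicit Types (A G : set V) (f g x y : V).

Lemma bounded_in_step n (B : set V) : (forall N, exists c, B `<=` sn n N c) <->
  exists A : set (BR_step M W n), lc_bounded A /\ BRemb n @` A = B.
Proof.
split=> [BN|[A [bA <-]] N].
  have Bn : B `<=` range (BRemb n).
    by move=> x Bx; rewrite range_emb => N; have [c Bc] := BN N; exists c; exact: Bc.
  exists (BRemb n @^-1` B); split; last first.
    by apply/seteqP; split=> [_ [f Bf <-]//|x Bx]; have [f _ fx] := Bn x Bx; exists f; rewrite /preimage /= ?fx.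
  move=> U /nbhs0_step[N [e [e0 eU]]]; have [c Bc] := BN N.
  pose r := (`|c| + 1) / e.
  have c0 : 0 < `|c| + 1 by rewrite ltr_wpDl.
  have r0 : 0 < r by rewrite divr_gt0.
  exists r%:V; first by rewrite ltcR.
  move=> f Bf; exists (r^-1%:V *: f); last by rewrite scalerA -rmorphM divff ?gt_eqF// scale1r.
  apply: eU; apply: (@sn_scale _ _ _ _ _ _ r c e (BR_emb f)) => //; last exact: Bc.
  by rewrite divfK ?gt_eqF// (le_trans (ler_norm _))// lerDl.
have [|r r0 Ar] := bA [set f | sn n N 1 (BR_emb f)].
  by apply/nbhs0_step; exists N, 1.
exists `|r : Rcomplex R| => _ [f Af <-]; have [g g1 <-] := Ar _ Af.
have := sn_lin r 0 (g1 : sn n N 1 (BR_emb g)) g1.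
by rewrite normr0 mul0r scale0r !addr0 mulr1.
Qed.

(** The hypothesis is applied to the absolutely convex hull [H] of [B]. If a neighborhood, dilated
    by [r], contains [B], then dividing by [r + 1] moves [B] into that neighborhood without leaving
    [H], where the topology of the step is known to be the same; so [r + 1] bounds the norm on
    [B]. *)
Lemma boundedly_retractive_regular : lf_boundedly_retractive (@BR_emb R d M W) -> lf_regular (@BR_emb R d M W).
Proof.
move=> br B bB.
pose H : set V := [set x | forall A, absconvex A -> B `<=` A -> A x].
have BH : B `<=` H by move=> x Bx A _; exact.
have acH : absconvex H.
  move=> a b x y ab Hx Hy A cA BA.
  exact: (cA a b x y ab (Hx A cA BA) (Hy A cA BA)).
have HG G : nbhs (0 : V) G -> exists2 r : R, 0 < r & H `<=` sc r G.
  move=> /nbhs0_ac[U [cU nU UG _]]; have [r r0 BU] := bounded_sc bB nU.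
  by exists r => // x Hx; apply: UG; apply: (Hx _ (ac_sc cU) BU).
have bH : lc_bounded (H : set (BR M W : tvsType _)).
  move=> G /HG[r r0 HrG]; exists r%:V; first by rewrite ltcR.
  by move=> x /HrG rG; have [|u Gu ->] := scV _ rG; [rewrite gt_eqF|exists u].
have [n [Hn Htop]] := br H bH; exists n.
apply/bounded_in_step => N.
(* The hull of the empty set is empty, so an element of [B] is needed for [0] to lie in [H]. *)
have [[b0 Bb0]|B0] := pselect (exists b, B b); last first.
  by exists 0 => x Bx; exfalso; apply: B0; exists x.
have H0 : H 0 by exact: ac_0 acH (BH _ Bb0).
pose Q : set (BR_step M W n) := [set f | sn n N 1 (BR_emb f)]°.
have Q0 : Q 0 by apply/nbhs0_step; exists N, 1.
have : [set H `&` BRemb n @` Y | Y in @open (BR_step M W n)] (H `&` BRemb n @` Q).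
  by exists Q => //; exact: open_interior.
rewrite -Htop => -[Y oY HY].
have Y0 : nbhs (0 : V) Y.
  move: oY; rewrite openE => oY; have [_ Y0] : (H `&` Y) 0.
    by rewrite HY; split=> //; exists 0 => //; exact/val_inj.
  exact: (oY 0 Y0).
have [U [cU nU UY _]] := nbhs0_ac Y0.
have [r r0 HU] := HG _ nU.
have r1 : 0 < r + 1 by rewrite addr_gt0.
exists ((r + 1) * 1) => x Bx; apply: (snV r1).
have Hx : H ((r + 1)^-1%:V *: x).
  apply: (ac_scale acH); last exact: BH.
  by rewrite gtr0_norm ?invr_gt0// invf_le1// lerDr ltW.
have : (H `&` Y) ((r + 1)^-1%:V *: x).
  split=> //; apply: UY.
  have rr1 : r <= r + 1 by rewrite lerDl.
  exact: sc_mono cU r0 rr1 _ (HU _ (BH _ Bx)).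
by rewrite HY => -[_ [f /interior_subset fN <-]].
Qed.

(* The set [B] collects functions witnessing the failure of [norm_wQ] at one
   fixed [n] against all larger [m] at once. *)
Lemma regular_norm_wQ : lf_regular (@BR_emb R d M W) -> norm_wQ M W.
Proof.
move=> reg n; apply: contrapT => nwQ.
(* The norm index [N] is tied to [m], and both [K] and [C] to [i], so that the witnesses form a
   double sequence. *)
have bad m : exists kN : nat * nat, (n < m)%N -> (m < kN.1)%N /\
    forall i : nat, exists f : V, [/\ stp n f, sn n m 1 f, sn kN.1 i 1 f &
      ~ sn m kN.2 i%:R f].
  apply: contrapT => H; apply: nwQ; exists m, m.
  have [nm|mn] := ltnP n m; last by exfalso; apply: H; exists (0%N, 0%N); rewrite ltnNge mn.
  split=> // k N' mk; apply: contrapT => H'; apply: H; exists (k, N') => _.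
  split=> // i; apply: contrapT => H''; apply: H'.
  (* The constant must be positive even for [i = 0]; exceeding [i + 1] implies exceeding [i]. *)
  exists i, i.+1%:R; split=> // f fn fm fk.
  apply: contrapT => ff; apply: H''; exists f; split=> //.
  by apply: contra_not ff; apply: sn_ler; rewrite ler_nat.
have {bad}[kN HkN] := choice bad.
have phiE (mi : nat * nat) : exists f : V, (n < mi.1)%N -> [/\ stp n f, sn n mi.1 1 f,
    sn (kN mi.1).1 mi.2 1 f & ~ sn mi.1 (kN mi.1).2 mi.2%:R f].
  have [nm|_] := boolP (n < mi.1)%N; last by exists 0.
  by have [_ /(_ mi.2)[f Hf]] := HkN _ nm; exists f.
have {phiE}[phi Hphi] := choice phiE.
pose B : set V := [set f | exists m i, (n < m)%N /\ f = phi (m, i)].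
have bB : lc_bounded (B : set (BR M W : tvsType _)).
  suff H G : nbhs (0 : V) G -> exists2 r : R, 0 < r & B `<=` sc r G.
    move=> G /H[r r0 BrG]; exists r%:V; first by rewrite ltcR.
    by move=> x /BrG rG; have [|u Gu ->] := scV _ rG; [rewrite gt_eqF|exists u].
  move=> /nbhs0_ac[U [cU nU UG bU]].
  suff [r r0 Br] : exists2 r : R, 0 < r & B `<=` sc r U.
    by exists r => // x /Br; exact: UG.
  have [N [e [e0 eU]]] := bU n.
  (* All rows [m >= N] lie in one ball of step [n]. In each of the finitely many other rows, all but
     finitely many entries lie in one ball of step [(kN m).1]. *)
  have tail m i : (n < m)%N -> (N <= m)%N -> sc e^-1 U (phi (m, i)).
    move=> nm Nm; have [/= fn fm _ _] := Hphi (m, i) nm.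
    apply: eU; apply: (@bl_scale _ _ _ _ _ _ _ 1); rewrite ?invr_gt0//.
      by rewrite mulVf// gt_eqF.
    by split=> //; exact: sn_mono fm.
  have U0 : U 0 by exact: nbhs_singleton.
  have one m : (n < m)%N -> exists2 r : R, 0 < r & forall i, sc r U (phi (m, i)).
    move=> nm; have [N' [e' [e'0 eU']]] := bU (kN m).1.
    have mk : (n <= (kN m).1)%N by have [mk _] := HkN _ nm; rewrite ltnW// (ltn_trans nm).
    have fin L : exists2 r : R, 0 < r & forall i, (i < L)%N -> sc r U (phi (m, i)).
      elim: L => [|L [r r0 IH]]; first by exists 1.
      have [/= fn _ _ _] := Hphi (m, L) nm.
      have [s s0 sU] := @bl_absorb _ _ _ _ n N e (phi (m, L)) e0 fn.
      exists (r + s) => [|i]; first exact: addr_gt0.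
      rewrite ltnS leq_eqVlt => /orP[/eqP->|iL].
        apply: (@sc_mono _ _ _ _ s) => //; first by rewrite lerDr ltW.
        exact: sc_sub_mono sU.
      by apply: (@sc_mono _ _ _ _ r) (IH _ iL) => //; rewrite lerDl ltW.
    have [r r0 Hr] := fin N'.
    exists (r + e'^-1) => [|i]; first by rewrite addr_gt0 ?invr_gt0.
    have [iN|Ni] := ltnP i N'.
      by apply: (@sc_mono _ _ _ _ r) (Hr _ iN) => //; rewrite lerDl invr_ge0 ltW.
    apply: (@sc_mono _ _ _ _ e'^-1); rewrite ?invr_gt0// ?lerDr ?ltW//.
    have [/= fn _ fk _] := Hphi (m, i) nm.
    apply: eU'; apply: (@bl_scale _ _ _ _ _ _ _ 1); rewrite ?invr_gt0//.
      by rewrite mulVf// gt_eqF.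
    by split; [exact: stp_mono fn|exact: sn_mono fk].
  have many L : exists2 r : R, 0 < r & forall m i, (n < m < L)%N -> sc r U (phi (m, i)).
    elim: L => [|L [r r0 IH]]; first by exists 1 => // m i; rewrite ltn0 andbF.
    have [nL|Ln] := ltnP n L; last first.
      exists r => // m i /andP[nm]; rewrite ltnS => mL.
      by have := leq_trans nm (leq_trans mL Ln); rewrite ltnn.
    have [s s0 sU] := one _ nL.
    exists (r + s) => [|m i /andP[nm]]; first exact: addr_gt0.
    rewrite ltnS leq_eqVlt => /orP[/eqP->|mL].
      by apply: (@sc_mono _ _ _ _ s) => //; rewrite lerDr ltW.
    apply: (@sc_mono _ _ _ _ r) => //; first by rewrite lerDl ltW.
    by apply: IH; rewrite nm.
  have [r r0 Hr] := many N.
  exists (r + e^-1) => [|_ [m [i [nm ->]]]]; first by rewrite addr_gt0 ?invr_gt0.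
  have [mN|Nm] := ltnP m N.
    apply: (@sc_mono _ _ _ _ r) => //; first by rewrite lerDl invr_ge0 ltW.
    by apply: Hr; rewrite nm.
  apply: (@sc_mono _ _ _ _ e^-1); rewrite ?invr_gt0// ?lerDr ?ltW//.
  exact: tail.
have [m' HA] := reg B bB.
pose m := maxn m' n.+1.
have nm : (n < m)%N by rewrite leq_maxr.
have /(_ (kN m).2)[c Bc] := (@bounded_in_step m' B).2 HA.
have [_ _ _ /=] := Hphi (m, (Num.truncn c).+1) nm; apply.
apply: sn_mono (leq_maxl m' n.+1) (leqnn _) _ _.
apply: (@sn_ler _ _ _ _ _ _ c); first by rewrite ltW// truncnS_gt.
by apply: Bc; exists m, (Num.truncn c).+1.
Qed.

End Regularity.

(** * Completeness implies regularity *)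

Section CompleteRegular.
Context (R : realType) (d : nat) (M : weight_sequence R) (W : weight_system R d).
Local Notation V := (BR M W).
Local Notation "c %:V" := (c%:C%C : R[i]) (at level 2, format "c %:V").
Local Notation sn := (@sn R d M W).
Local Notation stp := (@stp R d M W).
Local Notation sc := (@sc R d M W).
Local Notation idx := (({ffun 'I_d -> nat} * 'rV[R]_d)%type).
Implicit Types (A G : set V) (f g y : V) (p : idx).

Definition ev (n N : nat) p f : R :=
  hstep R n ^+ mlen p.1 * `|mderiv p.1 (BR_val f) p.2 : Rcomplex R| * W N p.2 / M (mlen p.1).

Lemma sn_ev n N c f : sn n N c f <-> forall p, ev n N p f <= c.
Proof. by rewrite snP; split=> [H [a x]|H a x]; [exact: H|exact: (H (a, x))]. Qed.

Lemma ev_factor_gt0 n N p : 0 < hstep R n ^+ mlen p.1 * W N p.2 / M (mlen p.1).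
Proof.
by rewrite divr_gt0 ?wseq_gt0// mulr_gt0 ?wsys_gt0// exprn_gt0// hstep_gt0.
Qed.

Lemma evE n N p f : ev n N p f =
  hstep R n ^+ mlen p.1 * W N p.2 / M (mlen p.1) * `|mderiv p.1 (BR_val f) p.2 : Rcomplex R|.
Proof. by rewrite /ev; ring. Qed.

Lemma mderiv_BRD alpha f g x : mderiv alpha (BR_val (f + g)) x =
  mderiv alpha (BR_val f) x + mderiv alpha (BR_val g) x.
Proof.
have -> : BR_val (f + g) = 1 *: BR_val f + BR_val g by rewrite scale1r.
by rewrite mderiv_lin; [rewrite scale1r|exact: BR_smooth|exact: BR_smooth].
Qed.

Lemma mderiv_BRZ alpha (a : R[i]) f x : mderiv alpha (BR_val (a *: f)) x =
  a * mderiv alpha (BR_val f) x.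
Proof.
have -> : BR_val (a *: f) = a *: BR_val f + 0 by rewrite addr0.
by rewrite mderiv_lin ?mderiv0 ?addr0//; [exact: BR_smooth|exact: smooth0].
Qed.

Lemma evD n N p f g : ev n N p (f + g) <= ev n N p f + ev n N p g.
Proof.
rewrite !evE -mulrDr ler_wpM2l ?(ltW (ev_factor_gt0 _ _ _))// mderiv_BRD.
exact: (@ler_normD _ (Rcomplex R)).
Qed.

Lemma evZ n N p (a : R) f : ev n N p (a%:V *: f) = `|a| * ev n N p f.
Proof.
rewrite !evE mderiv_BRZ -normc_real mulrCA; congr (_ * _).
exact: Normc.normcM.
Qed.

Lemma evN n N p f : ev n N p (- f) = ev n N p f.
Proof. by rewrite -scaleN1r -(rmorphN1 (real_complex R)) evZ normrN1 mul1r. Qed.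

Lemma ev_sign n N p f g : ev n N p g <= ev n N p (f + g) \/ ev n N p g <= ev n N p (f - g).
Proof.
have [|H1] := leP (ev n N p g) (ev n N p (f + g)); first by left.
have [|H2] := leP (ev n N p g) (ev n N p (f - g)); first by right.
have := evD n N p (f + g) (- (f - g)).
have -> : f + g - (f - g) = 2%:V *: g.
  rewrite opprB addrC addrA subrK.
  by rewrite (_ : 2 = 1 + 1)// rmorphD scalerDl scale1r.
by rewrite evZ evN gtr0_norm//; lra.
Qed.

Lemma nbhs0_ev n N p (c : R) : 0 < c -> nbhs (0 : V) [set f | ev n N p f <= c].
Proof.
move=> c0; have k0 := ev_factor_gt0 n N p.
have := @nbhs0_deriv R d M W p.1 p.2 _ (divr_gt0 c0 k0).
by apply: filterS => f /=; rewrite evE ler_pdivlMr// mulrC.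
Qed.

(* Gliding hump: if [B] is bounded in no step, then signed multiples of suitable
   elements of [B] sum up to an [y] all of whose step norms are infinite. The
   sign is chosen so that the new hump is not cancelled by the earlier ones, and
   each step is visited infinitely often, as [t] has [logn 2 t.+1 = m] for
   infinitely many [t]. *)
Lemma complete_regular : lc_complete (BR M W) -> lf_regular (@BR_emb R d M W).
Proof.
move=> cpl B bB; apply: contrapT => nreg.
have unb n : exists N, forall c : R, exists zp : V * idx, B zp.1 /\ c < ev n N zp.2 zp.1.
  apply: contrapT => H; apply: nreg; exists n; apply/bounded_in_step => N.
  apply: contrapT => H'; apply: H; exists N => c.
  apply: contrapT => H''; apply: H'; exists c => z Bz; apply/sn_ev => p.
  by have [//|cz] := leP; exfalso; apply: H''; exists (z, p).
have {unb}[N HN] := choice unb.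
pose E t p f := ev (logn 2 t.+1) (N (logn 2 t.+1)) p f.
have Ebd t p : exists2 b : R, 0 < b & forall z, B z -> E t p z <= b.
  have [r r0 Br] := bounded_sc bB (@nbhs0_ev (logn 2 t.+1) (N (logn 2 t.+1)) p 1 ltr01).
  exists r => // z /Br; rewrite /sc/= evZ gtr0_norm ?invr_gt0// mulrC ler_pdivrMr//.
  by rewrite mul1r.
pose h t : R := 2^-1 ^+ t.
have h0 t : 0 < h t by rewrite exprn_gt0// invr_gt0.
have hS t : h t = h t.+1 + h t.+1 by rewrite [LHS]splitr /h exprS mulrC.
(* A stage carries the partial sum and a number [b >= 1] that bounds, on [B], the evaluations at all
   earlier humps. Dividing the new coefficient by [b] protects these humps. *)
have step (q : nat * (V * R)) : exists q' : idx * (V * R), 1 <= q.2.2 ->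
    [/\ q.2.2 <= q'.2.2, q.1%:R + 2 <= E q.1 q'.1 q'.2.1,
        forall z, B z -> E q.1 q'.1 z <= q'.2.2 &
        exists a z, [/\ B z, `|a| <= h q.1.+1 / q.2.2 & q'.2.1 = q.2.1 + a%:V *: z]].
  case: q => t [s b] /=; have [b1|] := boolP (1 <= b); last by exists ((0, 0), (0, 0)).
  have b0 : 0 < b := lt_le_trans ltr01 b1.
  pose e := h t.+1 / b; have e0 : 0 < e by rewrite divr_gt0.
  have [[z p] /= [Bz zp]] := HN (logn 2 t.+1) ((t%:R + 2) / e).
  have [b' b'0 Hb'] := Ebd t p.
  have ez : t%:R + 2 <= E t p (e%:V *: z).
    by rewrite /E evZ gtr0_norm// mulrC -ler_pdivrMr// ltW.
  have [H|H] := ev_sign (logn 2 t.+1) (N (logn 2 t.+1)) p s (e%:V *: z).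
    exists (p, (s + e%:V *: z, Num.max b b')) => _; split=> /=.
    - by rewrite le_max lexx.
    - exact: le_trans H.
    - by move=> z' /Hb' /le_trans; apply; rewrite le_max lexx orbT.
    - by exists e, z; rewrite gtr0_norm.
  exists (p, (s - e%:V *: z, Num.max b b')) => _; split=> /=.
  - by rewrite le_max lexx.
  - exact: le_trans H.
  - by move=> z' /Hb' /le_trans; apply; rewrite le_max lexx orbT.
  - by exists (- e), z; rewrite normrN gtr0_norm// rmorphN scaleNr.
have {step}[q Hq] := choice step.
pose st := nat_rect (fun=> (V * R)%type) (0, 1) (fun t sb => (q (t, sb)).2).
pose p t := (q (t, st t)).1.
pose s t := (st t).1; pose b t := (st t).2.
have b1 t : 1 <= b t.
  elim: t => [|t IH]; first exact: lexx.
  by have [bb _ _ _] := Hq (t, st t) IH; apply: le_trans bb.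
have bS t : b t <= b t.+1 by have [bb _ _ _] := Hq (t, st t) (b1 t).
have bmono i j : (i <= j)%N -> b i <= b j.
  by move=> /subnK <-; elim: (_ - _)%N => [//|k IH]; apply: le_trans IH _; exact: bS.
have hump t : t%:R + 2 <= E t (p t) (s t.+1) by have [_ ? _ _] := Hq (t, st t) (b1 t).
have EB t z : B z -> E t (p t) z <= b t.+1.
  by have [_ _ H _] := Hq (t, st t) (b1 t); exact: H.
have sS t : exists a z, [/\ B z, `|a| <= h t.+1 / b t & s t.+1 = s t + a%:V *: z].
  by have [_ _ _ ?] := Hq (t, st t) (b1 t).
(* For [l > t], the coefficient of the term added at stage [l] is at most [h l.+1 / b l], and [b l]
   bounds the evaluation at hump [t] on [B]; the geometric series sums to at most [h l]. *)
have Etail t l k : (t < l)%N -> E t (p t) (s (l + k)%N - s l) <= h l.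
  elim: k l => [|k IH] l tl.
    by rewrite addn0 subrr -(scale0r (0 : V)) -[0 in X in X <= _](rmorph0 (real_complex R)) /E evZ normr0 mul0r ltW.
  have -> : s (l + k.+1)%N - s l = (s (l.+1 + k)%N - s l.+1) + (s l.+1 - s l).
    by rewrite addrA subrK addSnnS.
  apply: le_trans (evD _ _ _ _ _) _; rewrite hS; apply: lerD; first exact: (IH _ (leqW tl)).
  have [a [z [Bz az ->]]] := sS l; rewrite addrC addKr evZ.
  have bl0 : 0 < b l := lt_le_trans ltr01 (b1 l).
  have -> : h l.+1 = h l.+1 / b l * b l by rewrite divfK// gt_eqF.
  apply: ler_pM => //; last exact: le_trans (EB t z Bz) (bmono _ _ tl).
  by rewrite evE mulr_ge0// ltW// ev_factor_gt0.
have tail U r l k : absconvex U -> 0 < r -> B `<=` sc r U ->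
    sc (r * h l) U (s (l + k)%N - s l).
  move=> cU r0 BU; elim: k l => [|k IH] l.
    have [_ [z [Bz _ _]]] := sS 0%N.
    by rewrite addn0 subrr /sc/= scaler0; exact: ac_0 cU (BU _ Bz).
  have -> : s (l + k.+1)%N - s l = (s (l.+1 + k)%N - s l.+1) + (s l.+1 - s l).
    by rewrite addrA subrK addSnnS.
  rewrite hS mulrDr; apply: (sc_add cU (mulr_gt0 r0 (h0 _)) (mulr_gt0 r0 (h0 _)) (IH l.+1)).
  have [a [z [Bz az ->]]] := sS l; rewrite addrC addKr.
  have bl0 : 0 < b l := lt_le_trans ltr01 (b1 l).
  have ah : `|a / h l.+1| <= 1.
    rewrite normrM normfV (gtr0_norm (h0 _)) ler_pdivrMr// mul1r (le_trans az)//.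
    by rewrite ler_pdivrMr// ler_peMr// ltW.
  have := ac_scale cU ah (BU _ Bz); rewrite /sc/= !scalerA -!rmorphM.
  by rewrite invfM (_ : a / h l.+1 * r^-1 = r^-1 / h l.+1 * a)//; ring.
pose F := s @ \oo.
have cF : cauchy (F : set_system (BR M W)).
  apply/lcs_cauchyP => G G0; have [U [cU nU UG]] := nbhs0_half G0.
  have [r r0 BU] := bounded_sc bB nU.
  have [l hl] : exists l, r * h l <= 1.
    have q1 : `|2^-1 : R| < 1 by rewrite gtr0_norm ?invr_gt0// invf_lt1// ltr1n.
    have /cvgrPdist_le/(_ r^-1) := cvg_expr q1.
    rewrite invr_gt0// => /(_ r0)[l _ /(_ l (leqnn l)) /=].
    rewrite sub0r normrN ger0_norm ?(ltW (h0 l))// => hl; exists l.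
    by rewrite -ler_pdivlMl// mulr1.
  have sU k : U (s (l + k)%N - s l).
    rewrite -(sc1 U); apply: sc_mono hl _ (tail U r l k cU r0 BU) => //.
    exact: mulr_gt0.
  exists [set s (l + k)%N | k in setT].
    by exists l => // k /= lk; exists (k - l)%N => //; rewrite subnKC.
  move=> _ _ [k _ <-] [k' _ <-].
  have -> : s (l + k)%N - s (l + k')%N = (s (l + k)%N - s l) + (- (s (l + k')%N - s l)).
    by rewrite opprB addrA subrK.
  by apply: UG => //; exact: ac_opp.
have [y Fy] := cpl F _ cF.
have [m ym] := stp_cover y.
have [c yc] := ym (N m).
(* [t.+1] is [2 ^ m] times an odd number chosen large enough for [t >= c], so that stage [t] treats
   the step [m]. *)
pose t := (2 ^ m * (2 * (Num.truncn c).+1).+1).-1.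
have t1 : t.+1 = (2 ^ m * (2 * (Num.truncn c).+1).+1)%N by rewrite prednK// muln_gt0 expn_gt0.
have tm : logn 2 t.+1 = m.
  rewrite t1 lognM ?expn_gt0// pfactorK// logn_coprime ?addn0//.
  by rewrite coprime2n mul2n oddS odd_double.
have ct : c <= t%:R.
  apply: (@le_trans _ _ (Num.truncn c).+1%:R); first by rewrite ltW// truncnS_gt.
  rewrite ler_nat -ltnS t1; apply: leq_trans (leq_pmull _ _); last by rewrite expn_gt0.
  lia.
have Ey : E t (p t) y <= c by rewrite /E tm; have /sn_ev := yc; apply.
have := Fy [set x | E t (p t) (x - y) <= 2^-1].
case.
  apply/nbhs_BRE; have := @nbhs0_ev (logn 2 t.+1) (N (logn 2 t.+1)) (p t) 2^-1.
  rewrite invr_gt0 => /(_ (ltr0Sn _ 1)); apply: filterS => x /=.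
  by rewrite /E addrC addKr.
move=> L _ /(_ (t.+1 + L)%N (leq_addl _ _)) /= HL.
have H1 := Etail t t.+1 L (ltnSn t).
have H2 := hump t.
have h1 : h t.+1 <= 2^-1 by rewrite /h exprS ger_pMr ?invr_gt0// exprn_ile1 ?invr_ge0// invf_le1// ler1n.
have H3 : E t (p t) (s t.+1) <= E t (p t) (s (t.+1 + L)%N - s t.+1) + E t (p t) (s (t.+1 + L)%N).
  rewrite -[X in X + _]evN; apply: le_trans (evD _ _ _ _ _).
  by rewrite opprB subrK.
have H4 : E t (p t) (s (t.+1 + L)%N) <= E t (p t) (s (t.+1 + L)%N - y) + E t (p t) y.
  by apply: le_trans (evD _ _ _ _ _); rewrite subrK.
have half1 : 2^-1 + 2^-1 = 1 :> R by rewrite [RHS]splitr !mul1r.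
(* Altogether [t + 2 <= 1/2 + 1/2 + t], which is absurd. *)
have := le_trans H2 (le_trans H3 (lerD (le_trans H1 h1)
  (le_trans H4 (lerD HL (le_trans Ey ct))))).
by rewrite [2^-1 + (_ + _)]addrA half1 [1 + _]addrC lerD2l (ler_nat R 2 1).
Qed.

End CompleteRegular.

(** * Completeness *)

Section ComplexParts.
Context (R : realType).
Implicit Types (z w : Rcomplex R) (b : bool).

(** The boolean lets both coordinates share one proof: the mean value theorem is available for
    real-valued functions only and is applied to each part. *)
Definition part b z : R := if b then complex.Im z else complex.Re z.

Lemma partD b z w : part b (z + w) = part b z + part b w.
Proof. by case: b z w => -[? ?] [? ?]. Qed.

Lemma partN b z : part b (- z) = - part b z.
Proof. by case: b z => -[? ?]. Qed.

Lemma partB b z w : part b (z - w) = part b z - part b w.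
Proof. by rewrite partD partN. Qed.

Lemma partZ b (k : R) z : part b (k *: z) = k * part b z.
Proof. by case: b z => -[? ?]. Qed.

Lemma part_le b z : `|part b z| <= `|z|.
Proof.
have sq (x y : R) : `|x| <= Num.sqrt (x ^+ 2 + y ^+ 2).
  by rewrite -sqrtr_sqr ler_wsqrtr// lerDl sqr_ge0.
by case: b z => -[x y]; rewrite /part /Num.norm/=; [rewrite addrC|]; exact: sq.
Qed.

Lemma le_parts z : `|z| <= `|part false z| + `|part true z|.
Proof.
case: z => x y; rewrite /part/= {1}/Num.norm/=.
rewrite -[leRHS]ger0_norm ?addr_ge0// -sqrtr_sqr ler_wsqrtr//.
rewrite sqrrD !real_normK ?num_real// addrAC lerDl mulrn_wge0//.
Qed.

Lemma part_continuous b : continuous (part b : Rcomplex R -> R).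
Proof.
move=> z; have zF := @nbhs_filter (Rcomplex R) z.
apply/cvgrPdist_lt => e e0.
have := @nbhsx_ballx R (Rcomplex R) z _ e0; rewrite -ball_normE.
by apply: filterS => w; rewrite -partB; apply: le_lt_trans; exact: part_le.
Qed.

Lemma part_inj z w : (forall b, part b z = part b w) -> z = w.
Proof. by case: z w => [a c] [a' c'] H; have := H false; have := H true; rewrite /part/= => -> ->. Qed.

Lemma Rcomplex_cauchy_lim (u : nat -> Rcomplex R) :
  (forall e : R, 0 < e -> exists L, forall i j, (L <= i)%N -> (L <= j)%N -> `|u i - u j| <= e) ->
  exists l : Rcomplex R, forall e : R, 0 < e -> exists L, forall i, (L <= i)%N -> `|u i - l| <= e.
Proof.
move=> cu.
have lim b : exists l : R, part b (u i) @[i --> \oo] --> l.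
  apply/cvg_ex; apply/cauchy_cvgP; apply: cauchy_exP => e e0.
  have [|L HL] := cu (e / 2); first by rewrite divr_gt0.
  exists (part b (u L)); exists L => // i /= Li; rewrite /ball/= -partB.
  apply: le_lt_trans (part_le _ _) _; apply: le_lt_trans (HL _ _ (leqnn L) Li) _.
  by rewrite ltr_pdivrMr// ltr_pMr// ltr1n.
have [x Hx] := lim false; have [y Hy] := lim true.
exists (x +i* y)%C => e e0; have e2 : 0 < e / 2 by rewrite divr_gt0.
have /cvgrPdist_le/(_ _ e2)[L _ HL] := Hx.
have /cvgrPdist_le/(_ _ e2)[L' _ HL'] := Hy.
exists (maxn L L') => i; rewrite geq_max => /andP[Li Li'].
apply: le_trans (le_parts _) _; rewrite !partB [leRHS]splitr lerD//.
  by rewrite distrC; exact: HL.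
by rewrite distrC; exact: HL'.
Qed.

End ComplexParts.

(** * Mean values along lines and symmetry of mixed derivatives *)

Section LineDerivatives.
Context (R : realType) (d : nat).
Local Notation fct := ('rV[R]_d -> Rcomplex R).
Implicit Types (f g : fct) (x v : 'rV[R]_d) (b : bool) (i j : 'I_d).

Lemma is_derive_part b f x v (t : R) : derivable f (x + t *: v) v ->
  is_derive t (1 : R) (fun s : R => part b (f (x + s *: v)))
    (part b ('D_v f (x + t *: v))).
Proof.
move=> df.
have H : (fun h : R => h^-1 *: (((fun s : R => part b (f (x + s *: v))) \o shift t) (h *: 1)
    - part b (f (x + t *: v)))) @ 0^' --> part b ('D_v f (x + t *: v)).
  have -> : (fun h : R => h^-1 *: (((fun s : R => part b (f (x + s *: v))) \o shift t) (h *: 1)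
    - part b (f (x + t *: v)))) = part b \o
    (fun h : R => h^-1 *: ((f \o shift (x + t *: v)) (h *: v) - f (x + t *: v))).
    apply/funext => h /=; rewrite partZ partB; congr (_ * (part b (f _) - _)).
    by rewrite [h *: 1]mulr1 scalerDl addrCA.
  by apply: continuous_cvg; [exact: part_continuous|exact: df].
apply: DeriveDef; last exact: cvg_lim H.
by apply/cvg_ex; exists (part b ('D_v f (x + t *: v))).
Qed.

Lemma part_MVT b f x v (T : R) : 0 < T -> (forall y, derivable f y v) ->
  exists2 c, 0 < c < T & part b (f (x + T *: v)) - part b (f x) =
    T * part b ('D_v f (x + c *: v)).
Proof.
move=> T0 df.
have dp t := @is_derive_part b f x v t (df _).
have [c cT E] := @MVT R _ (fun t => part b ('D_v f (x + t *: v))) 0 T T0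
  (fun t _ => dp t) (derivable_within_continuous (fun t _ => @ex_derive _ _ _ _ _ _ _ (dp t))).
exists c; first by move: cT; rewrite in_itv.
by move: E; rewrite scale0r addr0 subr0 mulrC.
Qed.

(** The factor 2 is the price of applying the mean value theorem to the real and imaginary parts
    separately. *)
Lemma line_lipschitz f x v (T C : R) : (forall y, derivable f y v) ->
  (forall t, `|t| <= `|T| -> `|'D_v f (x + t *: v)| <= C) ->
  `|f (x + T *: v) - f x| <= 2 * C * `|T|.
Proof.
move=> df.
have pos y S : 0 < S -> (forall t, 0 < t < S -> `|'D_v f (y + t *: v)| <= C) ->
    `|f (y + S *: v) - f y| <= 2 * C * S.
  move=> S0 dC.
  have H b : `|part b (f (y + S *: v) - f y)| <= C * S.
    rewrite partB; have [c cS ->] := part_MVT b y S0 df.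
    rewrite normrM gtr0_norm// mulrC ler_pM2r//.
    by apply: le_trans (part_le _ _) _; apply: dC.
  apply: le_trans (le_parts _) _; rewrite -mulrA mulr_natl mulr2n.
  exact: lerD.
have [T0|T0|<-] := ltgtP 0 T => dC; last by rewrite scale0r addr0 subrr !normr0 mulr0.
  rewrite (gtr0_norm T0); apply: pos => // t /andP[t0 tT]; apply: dC.
  by rewrite !gtr0_norm// ltW.
have T'0 : 0 < - T by rewrite oppr_gt0.
have := pos (x + T *: v) (- T) T'0; rewrite scaleNr addrK distrC (ltr0_norm T0); apply.
move=> t /andP[t0 tT]; rewrite -addrA -scalerDl; apply: dC.
by rewrite !ler0_norm ?(ltW T0)//; lra.
Qed.

(* The second difference of [f] at [x] equals [T ^+ 2] times either mixed
   derivative at a point near [x]. *)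
Lemma partialC f i j : (forall y, derivable f y (delta_mx 0 i)) ->
  (forall y, derivable f y (delta_mx 0 j)) ->
  (forall y, derivable (partial i f) y (delta_mx 0 j)) ->
  (forall y, derivable (partial j f) y (delta_mx 0 i)) ->
  continuous (partial i (partial j f)) -> continuous (partial j (partial i f)) ->
  partial i (partial j f) = partial j (partial i f).
Proof.
move=> di dj dij dji cij cji; apply/funext => x; apply: part_inj => b.
have key k l : (forall y, derivable f y (delta_mx 0 k)) ->
    (forall y, derivable (partial k f) y (delta_mx 0 l)) -> forall T : R, 0 < T ->
    exists t s, [/\ 0 < t < T, 0 < s < T &
      part b (f (x + T *: delta_mx 0 k + T *: delta_mx 0 l)) -
      part b (f (x + T *: delta_mx 0 k)) - part b (f (x + T *: delta_mx 0 l)) + part b (f x)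
      = T * (T * part b (partial l (partial k f) (x + t *: delta_mx 0 k + s *: delta_mx 0 l)))].
  move=> dk dkl T T0.
  pose g : fct := fun y => f (y + T *: delta_mx 0 l) - f y.
  have dsh y : is_derive y (delta_mx 0 k : 'rV[R]_d)
      (fun y => f (y + T *: delta_mx 0 l)) (partial k f (y + T *: delta_mx 0 l)).
    have E : (fun h : R => h^-1 *: (((fun y => f (y + T *: delta_mx 0 l)) \o shift y)
        (h *: (delta_mx 0 k : 'rV[R]_d)) - f (y + T *: delta_mx 0 l))) =
      (fun h : R => h^-1 *: ((f \o shift (y + T *: delta_mx 0 l))
        (h *: (delta_mx 0 k : 'rV[R]_d)) - f (y + T *: delta_mx 0 l))).
      by apply/funext => h /=; rewrite addrA.
    by apply: DeriveDef; rewrite /derivable /derive E//; exact: dk.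
  have dg y : is_derive y (delta_mx 0 k : 'rV[R]_d) g
      (partial k f (y + T *: delta_mx 0 l) - partial k f y).
    by apply: is_deriveB; apply: derivableP.
  have [t tT Et] := @part_MVT b g x (delta_mx 0 k) T T0
    (fun y => @ex_derive _ _ _ _ _ _ _ (dg y)).
  have [s sT Es] := @part_MVT b (partial k f) (x + t *: delta_mx 0 k) (delta_mx 0 l) T T0 dkl.
  exists t, s; split=> //.
  have [_ Dg] := dg (x + t *: delta_mx 0 k).
  by rewrite Dg partB Es /g !partB in Et; rewrite -Et; ring.
apply/eqP; rewrite -subr_eq0 -normr_le0; apply/ler_addgt0Pr => e e0; rewrite add0r.
have e2 : 0 < e / 2 by rewrite divr_gt0.
have near_part (g : fct) v w : continuous g -> exists2 r : R, 0 < r & forall t s,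
    0 < t < r -> 0 < s < r ->
    `|part b (g x) - part b (g (x + t *: v + s *: w))| <= e / 2.
  move=> cg; have cpg := continuous_comp (cg x) (@part_continuous R b (g x)).
  have /cvgrPdist_le/(_ _ e2)/nbhs_normP[r0 /= r00 H] := cpg.
  have n0 : 0 < `|v| + `|w| + 1 by rewrite ltr_wpDl// addr_ge0.
  exists (r0 / (`|v| + `|w| + 1)) => [|t s /andP[t0 tr] /andP[s0 sr]]; first exact: divr_gt0.
  apply: H; rewrite /= -addrA opprD addrA subrr sub0r normrN.
  apply: le_lt_trans (ler_normD _ _) _; rewrite !normrZ !gtr0_norm//.
  have E : r0 = r0 / (`|v| + `|w| + 1) * (`|v| + `|w| + 1) by rewrite divfK// gt_eqF.
  rewrite {}E; move: tr sr; set q := r0 / _ => tr sr.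
  have := ler_wpM2r (normr_ge0 v) (ltW tr); have := ler_wpM2r (normr_ge0 w) (ltW sr).
  have : 0 < q by exact: lt_trans tr.
  by rewrite !mulrDr mulr1; lra.
have [r r0 Hr] := near_part _ (delta_mx 0 j) (delta_mx 0 i) cij.
have [r' r'0 Hr'] := near_part _ (delta_mx 0 i) (delta_mx 0 j) cji.
pose T := Num.min r r'; have T0 : 0 < T by rewrite lt_min r0.
have [t [s [tT sT E]]] := key j i dj dji T T0.
have [t' [s' [t'T s'T E']]] := key i j di dij T T0.
have lt_r u : 0 < u < T -> 0 < u < r by rewrite lt_min => /and3P[-> -> _].
have lt_r' u : 0 < u < T -> 0 < u < r' by rewrite lt_min => /and3P[-> _ ->].
have mulTI (a c : R) : T * (T * a) = T * (T * c) -> a = c.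
  by move=> /(mulfI (lt0r_neq0 T0))/(mulfI (lt0r_neq0 T0)).
have EE : part b (partial i (partial j f) (x + t *: delta_mx 0 j + s *: delta_mx 0 i)) =
    part b (partial j (partial i f) (x + t' *: delta_mx 0 i + s' *: delta_mx 0 j)).
  apply: mulTI; apply: etrans (etrans (esym E) _) E'.
  by rewrite [x + _ + _]addrAC [_ - part b (f (x + T *: delta_mx 0 j)) - _]addrAC.
have H1 := Hr t s (lt_r _ tT) (lt_r _ sT).
have H2 := Hr' t' s' (lt_r' _ t'T) (lt_r' _ s'T).
rewrite EE in H1; rewrite distrC in H2.
rewrite [leRHS]splitr; apply: le_trans (lerD H1 H2).
apply: le_trans (ler_normD _ _).
by rewrite addrA subrK.
Qed.

End LineDerivatives.

Lemma zmod_telescope (V : zmodType) (a b c a' b' c' : V) :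
  (a - c) - (a' - c') = ((a - b) - (a' - b')) + ((b - c) - (b' - c')).
Proof.
have k x y z : x - y + (y - z) = x - z :> V by rewrite addrA subrK.
by rewrite addrACA -opprD !k.
Qed.

Lemma count_flatten_nseq (T : eqType) (a : T -> nat) (l : seq T) (j : T) : uniq l ->
  count_mem j (flatten [seq nseq (a k) k | k <- l]) = if j \in l then a j else 0%N.
Proof.
elim: l => [//|k l IH] /= /andP[kl ul]; rewrite count_cat IH// count_nseq/= inE [j == k]eq_sym.
by case: eqP => [<-|_]; rewrite ?(negbTE kl) ?mul1n ?addn0.
Qed.

(** * Locally uniform limits of smooth functions *)

Section LocallyUniformLimits.
Context (R : realType) (d : nat).
Local Notation fct := ('rV[R]_d -> Rcomplex R).
Implicit Types (f g : fct) (x v : 'rV[R]_d) (i j : 'I_d) (s : seq 'I_d).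

Lemma foldr_partialC f s i j : smooth f ->
  partial i (partial j (foldr (@partial R d) f s)) =
  partial j (partial i (foldr (@partial R d) f s)).
Proof.
move=> sf.
have [_ D] := sf s; have [_ Di] := sf (i :: s); have [_ Dj] := sf (j :: s).
have [Cij _] := sf [:: i, j & s]; have [Cji _] := sf [:: j, i & s].
exact: partialC (D i) (D j) (Di j) (Dj i) Cij Cji.
Qed.

Lemma foldr_partial_perm f s s' : smooth f -> perm_eq s s' ->
  foldr (@partial R d) f s = foldr (@partial R d) f s'.
Proof.
move=> sf.
have front s1 s2 j : foldr (@partial R d) f (s1 ++ j :: s2) =
    foldr (@partial R d) f (j :: s1 ++ s2).
  elim: s1 => [//|i s1 IH] /=; rewrite IH /=; exact: foldr_partialC.
elim: s s' => [|j s IH] s' ss'; first by move: ss'; rewrite perm_sym => /perm_nilP ->.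
have js' : j \in s' by rewrite -(perm_mem ss') mem_head.
case/splitPr: js' ss' => s1 s2; rewrite perm_sym -(cat1s j s2) perm_catCA perm_cons.
by rewrite perm_sym => /IH ss'; rewrite cat1s front /= ss'.
Qed.

(** The norms bound derivatives taken in the standard order only, whereas smoothness of a limit
    concerns all orders of differentiation; the symmetry of mixed derivatives links the two. *)
Lemma foldr_partial_mderiv f s : smooth f ->
  foldr (@partial R d) f s = mderiv [ffun j => count_mem j s] f.
Proof.
move=> sf; rewrite mderiv_foldr; apply: foldr_partial_perm => //.
apply/allP => j _ /=; apply/eqP.
by rewrite count_flatten_nseq ?enum_uniq// mem_enum ffunE.
Qed.

Definition lucvg (u : nat -> fct) g : Prop := forall x, exists2 r : R, 0 < r &
  forall e : R, 0 < e -> exists L, forall i : nat, (L <= i)%N -> forall y,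
  `|x - y| < r -> `|u i y - g y| <= e.

Lemma lucvg_continuous u g : (forall k, continuous (u k)) -> lucvg u g -> continuous g.
Proof.
move=> cu ug x; have xF := @nbhs_filter _ x.
apply/cvgrPdist_le => e e0; have [r r0 Hr] := ug x.
have e3 : 0 < e / 3 by rewrite divr_gt0.
have [L /(_ L (leqnn L)) HL] := Hr _ e3.
have /cvgrPdist_le/(_ _ e3) := cu L x.
have : \forall y \near x, `|x - y| < r by apply/nbhs_normP; exists r.
apply: filterS2 => y xy uy.
have H1 := HL x; rewrite subrr normr0 in H1; have {}H1 := H1 r0.
have H2 := HL y xy.
have -> : g x - g y = (g x - u L x) + (u L x - u L y) + (u L y - g y).
  by rewrite [g x - _ + _]addrA subrK addrA subrK.
have -> : e = e / 3 + e / 3 + e / 3 by field.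
apply: le_trans (ler_normD _ _) (lerD _ H2).
by apply: le_trans (ler_normD _ _) (lerD _ uy); rewrite distrC.
Qed.

(** The derivative of [u L - u N] is small, so [u L - u N] is Lipschitz with a small constant;
    letting [N] grow, the difference quotients of [u L] and [g] are close uniformly in the
    increment. The split [6 = 1 + 1 + 4] accounts for [D u L] against [g'], [D u L] against its
    quotient, and the two quotients. *)
Lemma lucvg_derive u g g' v : (forall (k : nat) y, derivable (u k) y v) ->
  lucvg u g -> lucvg (fun k => 'D_v (u k)) g' ->
  forall x, is_derive x v g (g' x).
Proof.
move=> du ug Dug x.
have H : (fun h : R => h^-1 *: ((g \o shift x) (h *: v) - g x)) @ 0^' --> g' x.
  apply/cvgrPdist_le => e e0; have [r r0 Hr] := Dug x.
  have e6 : 0 < e / 6 by rewrite divr_gt0.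
  have [L HL] := Hr _ e6.
  have v1 : 0 < `|v| + 1 by rewrite ltr_wpDl.
  have tv t : `|t| < r / (`|v| + 1) -> `|x - (x + t *: v)| < r.
    move=> tr; rewrite opprD addrA subrr sub0r normrN normrZ.
    apply: (@le_lt_trans _ _ (`|t| * (`|v| + 1))); first by rewrite ler_wpM2l// lerDl.
    by rewrite -ltr_pdivlMr.
  have lip T : `|T| < r / (`|v| + 1) ->
      `|(u L (x + T *: v) - g (x + T *: v)) - (u L x - g x)| <= 4 * (e / 6) * `|T|.
    move=> Tr; apply/ler_addgt0Pr => c c0; have c2 : 0 < c / 2 by rewrite divr_gt0.
    have pw y : exists N, forall i : nat, (N <= i)%N -> `|u i y - g y| <= c / 2.
      have [r' r'0 /(_ _ c2)[N HN]] := ug y; exists N => i Ni.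
      by apply: HN => //; rewrite subrr normr0.
    have [N1 HN1] := pw x; have [N2 HN2] := pw (x + T *: v).
    pose N := maxn L (maxn N1 N2).
    have LN : (L <= N)%N by rewrite leq_maxl.
    have {}HN1 : `|u N x - g x| <= c / 2.
      by apply: HN1; rewrite /N !leq_max leqnn orbT.
    have {}HN2 : `|u N (x + T *: v) - g (x + T *: v)| <= c / 2.
      by apply: HN2; rewrite /N !leq_max leqnn !orbT.
    pose w : fct := u L - u N.
    have dw y : is_derive y v w ('D_v (u L) y - 'D_v (u N) y).
      by apply: is_deriveB; exact: derivableP.
    have := @line_lipschitz R d w x v T (2 * (e / 6)) (fun y => @ex_derive _ _ _ _ _ _ _ (dw y)).
    have bd t : `|t| <= `|T| -> `|'D_v w (x + t *: v)| <= 2 * (e / 6).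
      move=> tT; have tr := tv _ (le_lt_trans tT Tr).
      have [_ ->] := dw (x + t *: v).
      have -> : 'D_v (u L) (x + t *: v) - 'D_v (u N) (x + t *: v) =
          ('D_v (u L) (x + t *: v) - g' (x + t *: v)) - ('D_v (u N) (x + t *: v) - g' (x + t *: v)).
        by rewrite opprB addrA subrK.
      rewrite mulr_natl mulr2n; apply: le_trans (ler_normB _ _) _.
      by apply: lerD; exact: HL.
    have -> : 2 * (2 * (e / 6)) = 4 * (e / 6) by ring.
    move=> /(_ bd).
    move=> Hw.
    have -> : (u L (x + T *: v) - g (x + T *: v)) - (u L x - g x) =
        (w (x + T *: v) - w x) + ((u N (x + T *: v) - g (x + T *: v)) - (u N x - g x)).
      exact: zmod_telescope.
    apply: le_trans (ler_normD _ _) _; apply: lerD => //.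
    by apply: le_trans (ler_normB _ _) _; rewrite [leRHS]splitr lerD.
  have /cvgrPdist_le/(_ _ e6) uF := du L x.
  have rv : 0 < r / (`|v| + 1) by rewrite divr_gt0.
  have T0F := nbhs_dnbhs_neq (0 : R).
  have TF := dnbhs0_lt (V := R^o) rv.
  apply: filterS3 T0F TF uF => T T0 Tr uT.
  have nT0 : 0 < `|T| by rewrite normr_gt0.
  have xx : `|x - x| < r by rewrite subrr normr0.
  pose Q f := T^-1 *: (f (T *: v + x) - f x).
  have -> : g' x - T^-1 *: ((g \o shift x) (T *: v) - g x) =
      (g' x - 'D_v (u L) x) + ('D_v (u L) x - Q (u L)) + (Q (u L) - Q g).
    by rewrite [g' x - _ + _]addrA subrK addrA subrK.
  have -> : e = e / 6 + e / 6 + 4 * (e / 6) by field.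
  apply: le_trans (ler_normD _ _) _; apply: lerD.
    apply: le_trans (ler_normD _ _) _; apply: lerD => //.
    by rewrite distrC; exact: HL.
  have -> : Q (u L) - Q g = T^-1 *: ((u L (x + T *: v) - g (x + T *: v)) - (u L x - g x)).
    rewrite /Q -scalerBr; congr (_ *: _); rewrite [T *: v + x]addrC !opprB.
    by rewrite addrACA [RHS]addrACA; congr (_ + _); exact: addrC.
  by rewrite normrZ normfV mulrC ler_pdivrMr//; exact: lip.
apply: DeriveDef; last exact: cvg_lim H.
by apply/cvg_ex; exists (g' x).
Qed.

End LocallyUniformLimits.

(** * Completeness of the steps and of the limit *)

Section Completeness.
Context (R : realType) (d : nat) (M : weight_sequence R) (W : weight_system R d).
Local Notation V := (BR M W).
Local Notation "c %:V" := (c%:C%C : R[i]) (at level 2, format "c %:V").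
Local Notation sn := (@sn R d M W).
Local Notation stp := (@stp R d M W).
Local Notation sc := (@sc R d M W).
Local Notation addset := (@addset R d M W).
Local Notation bl := (@bl R d M W).
Implicit Types (A G : set V) (f g : V).

Lemma mderiv_BRB alpha f g x : mderiv alpha (BR_val (f - g)) x =
  mderiv alpha (BR_val f) x - mderiv alpha (BR_val g) x.
Proof. by rewrite mderiv_BRD -scaleN1r mderiv_BRZ mulN1r. Qed.

(** All iterated derivatives converge locally uniformly, so their limits are the derivatives of one
    smooth function, and the norm estimates pass to the limit point by point. *)
Lemma stp_complete m (u : nat -> V) : (forall i, stp m (u i)) ->
  (forall K (e : R), 0 < e -> exists L, forall i j, (L <= i)%N -> (L <= j)%N ->
     sn m K e (u i - u j)) ->
  exists2 y : V, stp m y & forall K (e : R), 0 < e -> exists L, forall i, (L <= i)%N ->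
    sn m K e (u i - y).
Proof.
move=> um cu.
pose D (s : seq 'I_d) k : 'rV[R]_d -> Rcomplex R := foldr (@partial R d) (BR_val (u k)) s.
have DE s k : D s k = mderiv [ffun j => count_mem j s] (BR_val (u k)).
  exact: foldr_partial_mderiv (@BR_smooth _ _ _ _ (u k)).
have luc s x : exists2 r : R, 0 < r & forall e : R, 0 < e -> exists L, forall i j,
    (L <= i)%N -> (L <= j)%N -> forall y, `|x - y| < r -> `|D s i y - D s j y| <= e.
  (* Near [x] the weight stays above half of its value at [x], which turns the weighted bounds into
     uniform ones. *)
  have Wx := wsys_gt0 W 0 x; have W2 : 0 < W 0%N x / 2 by rewrite divr_gt0.
  have /cvgrPdist_le/(_ _ W2)/nbhs_normP[r /= r0 Hr] := @wsys_continuous R d W 0%N x.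
  exists r => // e e0.
  set alpha : {ffun 'I_d -> nat} := [ffun j => count_mem j s].
  have k0 : 0 < hstep R m ^+ mlen alpha * (W 0%N x / 2) / M (mlen alpha).
    by rewrite divr_gt0 ?wseq_gt0// mulr_gt0// exprn_gt0// hstep_gt0.
  have [L HL] := cu 0%N _ (mulr_gt0 e0 k0).
  exists L => i j Li Lj y xy; have /snP/(_ alpha y) := HL _ _ Li Lj.
  rewrite mderiv_BRB !DE -/alpha; set F := `|_|.
  have Wy : W 0%N x / 2 <= W 0%N y.
    have := Hr y xy; rewrite ler_distl => /andP[_].
    by rewrite [in X in X <= _](splitr (W 0%N x)) -lerBlDr addrK.
  move=> H; rewrite -(ler_pM2r k0); apply: le_trans H.
  have -> : F * (hstep R m ^+ mlen alpha * (W 0%N x / 2) / M (mlen alpha)) =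
    hstep R m ^+ mlen alpha * F * (W 0%N x / 2) / M (mlen alpha) by ring.
  apply: ler_wpM2r; first by rewrite invr_ge0 ltW// wseq_gt0.
  by apply: ler_wpM2l => //; apply: wfactor_ge0; exact: normr_ge0.
have [g Hg] : exists g : seq 'I_d -> 'rV[R]_d -> Rcomplex R, forall s x (e : R), 0 < e ->
    exists L, forall i, (L <= i)%N -> `|D s i x - g s x| <= e.
  have H (sx : seq 'I_d * 'rV[R]_d) : exists l : Rcomplex R, forall e : R, 0 < e ->
      exists L, forall i, (L <= i)%N -> `|D sx.1 i sx.2 - l| <= e.
    apply: Rcomplex_cauchy_lim => e e0; have [r r0 /(_ _ e0)[L HL]] := luc sx.1 sx.2.
    by exists L => i j Li Lj; apply: HL; rewrite ?subrr ?normr0.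
  have [g Hg] := choice H.
  by exists (fun s x => g (s, x)) => s x; exact: (Hg (s, x)).
have lug s : lucvg (D s) (g s).
  move=> x; have [r r0 Hr] := luc s x; exists r => // e e0.
  have e2 : 0 < e / 2 by rewrite divr_gt0.
  have [L HL] := Hr _ e2; exists L => i Li y xy.
  have [L' HL'] := Hg s y _ e2.
  have H1 := HL i (maxn L L') Li (leq_maxl _ _) y xy.
  have H2 := HL' (maxn L L') (leq_maxr _ _).
  rewrite [e]splitr; apply: le_trans (lerD H1 H2).
  apply: le_trans (ler_normD _ _).
  by rewrite addrA subrK.
have dg s j x : is_derive x (delta_mx 0 j : 'rV[R]_d) (g s) (g (j :: s) x).
  apply: (@lucvg_derive _ _ (D s) (g s) (g (j :: s)) (delta_mx 0 j)) => //.
    by move=> k y; have [_ /(_ j y)] := @BR_smooth _ _ _ _ (u k) s.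
  exact: (lug (j :: s)).
have pg s : foldr (@partial R d) (g [::]) s = g s.
  elim: s => [//|j s IH] /=; rewrite IH; apply/funext => x.
  by rewrite /partial; have [_ ->] := dg s j x.
have sg : smooth (g [::]).
  move=> s /=; rewrite pg; split=> [|j x]; last by have [] := dg s j x.
  apply: lucvg_continuous (lug s) => k.
  by have [] := @BR_smooth _ _ _ _ (u k) s.
have gE alpha : exists s, forall k, mderiv alpha (g [::]) = g s /\
    mderiv alpha (BR_val (u k)) = D s k.
  by eexists=> k; rewrite !mderiv_foldr pg; split; first reflexivity.
have bound K (e : R) : 0 < e -> exists L, forall i, (L <= i)%N -> forall alpha x,
    hstep R m ^+ mlen alpha * `|mderiv alpha (BR_val (u i)) x - mderiv alpha (g [::]) x : Rcomplex R|
     * W K x / M (mlen alpha) <= e.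
  move=> e0; have [L HL] := cu K e e0; exists L => i Li alpha x.
  set h := hstep R m ^+ mlen alpha.
  have k0 : 0 < h * W K x / M (mlen alpha).
    by rewrite divr_gt0 ?wseq_gt0// mulr_gt0 ?wsys_gt0// exprn_gt0// hstep_gt0.
  apply/ler_addgt0Pr => c c0.
  have [s Hs] := gE alpha; have [-> _] := Hs 0%N.
  have [_ uiE] := Hs i; rewrite uiE.
  have [L' HL'] := Hg s x _ (divr_gt0 c0 k0).
  have := HL' (maxn L L') (leq_maxr _ _).
  have /snP/(_ alpha x) := HL i (maxn L L') Li (leq_maxl _ _).
  have [_ uLE] := Hs (maxn L L'); rewrite mderiv_BRB uiE uLE -/h.
  set a := D s i x; set b := D s _ x; set l := g s x => H1 H2.
  have kE (r : R) : h * r * W K x / M (mlen alpha) = r * (h * W K x / M (mlen alpha)) by ring.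
  rewrite kE in H1; rewrite kE.
  rewrite ler_pdivlMr// in H2.
  apply: le_trans (lerD H1 H2); rewrite -mulrDl ler_pM2r//.
  apply: le_trans (ler_normD _ _).
  by rewrite addrA subrK.
have gm : g [::] \in BW_pred M W (m.+1%:R^-1)%:pos.
  apply/asboolP; split=> // K.
  have [L HL] := bound K 1 ltr01; have [c /snP uc] := um L K.
  apply/bnorm_ltyP; exists (c + 1); apply/bnorm_leP => alpha x.
  rewrite [X in X ^+ _ * _](_ : _ = hstep R m)//.
  have := lerD (uc alpha x) (HL L (leqnn L) alpha x).
  set h := hstep R m ^+ mlen alpha.
  have kE (r : R) : h * r * W K x / M (mlen alpha) = r * (h * W K x / M (mlen alpha)) by ring.
  rewrite !kE -mulrDl; apply: le_trans.
  have k0 : 0 < h * W K x / M (mlen alpha).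
    by rewrite divr_gt0 ?wseq_gt0// mulr_gt0 ?wsys_gt0// exprn_gt0// hstep_gt0.
  rewrite ler_pM2r//.
  set a := mderiv alpha (g [::]) x; set b := mderiv _ _ x.
  have E : (b : Rcomplex R) - (b - a) = a by rewrite opprB addrC subrK.
  by have := @ler_normB _ (Rcomplex R) b (b - a); rewrite E.
pose y : V := BW_incl (BWFun gm : BW M W (m.+1%:R^-1)%:pos).
have ym : stp m y by apply/stpP.
exists y => // K e e0; have [L HL] := bound K e e0; exists L => i Li.
by apply/snP => alpha x; rewrite mderiv_BRB; exact: HL.
Qed.

Section NestedComplete.
Context (F : nested M W).

Lemma nset_absorb x : exists2 r : R, 0 < r & exists j, sc r (F j) x.
Proof.
have [n xn] := stp_cover x.
have xm : stp (nidx F n) x by apply: stp_mono xn; exact: nidx_ge.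
have [r r0 rx] := bl_absorb (nN F n) (neps_gt0 F n) xm.
by exists r => //; exists n.+1; exact: sc_sub_mono (@bl_nsetS _ _ _ _ F n) _ rx.
Qed.

(** Otherwise, for every [j], a member of the filter misses [(j + 1) F j + G j]. On a member small
    for a neighborhood inside all [F j + G j], each point differs from a fixed [x0] by an element of
    [F n + G n], and [x0] lies in [n F n] for large [n]: a contradiction. *)
Lemma cauchy_nset (X : set_system V) : ProperFilter X ->
  (forall G, nbhs (0 : V) G -> exists2 A, X A & forall x y, A x -> A y -> G (x - y)) ->
  exists2 r : R, 0 < r & exists j, forall G A, nbhs (0 : V) G -> X A ->
    exists2 x, A x & addset (sc r (F j)) G x.
Proof.
move=> FX cX; apply: contrapT => nr.
have bad j : exists GA : set V * set V, [/\ nbhs (0 : V) GA.1, X GA.2 &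
    forall x, GA.2 x -> ~ addset (sc j.+1%:R (F j)) GA.1 x].
  apply: contrapT => H; apply: nr; exists j.+1%:R => //; exists j => G A nG XA.
  apply: contrapT => H'; apply: H; exists (G, A); split=> //= x Ax GF.
  by apply: H'; exists x.
have {bad}[GA HGA] := choice bad.
have nGA n : nbhs (0 : V) (GA n).1 by have [] := HGA n.
have [A nA AF] := nbhs0_addset F nGA.
have [B XB BA] := cX _ nA.
have [x0 Bx0] := filter_ex XB.
have [r r0 [j rx0]] := nset_absorb x0.
pose n := maxn j (Num.truncn r).+1.
have [_ XA HA] := HGA n.
have [x [Bx GAx]] := filter_ex (filterI XB XA).
apply: (HA x GAx); have [a Fa [b Gb ab]] := AF n _ (BA _ _ Bx Bx0).
exists (x0 + a); last by exists b => //; rewrite -addrA ab addrC subrK.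
rewrite -natr1; apply: sc_add => //; first exact: nset_ac.
- by rewrite ltr0n leq_max orbT.
- apply: (@sc_mono _ _ _ _ r) => //; first exact: nset_ac.
    apply: ltW; apply: lt_le_trans (truncnS_gt r) _.
    by rewrite ler_nat leq_maxr.
  by apply: sc_sub_mono rx0; apply: nset_le; exact: leq_maxl.
- by rewrite sc1.
Qed.

(** The filter is approximated by points of a single dilate [r F j], where the topology is that of a
    step and thus given by countably many norms. A sequence of approximants is therefore Cauchy in
    that step, and its limit there is the limit of the filter. *)
Lemma nested_complete : lc_complete (BR M W).
Proof.
move=> X FX /lcs_cauchyP cX.
have [r r0 [j HX]] := cauchy_nset FX cX.
have rr0 : 0 < r + r by rewrite addr_gt0.
have cF := @nset_ac _ _ _ _ F j.
pose mu := nidx F j.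
(* The three terms are those of [(u' - f') + (f' - f) + (f - u)], where [u] and [u'] are
   approximants of the points [f] and [f'] of the filter's members. *)
have dataN (N : nat) : exists GA : set V * set V, [/\ nbhs (0 : V) GA.1, absconvex GA.1,
    X GA.2, forall x y, GA.2 x -> GA.2 y -> GA.1 (x - y) &
    forall a b c, GA.1 a -> GA.1 b -> GA.1 c -> sc (r + r) (F j) (a + b + c) ->
      sn mu N N.+1%:R^-1 (a + b + c)].
  have [A nA AF] := @limit_coarse _ _ _ _ F j N N.+1%:R^-1 (r + r) ltac:(by rewrite invr_gt0) rr0.
  have [U [cU nU UA]] := nbhs0_half nA; have [U' [cU' nU' U'U]] := nbhs0_half nU.
  have [B XB BU] := cX _ nU'.
  exists (U', B); split=> //= a b c Ua Ub Uc abc; apply: AF => //.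
  apply: UA; first exact: U'U.
  by rewrite -[c]addr0; apply: U'U => //; exact: nbhs_singleton.
have {dataN}[GA HGA] := choice dataN.
pose G N := (GA N).1; pose B N := (GA N).2.
(* Finite intersections make the approximant of index [N] meet all the earlier requirements as
   well. *)
pose GG N : set V := \big[setI/setT]_(i < N.+1) G i.
pose BB N : set V := \big[setI/setT]_(i < N.+1) B i.
have nGG N : nbhs (0 : V) (GG N).
  by apply: big_ind => [|A1 A2|i _]; [exact: filterT|exact: filterI|have [] := HGA i].
have XBB N : X (BB N).
  by apply: big_ind => [|A1 A2|i _]; [exact: filterT|exact: filterI|have [] := HGA i].
have GGG N i : (i <= N)%N -> GG N `<=` G i.
  by move=> iN x; rewrite /GG -bigcap_mkord => H; apply: H; rewrite /= ltnS.
have BBB N i : (i <= N)%N -> BB N `<=` B i.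
  by move=> iN x; rewrite /BB -bigcap_mkord => H; apply: H; rewrite /= ltnS.
have pick N : exists fu : V * V, [/\ BB N fu.1, sc r (F j) fu.2 & GG N (fu.1 - fu.2)].
  have [f Bf [u Fu [v Gv uv]]] := HX _ _ (nGG N) (XBB N).
  by exists (f, u); split=> //=; rewrite -uv addrC addKr.
have {pick}[fu Hfu] := choice pick.
pose u N := (fu N).2.
have uF N : sc r (F j) (u N) by have [] := Hfu N.
have close N i (f' u' : V) : (N <= i)%N -> B N f' -> sc r (F j) u' -> G N (f' - u') ->
    sn mu N N.+1%:R^-1 (u' - u i).
  move=> Ni Bf' Fu' Gfu'; have [Bf Fu Gfu] := Hfu i.
  have [_ cG _ BG H] := HGA N.
  have E : u' - u i = (- (f' - u')) + (f' - (fu i).1) + ((fu i).1 - u i).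
    by rewrite opprB [u' - f' + _]addrA subrK addrA subrK.
  rewrite E; apply: H.
  - exact: ac_opp.
  - by apply: BG => //; exact: BBB Bf.
  - exact: GGG Gfu.
  - by rewrite -E; apply: sc_sub.
have um i : stp mu (u i).
  have [|v Fv ->] := scV _ (uF i); first by rewrite gt_eqF.
  exact/stpZ/nset_stp.
have small K (e : R) : 0 < e -> exists2 N, (K <= N)%N & N.+1%:R^-1 <= e.
  move=> e0; have [n ne] := hstep_small e0.
  by exists (maxn K n); rewrite ?leq_maxl//; apply: le_trans ne; apply: hstep_le; rewrite leq_maxr.
have [y ym Hy] : exists2 y, stp mu y & forall K (e : R), 0 < e -> exists L, forall i,
    (L <= i)%N -> sn mu K e (u i - y).
  apply: stp_complete => // K e e0; have [N KN Ne] := small K e e0.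
  exists N => i i' Ni Ni'; have [Bf Fu Gfu] := Hfu i.
  apply: sn_ler Ne _ _; apply: (sn_mono (leqnn mu) KN).
  exact: (close N i' _ _ Ni' (BBB _ _ Ni _ Bf) (uF i) (GGG _ _ Ni _ Gfu)).
exists y => Q /nbhs_BRE/nbhs0_half[U [cU nU UQ]].
have [U1 [cU1 nU1 U1U]] := nbhs0_half nU.
have [A XA AU] := cX _ nU1.
have [U2 [cU2 nU2 U2U _]] := nbhs0_ac nU1.
have /nbhs0_BR[U3 [_ /(_ mu)[K [e [e0 eU]]] U3U]] := nU.
have e2 : 0 < e / 2 by rewrite divr_gt0.
have [N KN Ne] := small K _ e2.
have [L HL] := Hy K _ e2.
have nG' : nbhs (0 : V) (GG N `&` U2) by exact: filterI.
(* The sequence [u] was chosen without regard to [Q]. A further approximant [u'], close to the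
   filter in the sense of [Q], links it to [y]. *)
have [f [Bf Af] [u' Fu' [v [Gv Uv] uv]]] := HX _ _ nG' (filterI (XBB N) XA).
have vE : v = f - u' by rewrite -uv addrC addKr.
have u'y : sn mu K e (u' - y).
  have -> : u' - y = (u' - u (maxn N L)) + (u (maxn N L) - y) by rewrite addrA subrK.
  rewrite [e]splitr; apply: snD; last by apply: HL; rewrite leq_maxr.
  apply: sn_ler Ne _ _; apply: (sn_mono (leqnn mu) KN).
  apply: (close N _ f); rewrite ?leq_maxl//; first exact: BBB Bf.
  by rewrite -vE; exact: GGG Gv.
have u'm : stp mu u'.
  have [|w Fw ->] := scV _ Fu'; first by rewrite gt_eqF.
  exact/stpZ/nset_stp.
apply: filterS XA => x Ax.
have -> : x = y + ((x - f) + (f - u') + (u' - y)).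
  have k a b c : a - b + (b - c) = a - c :> V by rewrite addrA subrK.
  by rewrite !k addrC subrK.
apply: UQ.
  by apply: U1U; [exact: AU|rewrite -vE; exact: U2U].
by apply: U3U; apply: eU; split=> //; exact: stpB.
Qed.

End NestedComplete.
End Completeness.

(** * Cutoff functions *)

Section Averages.
Context (R : realType).
Implicit Types (g : R -> R) (a s x y : R).
Local Notation mu := (@lebesgue_measure R).

(* [4]-Lipschitz plateau functions. Averaging over [x, x + a] enlarges [s] to
   [s + a]. *)
Definition plateau s g : Prop := [/\
  forall x y, `|g x - g y| <= 4 * `|x - y|, forall x, `|g x| <= 1,
  forall x, x <= - (3 / 4) - s \/ 3 / 4 <= x -> g x = 0 &
  forall x, - (1 / 2) <= x -> x <= 1 / 2 - s -> g x = 1].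

Definition hat (x : R) : R := Num.min 1 (Num.max 0 (3 - 4 * `|x|)).

Lemma hatP x : [\/ 3 - 4 * `|x| <= 0 /\ hat x = 0,
  (0 <= 3 - 4 * `|x| /\ 3 - 4 * `|x| <= 1) /\ hat x = 3 - 4 * `|x| |
  1 <= 3 - 4 * `|x| /\ hat x = 1].
Proof.
rewrite /hat; set t := 3 - 4 * `|x|.
have [t0|t0] := leP t 0; first by apply: Or31; split=> //; rewrite min_r.
have [t1|t1] := leP t 1; first by apply: Or32; split=> //; rewrite (ltW t0).
by apply: Or33; rewrite (ltW t1).
Qed.

Lemma plateau_hat : plateau 0 hat.
Proof.
split=> [x y|x|x H|x x1 x2].
- have H : `| `|x| - `|y| | <= `|x - y| by exact: ler_dist_dist.
  move: H; set d := `|x - y|; rewrite ler_norml => /andP[H1 H2].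
  have d0 : 0 <= d by exact: normr_ge0.
  rewrite ler_norml; apply/andP.
  by have [[? ->]|[[? ?] ->]|[? ->]] := hatP x; have [[? ->]|[[? ?] ->]|[? ->]] := hatP y; split; lra.
- rewrite ler_norml; apply/andP.
  by have [[? ->]|[[? ?] ->]|[? ->]] := hatP x; split; lra.
- have x34 : 3 / 4 <= `|x|.
    case: H => H; last by rewrite (le_trans H)// ler_norm.
    by rewrite -normrN (le_trans _ (ler_norm _))//; lra.
  by have [[? ->]|[[? ?] ->]|[? ->]] := hatP x; lra.
- have x12 : `|x| <= 1 / 2 by rewrite ler_norml; apply/andP; split; lra.
  by have [[? ->]|[[? ?] ->]|[? ->]] := hatP x; lra.
Qed.

Lemma plateau_mono s s' g : s <= s' -> plateau s g -> plateau s' g.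
Proof.
move=> ss' [L B Z I]; split=> // [x [H|H]|x x1 x2].
- by apply: Z; left; lra.
- by apply: Z; right.
- by apply: I => //; lra.
Qed.

Lemma plateau_continuous s g : plateau s g -> continuous g.
Proof.
move=> [L _ _ _] x; apply/cvgrPdist_le => e e0.
have e4 : 0 < e / 4 by rewrite divr_gt0.
apply/nbhs_normP; exists (e / 4) => // y /= xy.
by apply: le_trans (L x y) _; rewrite mulrC -ler_pdivlMr// ltW.
Qed.

(** For [s <= 1/4] plateau functions vanish to the left of [-1], so with the base point [-2] this is
    a primitive on the whole line. *)
Definition prim g x : R := (\int[mu]_(t in `[(-2), x]) g t)%R.

Lemma prim_derive s g x : s <= 1 / 4 -> plateau s g -> is_derive x 1 (prim g) (g x).
Proof.
move=> s4 pg; have [L _ Z _] := pg.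
have [x2|x2] := ltP (- 2) x.
  have xx : x < x + 1 by rewrite ltrDl.
  have ig : mu.-integrable [set` `[(-2), (x + 1)]] (EFin \o g).
    apply: continuous_compact_integrable; first exact: segment_compact.
    exact/continuous_subspaceT/(plateau_continuous pg).
  have [H1 H2] := @continuous_FTC1_closed R g (- 2) x (x + 1) xx ig x2
    (@plateau_continuous _ _ pg x).
  by apply: DeriveDef; [exact: H1|rewrite -derive1E].
have Z' y : y <= -1 -> g y = 0 by move=> y1; apply: Z; left; lra.
have P0 y : y <= -1 -> prim g y = 0.
  move=> y1; rewrite /prim (@eq_Rintegral _ _ _ mu _ (cst 0)).
    by rewrite Rintegral_cst ?mul0r//; exact: measurable_itv.
  by move=> t; rewrite inE/= in_itv/= => /andP[_ ty]; rewrite Z'//; lra.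
rewrite Z'; last by lra.
have : is_derive x 1 (cst 0 : R -> R) 0 by exact: is_derive_cst.
apply: near_eq_is_derive.
have x1 : x < -1 by lra.
by apply: filterS (lt_nbhsl x1) => y y1; rewrite /cst P0// ltW.
Qed.

Lemma is_derive_translate (f : R -> R) (df x a : R) : is_derive (x + a) (1 : R) f df ->
  is_derive x (1 : R) (fun t => f (t + a)) df.
Proof.
move=> [ex D].
have E : (fun h : R => h^-1 *: (((fun t => f (t + a)) \o shift x) (h *: 1) - f (x + a))) =
    (fun h : R => h^-1 *: ((f \o shift (x + a)) (h *: 1) - f (x + a))).
  by apply/funext => h /=; rewrite addrA.
by apply: DeriveDef; rewrite /derivable /derive E.
Qed.

Definition avg a g x : R := (prim g (x + a) - prim g x) / a.
Definition dquot a g x : R := (g (x + a) - g x) / a.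

Lemma is_derive_dquot a (f df : R -> R) : (forall x, is_derive x (1 : R) f (df x)) ->
  forall x, is_derive x (1 : R) (dquot a f) (dquot a df x).
Proof.
move=> Df x; have D1 := is_derive_translate (Df (x + a)).
have D2 := is_deriveZ a^-1 (is_deriveB D1 (Df x)).
have -> : dquot a f = a^-1 \*: ((fun t => f (t + a)) - f).
  by apply/funext => t; rewrite /dquot mulrC.
by apply: is_derive_eq; rewrite /dquot mulrC.
Qed.

Lemma avg_derive s a g x : s <= 1 / 4 -> plateau s g ->
  is_derive x (1 : R) (avg a g) (dquot a g x).
Proof.
by move=> s4 pg; apply: is_derive_dquot => y; exact: prim_derive pg.
Qed.

(** The mean value theorem for the difference of two primitives yields one point [c] for both
    functions. Hence Lipschitz bounds and distances pass to averages with the same constant. *)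
Lemma avgB_mean s s' a g g' x y : s <= 1 / 4 -> s' <= 1 / 4 -> plateau s g ->
  plateau s' g' -> 0 < a -> exists2 c, 0 < c < a &
  avg a g x - avg a g' y = g (x + c) - g' (y + c).
Proof.
move=> s4 s'4 pg pg' a0.
pose h t := prim g (t + x) - prim g' (t + y).
have dh t : is_derive t (1 : R) h (g (t + x) - g' (t + y)).
  by apply: is_deriveB; apply: is_derive_translate; [exact: prim_derive pg|exact: prim_derive pg'].
have [c c0a E] := @MVT R h _ 0 a a0 (fun t _ => dh t)
  (derivable_within_continuous (fun t _ => @ex_derive _ _ _ _ _ _ _ (dh t))).
exists c; first by move: c0a; rewrite in_itv.
move: E; rewrite /h subr0 !add0r /avg -mulrBl ![c + _]addrC ![a + _]addrC => E.
by rewrite (_ : _ - _ - _ = (g (x + c) - g' (y + c)) * a) ?mulfK ?gt_eqF// -E; ring.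
Qed.

Lemma avg_mean s a g x : s <= 1 / 4 -> plateau s g -> 0 < a ->
  exists2 c, 0 < c < a & avg a g x = g (x + c).
Proof.
move=> s4 pg a0; pose h t := prim g (t + x).
have dh t : is_derive t (1 : R) h (g (t + x)).
  by apply: is_derive_translate; exact: prim_derive pg.
have [c c0a E] := @MVT R h _ 0 a a0 (fun t _ => dh t)
  (derivable_within_continuous (fun t _ => @ex_derive _ _ _ _ _ _ _ (dh t))).
exists c; first by move: c0a; rewrite in_itv.
by move: E; rewrite /h /avg subr0 add0r [a + x]addrC [c + x]addrC => ->; rewrite mulfK// gt_eqF.
Qed.

Lemma plateau_avg s a g : 0 < a -> s + a <= 1 / 4 -> plateau s g ->
  plateau (s + a) (avg a g).
Proof.
move=> a0 sa pg; have s4 : s <= 1 / 4 by lra.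
have [L B Z I] := pg; split=> [x y|x|x H|x x1 x2].
- have [c _ ->] := avgB_mean x y s4 s4 pg pg a0; apply: le_trans (L _ _) _.
  by rewrite opprD addrACA subrr addr0.
- by have [c _ ->] := avg_mean x s4 pg a0; exact: B.
- have [c /andP[c0 ca] ->] := avg_mean x s4 pg a0; apply: Z.
  by case: H => H; [left|right]; lra.
- by have [c /andP[c0 ca] ->] := avg_mean x s4 pg a0; apply: I; lra.
Qed.

End Averages.

(** * Iterated averages with summable widths *)

Section Cutoff.
Context (R : realType) (a : nat -> R).
Hypothesis a_gt0 : forall i, 0 < a i.
Hypothesis a_sum : forall n, \sum_(i < n) a i <= 1 / 4.
Implicit Types (i j k l p : nat) (x : R).

Definition asum j k : R := \sum_(i < k) a (j + i)%N.

Lemma asum_ge0 j k : 0 <= asum j k.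
Proof. by apply: sumr_ge0 => i _; rewrite ltW. Qed.

Lemma asumS j k : asum j k.+1 = a j + asum j.+1 k.
Proof.
rewrite /asum big_ord_recl addn0; congr (_ + _).
by apply: eq_bigr => i _; rewrite /bump/= addnA addn1.
Qed.

Lemma asum_cat j k l : asum j (k + l) = asum j k + asum (j + k)%N l.
Proof.
elim: k j => [|k IH] j; first by rewrite /asum big_ord0 add0r addn0 add0n.
by rewrite addSn !asumS IH addrA addSnnS.
Qed.

Lemma asum_le j k : asum j k <= 1 / 4.
Proof.
apply: le_trans (a_sum (j + k)).
have := asum_cat 0 j k; rewrite {1}/asum; under eq_bigr do rewrite add0n.
by move=> ->; rewrite add0n lerDr asum_ge0.
Qed.

Lemma asum_tail (e : R) : 0 < e -> exists K, forall k l, (K <= k)%N -> asum k l <= e.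
Proof.
move=> e0; apply: contrapT => H.
have grow n : exists k, n%:R * e <= asum 0 k.
  elim: n => [|n [k IH]]; first by exists 0%N; rewrite mul0r asum_ge0.
  apply: contrapT => H'; apply: H; exists k => k' l kk'.
  rewrite leNgt; apply/negP => el; apply: H'; exists (k' + l)%N.
  rewrite asum_cat add0n -natr1 mulrDl mul1r; apply: lerD (ltW el).
  by apply: le_trans IH _; rewrite -(subnKC kk') asum_cat lerDl asum_ge0.
have [k] := grow (Num.truncn e^-1).+1.
move/le_trans/(_ (asum_le _ _)); apply/negP; rewrite -ltNge.
have : 1 < (Num.truncn e^-1).+1%:R * e by rewrite -ltr_pdivrMr// div1r truncnS_gt.
lra.
Qed.

(** The width [a j] is applied last. In the limit this gives [v j = avg (a j) (v j.+1)], whose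
    derivative is a difference quotient of [v j.+1]. *)
Fixpoint avgs k j : R -> R := if k is k'.+1 then avg (a j) (avgs k' j.+1) else @hat R.

Lemma plateau_avgs k j : plateau (asum j k) (avgs k j).
Proof.
elim: k j => [|k IH] j; first by rewrite /asum big_ord0; exact: plateau_hat.
by rewrite asumS addrC /=; apply: plateau_avg => //; rewrite addrC -asumS; exact: asum_le.
Qed.

(** The additional average is the innermost one. It moves the 4-Lipschitz function [hat] by at most
    four times its width, and the outer averages do not amplify this. *)
Lemma avgs_close1 k j x : `|avgs k.+1 j x - avgs k j x| <= 4 * a (j + k)%N.
Proof.
elim: k j x => [|k IH] j x; last first.
  have [c _ ->] := avgB_mean x x (asum_le _ _) (asum_le _ _) (plateau_avgs k.+1 j.+1)
    (plateau_avgs k j.+1) (a_gt0 j).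
  by rewrite -addSnnS; exact: IH.
have [|c /andP[c0 ca] /= ->] := @avg_mean R 0 (a j) (@hat R) x _ (@plateau_hat R) (a_gt0 j).
  by rewrite divr_ge0.
have [L _ _ _] := @plateau_hat R; apply: le_trans (L _ _) _.
by rewrite addrC addKr addn0 gtr0_norm// ler_pM2l// ltW.
Qed.

Lemma avgs_close k l j x : `|avgs (k + l) j x - avgs k j x| <= 4 * asum (j + k)%N l.
Proof.
elim: l => [|l IH]; first by rewrite addn0 subrr normr0 /asum big_ord0 mulr0.
have -> : asum (j + k) l.+1 = asum (j + k) l + a (j + (k + l))%N.
  by rewrite /asum big_ord_recr/= addnA.
rewrite addnS mulrDr -(subrK (avgs (k + l) j x) (avgs (k + l).+1 j x)) -addrA.
apply: le_trans (ler_normD _ _) _; rewrite [leRHS]addrC.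
exact: lerD (avgs_close1 _ _ _) IH.
Qed.

Lemma avgs_lim : exists v : nat -> R -> R, forall j (e : R), 0 < e -> exists K, forall k x,
  (K <= k)%N -> `|avgs k j x - v j x| <= e.
Proof.
have cau (e : R) : 0 < e -> exists K, forall j k k' x, (K <= k)%N -> (K <= k')%N ->
    `|avgs k j x - avgs k' j x| <= e.
  move=> e0; have e8 : 0 < e / 8 by rewrite divr_gt0.
  have [K HK] := asum_tail e8; exists K => j k k' x Kk Kk'.
  have D i : (K <= i)%N -> `|avgs i j x - avgs K j x| <= e / 2.
    move=> Ki; rewrite -(subnKC Ki); apply: le_trans (avgs_close _ _ _ _) _.
    have := HK (j + K)%N (i - K)%N (leq_addl _ _); lra.
  have := lerD (D k Kk) (D k' Kk'); rewrite -splitr; apply: le_trans.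
  rewrite [X in _ <= _ + X]distrC; apply: le_trans (ler_normD _ _).
  by rewrite addrA subrK.
have [v Hv] : exists v : nat -> R -> R, forall j x, avgs k j x @[k --> \oo] --> v j x.
  have H (jx : nat * R) : exists l : R, avgs k jx.1 jx.2 @[k --> \oo] --> l.
    apply/cvg_ex; apply/cauchy_cvgP; apply: cauchy_exP => e e0.
    have [|K HK] := cau (e / 2); first by rewrite divr_gt0.
    exists (avgs K jx.1 jx.2); exists K => // k /= Kk; rewrite /ball/=.
    apply: le_lt_trans (HK _ _ _ _ (leqnn K) Kk) _.
    by rewrite ltr_pdivrMr// ltr_pMr// ltr1n.
  have [v Hv] := choice H.
  by exists (fun j x => v (j, x)) => j x; exact: (Hv (j, x)).
exists v => j e e0; have e2 : 0 < e / 2 by rewrite divr_gt0.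
have [K HK] := cau _ e2; exists K => k x Kk.
have /cvgrPdist_le/(_ _ e2)[L _ HL] := Hv j x.
have H1 := HK j k (maxn K L) x Kk (leq_maxl _ _).
have := HL (maxn K L) (leq_maxr _ _); rewrite /= distrC => H2.
rewrite [e]splitr; apply: le_trans (lerD H1 H2).
apply: le_trans (ler_normD _ _).
by rewrite addrA subrK.
Qed.

End Cutoff.

Lemma derive_locally_cst (R : realType) (f df : R -> R) (c l r : R) :
  (forall x, l < x < r -> f x = c) -> (forall x, l < x < r -> is_derive x (1 : R) f (df x)) ->
  forall x, l < x < r -> df x = 0.
Proof.
move=> fc Df x xlr; have [lx xr] := andP xlr; have [_ <-] := Df x xlr.
rewrite (@near_eq_derive _ _ _ f (cst c)); first exact: derive_cst.
apply: filterS2 (lt_nbhsr lx) (lt_nbhsl xr) => y ly yr.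
by rewrite fc// ly.
Qed.

(** * The derivatives of the limit as difference quotients *)

Section CutoffExists.
Context (R : realType) (a : nat -> R).
Hypothesis a_gt0 : forall i, 0 < a i.
Hypothesis a_sum : forall n, \sum_(i < n) a i <= 1 / 4.
Implicit Types (i j k l p : nat) (x : R).

Fixpoint dquots p j (g : R -> R) : R -> R :=
  if p is p'.+1 then dquot (a j) (dquots p' j.+1 g) else g.

Lemma dquotsS p j g : dquots p.+1 j g = dquots p j (dquot (a (j + p)%N) g).
Proof. by elim: p j => [|p IH] j; [rewrite /= addn0|rewrite -addSnnS /= -IH]. Qed.

Lemma is_derive_dquots p j (f df : R -> R) : (forall x, is_derive x (1 : R) f (df x)) ->
  forall x, is_derive x (1 : R) (dquots p j f) (dquots p j df x).
Proof.
by move=> D; elim: p j => [|p IH] j x; [exact: D|exact: is_derive_dquot (IH j.+1) x].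
Qed.

Lemma dquots_le p j g : (forall x, `|g x| <= 1) -> forall x,
  `|dquots p j g x| <= \prod_(i < p) (2 / a (j + i)%N).
Proof.
move=> g1; elim: p j => [|p IH] j x /=; first by rewrite big_ord0.
rewrite big_ord_recl addn0 /dquot normrM normfV (gtr0_norm (a_gt0 j)).
set P := \prod_(i < p) _.
have H y : `|dquots p j.+1 g y| <= P.
  apply: le_trans (IH _ _) _; rewrite le_eqVlt; apply/orP; left; apply/eqP.
  by apply: eq_bigr => i _; rewrite /bump/= addnA addn1.
rewrite mulrAC ler_wpM2r ?invr_ge0 ?(ltW (a_gt0 j))//.
apply: le_trans (ler_normB _ _) _; rewrite mulr_natl mulr2n.
exact: lerD.
Qed.

(** The derivative of an average is a difference quotient, so the [p]-th derivative of [v 0] is a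
    [p]-fold difference quotient of [v p]; as [v p] is bounded by 1, each quotient contributes a
    factor [2 / a i]. *)
Lemma cutoff_exists : exists chi : nat -> R -> R, [/\
  forall p x, is_derive x (1 : R) (chi p) (chi p.+1 x),
  forall p x, `|chi p x| <= \prod_(i < p) (2 / a i),
  forall p x, 1 < `|x| -> chi p x = 0, chi 0%N 0 = 1 & forall p, chi p.+1 0 = 0].
Proof.
have [v Hv] := avgs_lim a_gt0 a_sum.
have pv k j : plateau (1 / 4) (avgs a k j).
  exact: plateau_mono (asum_le a_gt0 a_sum j k) (plateau_avgs a_gt0 a_sum k j).
have close j (e : R) : 0 < e -> exists k, forall x, `|avgs a k j x - v j x| <= e.
  by move=> e0; have [k Hk] := Hv j e e0; exists k => x; exact: Hk.
have small (r : R) : (forall e : R, 0 < e -> `|r| <= e) -> r = 0.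
  move=> H; apply/eqP; rewrite -normr_le0; apply/ler_addgt0Pr => e e0.
  by rewrite add0r; exact: H.
have pl j : plateau (1 / 4) (v j).
  split=> [x y|x|x H|x x1 x2].
  - apply/ler_addgt0Pr => e e0; have e2 : 0 < e / 2 by rewrite divr_gt0.
    have [k Hk] := close j _ e2; have [L _ _ _] := pv k j.
    have -> : v j x - v j y = (avgs a k j x - avgs a k j y) -
        ((avgs a k j x - v j x) - (avgs a k j y - v j y)) by ring.
    apply: le_trans (ler_normB _ _) _; apply: lerD; first exact: L.
    by apply: le_trans (ler_normB _ _) _; rewrite [leRHS]splitr lerD.
  - apply/ler_addgt0Pr => e e0; have [k Hk] := close j _ e0; have [_ B _ _] := pv k j.
    have -> : v j x = avgs a k j x - (avgs a k j x - v j x) by ring.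
    by apply: le_trans (ler_normB _ _) _; exact: lerD.
  - apply: small => e e0; have [k Hk] := close j _ e0; have [_ _ Z _] := pv k j.
    by have := Hk x; rewrite (Z _ H) sub0r normrN.
  - apply/esym/eqP; rewrite -subr_eq0; apply/eqP.
    apply: small => e e0; have [k Hk] := close j _ e0; have [_ _ _ I] := pv k j.
    by have := Hk x; rewrite (I _ x1 x2).
have vE j x : v j x = avg (a j) (v j.+1) x.
  apply/eqP; rewrite -subr_eq0; apply/eqP; apply: small => e e0.
  have e2 : 0 < e / 2 by rewrite divr_gt0.
  have [K HK] := Hv j _ e2; have [K' HK'] := Hv j.+1 _ e2.
  pose k := maxn K K'.
  have H1 := HK k.+1 x (leqW (leq_maxl _ _)).
  have [c _ E] := avgB_mean x x (lexx _) (lexx _) (pv k j.+1) (pl j.+1) (a_gt0 j).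
  have H2 := HK' k (x + c) (leq_maxr _ _); rewrite -E in H2.
  rewrite [e]splitr; apply: le_trans (lerD H2 H1).
  apply: le_trans (ler_normB _ _); rewrite /= le_eqVlt; apply/orP; left; apply/eqP.
  by congr `|_|; ring.
have Dv j x : is_derive x (1 : R) (v j) (dquot (a j) (v j.+1) x).
  rewrite (_ : v j = avg (a j) (v j.+1)); last exact/funext/vE.
  exact: avg_derive (lexx _) (pl j.+1).
pose chi p := dquots p 0 (v p).
have Dchi p x : is_derive x (1 : R) (chi p) (chi p.+1 x).
  by rewrite /chi dquotsS add0n; apply: is_derive_dquots => y; exact: Dv.
have zero_right p x : 1 < x -> chi p x = 0.
  elim: p x => [|p IH] x x1; first by have [_ _ Z _] := pl 0%N; apply: Z; right; lra.
  have x1x : 1 < x < x + 1 by apply/andP; split; lra.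
  have H y : 1 < y < x + 1 -> chi p y = 0 by move=> /andP[y1 _]; exact: IH.
  exact: derive_locally_cst H (fun y _ => Dchi p y) _ x1x.
have zero_left p x : x < -1 -> chi p x = 0.
  elim: p x => [|p IH] x x1; first by have [_ _ Z _] := pl 0%N; apply: Z; left; lra.
  have x1x : x - 1 < x < -1 by apply/andP; split; lra.
  have H y : x - 1 < y < -1 -> chi p y = 0 by move=> /andP[_ y1]; exact: IH.
  exact: derive_locally_cst H (fun y _ => Dchi p y) _ x1x.
have flat p x : - (1 / 4) < x < 1 / 4 -> chi p.+1 x = 0.
  elim: p x => [|p IH] x xI.
    have H y : - (1 / 4) < y < 1 / 4 -> chi 0%N y = 1.
      by move=> /andP[y1 y2]; have [_ _ _ I] := pl 0%N; apply: I; lra.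
    exact: derive_locally_cst H (fun y _ => Dchi 0%N y) _ xI.
  exact: derive_locally_cst IH (fun y _ => Dchi p.+1 y) _ xI.
exists chi; split=> //.
- by move=> p x; have [_ B _ _] := pl p; exact: dquots_le.
- move=> p x; have [x0|x0] := leP 0 x; [rewrite ger0_norm//|rewrite ltr0_norm//].
    exact: zero_right.
  by move=> x1; apply: zero_left; lra.
- by have [_ _ _ I] := pl 0%N; apply: I; lra.
- by move=> p; apply: flat; apply/andP; split; lra.
Qed.

End CutoffExists.

(** * Widths adapted to the weight sequence *)

Section WeightedCutoff.
Context (R : realType) (M : weight_sequence R).

Lemma wquot_gt0 p : 0 < wquot M p.
Proof. by rewrite divr_gt0// wseq_gt0. Qed.

Lemma wseqS p : M p.+1 = wquot M p.+1 * M p.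
Proof. by rewrite /wquot divfK// gt_eqF// wseq_gt0. Qed.

Lemma wquot_mono p q : cond_M1 M -> (0 < p)%N -> (p <= q)%N -> wquot M p <= wquot M q.
Proof.
move=> M1 p0 /subnK <-; elim: (_ - _)%N => [//|k IH]; apply: le_trans IH _.
rewrite addSn; set r := (k + p)%N; have r0 : (0 < r)%N by rewrite addn_gt0 p0 orbT.
rewrite /wquot/= ler_pdivrMr ?wseq_gt0// mulrAC ler_pdivlMr ?wseq_gt0//.
by rewrite -expr2 mulrC; exact: M1.
Qed.

Lemma wseq_mulM p q : cond_M1 M -> M p * M q <= M 0%N * M (p + q)%N.
Proof.
move=> M1; elim: p => [|p IH]; first by rewrite add0n.
rewrite addSn !wseqS -mulrA [M 0%N * _]mulrCA; apply: ler_pM => //.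
- by rewrite ltW// wquot_gt0.
- by rewrite mulr_ge0// ltW// wseq_gt0.
- by apply: wquot_mono; rewrite ?ltnS// leq_addr.
Qed.

Lemma M3_sum : cond_M3 M -> exists2 C : R, 1 <= C & forall q n, (0 < q)%N ->
  \sum_(q <= p < n) (wquot M p)^-1 <= C * q%:R / wquot M q.
Proof.
move=> [C C1 H]; exists C => // q n q0.
rewrite -lee_fin -sumEFin; apply: le_trans (ltW (H q q0)).
by apply: nneseries_lim_ge => i _ _; rewrite lee_fin invr_ge0 ltW// wquot_gt0.
Qed.

Lemma M3_tail (e : R) : cond_M3 M -> 0 < e -> exists p0, forall n,
  asum (fun i => (wquot M i.+1)^-1) p0 n <= e.
Proof.
move=> M3 e0; have [C C1 H] := M3_sum M3.
(* Dividing by [B] brings the total to at most [1/4], as [asum_tail] requires. *)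
pose B := 4 * (C * 1%:R / wquot M 1).
have B0 : 0 < B by rewrite !mulr_gt0// ?invr_gt0 ?wquot_gt0// (lt_le_trans ltr01).
have u0 i : 0 < (wquot M i.+1)^-1 / B by rewrite divr_gt0// invr_gt0 wquot_gt0.
have us n : \sum_(i < n) (wquot M i.+1)^-1 / B <= 1 / 4.
  rewrite -mulr_suml ler_pdivrMr// mulrA (_ : 1 / 4 * 4 = 1) ?mul1r; last by field.
  apply: le_trans (H 1%N n.+1 isT); rewrite big_add1 big_mkord.
  by rewrite le_eqVlt eqxx.
have [K HK] := asum_tail u0 us (divr_gt0 e0 B0).
exists K => n; have := HK K n (leqnn K).
by rewrite /asum -mulr_suml ler_pM2r// invr_gt0.
Qed.

Lemma weighted_cutoff : cond_M3 M -> exists D : R, 0 < D /\ exists chi : nat -> R -> R, [/\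
  forall p x, is_derive x (1 : R) (chi p) (chi p.+1 x),
  forall p x, `|chi p x| <= D * 2^-1 ^+ p * M p,
  forall p x, 1 < `|x| -> chi p x = 0, chi 0%N 0 = 1 & forall p, chi p.+1 0 = 0].
Proof.
move=> M3; have [p0 Hp0] := @M3_tail (1 / 32) M3 ltac:(lra).
(* With [a i = 4 / m_(i+1)] the factor [2 / a i] is half of [m_(i+1)], which produces [2^-p M_p].
   The tail from [p0] on contributes at most [4 / 32], and the first [p0] widths at most another
   [1/8]. *)
pose a i : R := if (i < p0)%N then (8 * p0.+1%:R)^-1 else 4 / wquot M i.+1.
have a0 i : 0 < a i.
  by rewrite /a; case: ifP => _; [rewrite invr_gt0 mulr_gt0|rewrite divr_gt0 ?wquot_gt0].
have asum14 n : \sum_(i < n) a i <= 1 / 4.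
  have am k : asum a 0 k = \sum_(i < k) a i.
    by apply: eq_bigr => i _; rewrite add0n.
  rewrite -am; apply: (@le_trans _ _ (asum a 0 (p0 + n))).
    by rewrite addnC asum_cat lerDl asum_ge0.
  rewrite asum_cat add0n am; apply: (@le_trans _ _ (1 / 8 + 1 / 8)); last by lra.
  apply: lerD.
    rewrite (eq_bigr (fun=> (8 * p0.+1%:R)^-1)) => [|i _]; last by rewrite /a ltn_ord.
    rewrite sumr_const card_ord -[_ *+ p0]mulr_natl ler_pdivrMr ?mulr_gt0// mulrA.
    by rewrite (_ : 1 / 8 * 8 = 1) ?mul1r ?ler_nat//; field.
  rewrite /asum (eq_bigr (fun i : 'I_n => 4 * (wquot M (p0 + i).+1)^-1)); last first.
    by move=> i _; rewrite /a ltnNge leq_addr.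
  by rewrite -mulr_sumr; have := Hp0 n; rewrite /asum; lra.
have [chi [D1 D2 D3 D4 D5]] := cutoff_exists a0 asum14.
(* [E p] is the quotient of the available bound by [2^-p M_p]. It is constant from [p0] on, so the
   sum of its first values dominates all of them. *)
pose E p : R := (\prod_(i < p) (2 / a i)) * 2 ^+ p / M p.
have E0 p : 0 < E p.
  by rewrite /E divr_gt0 ?wseq_gt0// mulr_gt0 ?exprn_gt0// prodr_gt0// => i _; rewrite divr_gt0.
exists (\sum_(q < p0.+1) E q); split.
  by rewrite big_ord_recl ltr_wpDr// sumr_ge0// => i _; rewrite ltW.
exists chi; split=> // p x; apply: le_trans (D2 p x) _.
have -> : \prod_(i < p) (2 / a i) = E p * 2^-1 ^+ p * M p.
  rewrite /E [X in X * M p]mulrAC divfK ?gt_eqF ?wseq_gt0//.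
  by rewrite -mulrA -exprMn divff// expr1n mulr1.
apply: ler_wpM2r; first by rewrite ltW// wseq_gt0.
apply: ler_wpM2r; first by rewrite exprn_ge0// invr_ge0.
have le1 q : (q <= p0)%N -> E q <= \sum_(q < p0.+1) E q.
  move=> qp; rewrite (bigD1 (Ordinal (qp : (q < p0.+1)%N)))//= lerDl sumr_ge0// => i _.
  by rewrite ltW.
have [/le1//|/ltnW p0p] := leqP p p0.
have -> : E p = E p0; last exact: le1.
move: p0p => /subnK <-; elim: (_ - _)%N => [//|k IH]; rewrite -[RHS]IH addSn.
have aE : a (k + p0)%N = 4 / wquot M (k + p0).+1 by rewrite /a ltnNge leq_addl.
rewrite /E big_ord_recr/= aE exprS wseqS.
have := wquot_gt0 (k + p0).+1; have := wseq_gt0 M (k + p0).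
set w := wquot M _; set m := M _; set P := \prod_(_ < _) _; set q := _ ^+ _.
by move=> m0 w0; field; rewrite !gt_eqF.
Qed.

End WeightedCutoff.

(** * Necessity of (DN) *)

Section TensorProducts.
Context (R : realType) (d : nat) (G : 'I_d -> nat -> R -> R).
Hypothesis G_derive : forall j p t, is_derive t (1 : R) (G j p) (G j p.+1 t).
Implicit Types (c : 'I_d -> nat) (x : 'rV[R]_d) (j k : 'I_d) (s : seq 'I_d).

(** [c j] is the order of the derivative taken in coordinate [j]; a partial derivative just raises
    one entry of [c]. *)
Definition rtensor c x : R := \prod_j G j (c j) (x 0 j).

Definition tensor c : 'rV[R]_d -> Rcomplex R := fun x => (rtensor c x)%:C%C.

Lemma is_derive_rtensor c x k :
  is_derive x (delta_mx 0 k : 'rV[R]_d) (rtensor c) (rtensor (fun j => c j + (j == k))%N x).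
Proof.
pose C := \prod_(j | j != k) G j (c j) (x 0 j).
have D := is_deriveZ C (G_derive k (c k) (x 0 k)).
have E : (fun h : R => h^-1 *: ((rtensor c \o shift x) (h *: (delta_mx 0 k : 'rV[R]_d)) - rtensor c x)) =
    (fun h : R => h^-1 *: (((C \*: G k (c k)) \o shift (x 0 k)) (h *: (1 : R)) -
       (C \*: G k (c k)) (x 0 k))).
  apply/funext => h /=; rewrite /rtensor (bigD1 k)//= [X in _ - X](bigD1 k)//=.
  rewrite !mxE !eqxx/= [h *: 1]mulr1 mulr1 -/C.
  congr (_ *: (_ - _)); last by rewrite mulrC.
  rewrite mulrC; congr (_ * _); apply: eq_bigr => j jk.
  by rewrite !mxE (negbTE jk) andbF mulr0 add0r.
have -> : rtensor (fun j => c j + (j == k))%N x = C *: G k (c k).+1 (x 0 k).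
  rewrite /rtensor (bigD1 k)//= eqxx addn1 mulrC; congr (_ * _).
  by apply: eq_bigr => j jk; rewrite (negbTE jk) addn0.
case: D => [ex D]; apply: DeriveDef; rewrite /derivable /derive E.
  exact: ex.
exact: D.
Qed.

Lemma real_complex_continuous : continuous (fun r : R => r%:C%C : Rcomplex R).
Proof.
move=> r; have rF := @nbhs_filter R r.
apply/cvgrPdist_le => e e0; apply/nbhs_normP; exists e => // t /= rt.
by rewrite -rmorphB Rcomplex_norm_real ltW.
Qed.

Lemma is_derive_tensor c x k : is_derive x (delta_mx 0 k : 'rV[R]_d) (tensor c)
  (tensor (fun j => c j + (j == k))%N x).
Proof.
have [ex D] := is_derive_rtensor c x k.
have H : (fun h : R => h^-1 *: ((tensor c \o shift x) (h *: (delta_mx 0 k : 'rV[R]_d)) - tensor c x))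
    @ 0^' --> tensor (fun j => c j + (j == k))%N x.
  have -> : (fun h : R => h^-1 *: ((tensor c \o shift x) (h *: (delta_mx 0 k : 'rV[R]_d)) - tensor c x)) =
    (fun r : R => r%:C%C : Rcomplex R) \o
    (fun h : R => h^-1 *: ((rtensor c \o shift x) (h *: (delta_mx 0 k : 'rV[R]_d)) - rtensor c x)).
    apply/funext => h /=; rewrite /tensor -rmorphB; set r := _ - _.
    by apply: part_inj => -[]; rewrite partZ/= ?mulr0.
  apply: continuous_cvg; first exact: real_complex_continuous.
  by rewrite -D; exact: ex.
apply: DeriveDef; last exact: cvg_lim H.
by apply/cvg_ex; eexists; exact: H.
Qed.

Lemma tensor_continuous c : continuous (tensor c).
Proof.
have cr (l : seq 'I_d) : continuous (fun x : 'rV[R]_d => \prod_(j <- l) G j (c j) (x 0 j)).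
  elim: l => [|j l IH] x.
    rewrite (_ : (fun x : 'rV_d => _) = cst 1); first exact: cst_continuous.
    by apply/funext => y; rewrite big_nil.
  rewrite (_ : (fun x : 'rV_d => _) = fun y : 'rV[R]_d =>
    G j (c j) (y 0 j) * \prod_(j <- l) G j (c j) (y 0 j)); last first.
    by apply/funext => y; rewrite big_cons.
  apply: (@continuousM R _ (fun y : 'rV[R]_d => G j (c j) (y 0 j))); last exact: IH.
  apply: (@continuous_comp _ _ _ (fun y : 'rV[R]_d => y 0 j) (G j (c j))).
    exact: coord_continuous.
  apply: differentiable_continuous; apply/derivable1_diffP.
  exact: (@ex_derive _ _ _ _ _ _ _ (G_derive j (c j) (x 0 j))).
move=> x; apply: (@continuous_comp _ _ _ (rtensor c) (fun r : R => r%:C%C : Rcomplex R)).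
  exact: cr.
exact: real_complex_continuous.
Qed.

Lemma foldr_partial_tensor c s :
  foldr (@partial R d) (tensor c) s = tensor (fun j => c j + count_mem j s)%N.
Proof.
elim: s => [|k s IH] /=; first by congr tensor; apply/funext => j; rewrite addn0.
rewrite IH; apply/funext => x; rewrite /partial.
have [_ ->] := is_derive_tensor (fun j => c j + count_mem j s)%N x k.
by congr (tensor _ x); apply/funext => j; rewrite -addnA [(count_mem j s + _)%N]addnC eq_sym.
Qed.

Lemma smooth_tensor c : smooth (tensor c).
Proof.
move=> s /=; rewrite foldr_partial_tensor; split; first exact: tensor_continuous.
by move=> j x; have [] := is_derive_tensor (fun j => c j + count_mem j s)%N x j.
Qed.

Lemma mderiv_tensor (alpha : {ffun 'I_d -> nat}) :
  mderiv alpha (tensor (fun=> 0%N)) = tensor alpha.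
Proof.
rewrite mderiv_foldr foldr_partial_tensor; congr tensor; apply/funext => j.
by rewrite add0n count_flatten_nseq ?enum_uniq// mem_enum.
Qed.

End TensorProducts.

(** * Derivatives of a product *)

Section Leibniz.
Context (R : realType) (F G : nat -> R -> R).
Hypothesis F_derive : forall i t, is_derive t (1 : R) (F i) (F i.+1 t).
Hypothesis G_derive : forall i t, is_derive t (1 : R) (G i) (G i.+1 t).

(* [leib n i j] is the [n]-th derivative of [F i * G j]. *)
Fixpoint leib (n i j : nat) (t : R) : R :=
  if n is n'.+1 then leib n' i.+1 j t + leib n' i j.+1 t else F i t * G j t.

Lemma is_derive_leib n i j t : is_derive t (1 : R) (leib n i j) (leib n.+1 i j t).
Proof.
elim: n i j => [|n IH] i j; last exact: is_deriveD (IH i.+1 j) (IH i j.+1).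
have [ex D] := is_deriveM (F_derive i t) (G_derive j t).
apply: DeriveDef; first exact: ex.
by apply: etrans D _; rewrite /= /GRing.scale/= addrC mulrC.
Qed.

Lemma leib0 n i t : G 0%N t = 1 -> (forall j, G j.+1 t = 0) -> leib n i 0 t = F (n + i)%N t.
Proof.
move=> G0 GS.
have Z m k j : leib m k j.+1 t = 0.
  by elim: m k j => [|m IH] k j /=; rewrite ?GS ?mulr0// !IH addr0.
elim: n i => [|n IH] i /=; first by rewrite G0 mulr1.
by rewrite Z addr0 IH addSnnS.
Qed.

Lemma leib_eq0 n i j t : (forall k, G k t = 0) -> leib n i j t = 0.
Proof. by move=> G0; elim: n i j => [|n IH] i j /=; rewrite ?G0 ?mulr0// !IH addr0. Qed.

(** The recursion produces [2 ^+ n] products of total order [n + i + j], and log-convexity, through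
    [M p * M q <= M 0 * M (p + q)], gives all of them the same bound. *)
Lemma leib_le (M : weight_sequence R) (A B k : R) t : cond_M1 M -> 0 <= k -> 0 <= A -> 0 <= B ->
  (forall i, `|F i t| <= A * k ^+ i * M i) -> (forall j, `|G j t| <= B * k ^+ j * M j) ->
  forall n i j, `|leib n i j t| <=
    2 ^+ n * (A * B * M 0%N * k ^+ (n + i + j) * M (n + i + j)%N).
Proof.
move=> M1 k0 A0 B0 FA GB; elim=> [|n IH] i j /=.
  rewrite expr0 mul1r add0n normrM; apply: le_trans (ler_pM _ _ (FA i) (GB j)) _ => //.
  rewrite exprD; have := wseq_mulM i j M1 => H.
  have -> : A * k ^+ i * M i * (B * k ^+ j * M j) = (A * B * (k ^+ i * k ^+ j)) * (M i * M j) by ring.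
  have -> : A * B * M 0%N * (k ^+ i * k ^+ j) * M (i + j)%N =
    (A * B * (k ^+ i * k ^+ j)) * (M 0%N * M (i + j)%N) by ring.
  by apply: ler_wpM2l => //; rewrite !mulr_ge0// exprn_ge0.
apply: le_trans (ler_normD _ _) _.
have := lerD (IH i.+1 j) (IH i j.+1).
rewrite !addnS !addSn [2 ^+ n.+1]exprS; set X := A * B * _ * _ * _; move/le_trans; apply.
by rewrite -mulrA mulr_natl mulr2n.
Qed.

End Leibniz.

(** * Localized oscillating test functions *)

Section TestFunctions.
Context (R : realType) (d : nat) (M : weight_sequence R) (W : weight_system R d.+1).
Hypothesis M1 : cond_M1 M.
Context (D : R) (chi : nat -> R -> R).
Hypothesis D_gt0 : 0 < D.
Hypothesis chi_derive : forall p x, is_derive x (1 : R) (chi p) (chi p.+1 x).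
Hypothesis chi_le : forall p x, `|chi p x| <= D * 2^-1 ^+ p * M p.
Hypothesis chi_supp : forall p x, 1 < `|x| -> chi p x = 0.
Hypothesis chi0 : chi 0%N 0 = 1.
Hypothesis chi0S : forall p, chi p.+1 0 = 0.

Section Osc.
Context (a : nat) (lam : R) (x0 : 'rV[R]_d.+1).
Hypothesis lam_gt0 : 0 < lam.

(* The phase is shifted so that the [a]-th derivative is [M a] at [0]. *)
Definition osc (i : nat) (t : R) : R :=
  M a * (lam ^+ i / lam ^+ a) * cos (lam * t + (i%:R - a%:R) * (pi / 2)).

Lemma osc_derive i t : is_derive t (1 : R) (osc i) (osc i.+1 t).
Proof.
pose th : R := (i%:R - a%:R) * (pi / 2).
have Dl : is_derive t (1 : R) (fun s : R => lam * s + th) lam.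
  have [ex E] := is_deriveD (is_deriveZ lam (is_derive_id t (1 : R))) (is_derive_cst th t (1 : R)).
  apply: DeriveDef; first exact: ex.
  by apply: etrans E _; rewrite addr0 [LHS]mulr1.
have [ex E] := is_deriveZ (M a * (lam ^+ i / lam ^+ a)) 
  (@is_derive1_comp R (@cos R) (fun s : R => lam * s + th) t _ _ (is_derive_cos _) Dl).
apply: DeriveDef; first exact: ex.
apply: etrans E _.
rewrite /osc -natr1 (_ : lam * t + (i%:R + 1 - a%:R) * (pi / 2) = lam * t + th + pi / 2); last first.
  by rewrite /th; ring.
rewrite cosDpihalf exprS /GRing.scale/=; ring.
Qed.

Lemma osc_at0 : osc a 0 = M a.
Proof. by rewrite /osc subrr mul0r mulr0 addr0 cos0 divff ?mulr1// expf_neq0// gt_eqF. Qed.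

Lemma osc_le i t : `|osc i t| <= M a * (lam ^+ i / lam ^+ a).
Proof.
have c0 : 0 <= M a * (lam ^+ i / lam ^+ a).
  by rewrite mulr_ge0 ?divr_ge0 ?exprn_ge0// ltW// wseq_gt0.
by rewrite normrM (ger0_norm c0) ler_piMr// cos_max.
Qed.

Definition factor (j : 'I_d.+1) (p : nat) (t : R) : R :=
  if j == ord0 then leib osc chi p 0 0 (t - x0 0 j) else chi p (t - x0 0 j).

Lemma factor_derive j p t : is_derive t (1 : R) (factor j p) (factor j p.+1 t).
Proof.
rewrite /factor; case: (j == ord0).
  apply: (is_derive_translate (f := leib osc chi p 0 0)).
  exact: (is_derive_leib osc_derive chi_derive).
exact: (is_derive_translate (f := chi p)).
Qed.

Lemma factor_supp j p t : 1 < `|t - x0 0 j| -> factor j p t = 0.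
Proof.
move=> t1; rewrite /factor; case: (j == ord0); last exact: chi_supp.
by apply: leib_eq0 => k; exact: chi_supp.
Qed.

Definition test := tensor factor (fun=> 0%N).

Lemma smooth_test : smooth test.
Proof. exact: smooth_tensor factor_derive _. Qed.

Lemma test_at : exists alpha : {ffun 'I_d.+1 -> nat}, mlen alpha = a /\
  `|mderiv alpha test x0 : Rcomplex R| = M a.
Proof.
exists [ffun j => if j == ord0 then a else 0%N]; split.
  rewrite /mlen big_ord_recl ffunE eqxx big1 ?addn0// => j _.
  by rewrite ffunE.
rewrite (mderiv_tensor factor_derive) /tensor Rcomplex_norm_real /rtensor big_ord_recl big1 ?mulr1.
  rewrite ffunE eqxx /factor eqxx subrr leib0// addn0 osc_at0 gtr0_norm//.
  exact: wseq_gt0.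
by move=> j _; rewrite ffunE/= /factor/= subrr.
Qed.

Lemma prod_wseq n (c : 'I_n.+1 -> nat) :
  \prod_j M (c j) <= M 0%N ^+ n * M (\sum_j c j)%N.
Proof.
elim: n c => [|n IH] c; first by rewrite !big_ord_recl !big_ord0 mulr1 expr0 mul1r addn0.
rewrite big_ord_recl [(\sum_j c j)%N]big_ord_recl exprSr.
have M0 p : 0 <= M p by rewrite ltW// wseq_gt0.
apply: le_trans (ler_wpM2l (M0 _) (IH _)) _.
rewrite mulrCA -mulrA; apply: ler_wpM2l; first by rewrite exprn_ge0.
exact: wseq_mulM.
Qed.

(** Log-convexity merges the [d + 1] factors at the price of [M 0 ^+ d]; each cutoff contributes
    [D], and the product rule the remaining [M 0]. *)
Definition test_const : R := M 0%N * D ^+ d.+1 * M 0%N ^+ d.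

Lemma test_const_gt0 : 0 < test_const.
Proof. by rewrite !mulr_gt0// ?exprn_gt0// wseq_gt0. Qed.

(** The product rule costs [2 ^+ p]. This is paid by measuring the oscillation with parameter
    [2 h_n] and by the factor [2^-p] in the bound of the cutoff, which suffices because
    [h_n <= 1]. *)
Lemma factor_le n (S : R) j p t : 0 <= S ->
  (forall i, M a * (lam ^+ i / lam ^+ a) * (2 * hstep R n) ^+ i <= S * M i) ->
  `|factor j p t| <= (if j == ord0 then S * M 0%N else 1) * (D * (hstep R n)^-1 ^+ p * M p).
Proof.
move=> S0 HS; have h0 := hstep_gt0 R n; have M0 q : 0 <= M q by rewrite ltW// wseq_gt0.
have h2 : 0 < 2 * hstep R n by rewrite mulr_gt0.
rewrite /factor; case: (j == ord0); last first.
  rewrite mul1r; apply: le_trans (chi_le _ _) _; apply: ler_wpM2r => //.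
  apply: ler_wpM2l; first exact: ltW.
  rewrite lerXn2r ?nnegrE ?invr_ge0 ?(ltW h0)// lef_pV2 ?posrE//.
  by rewrite (le_trans (hstep_le1 _ _))// ler1n.
have FA i s : `|osc i s| <= S * (2 * hstep R n)^-1 ^+ i * M i.
  apply: le_trans (osc_le _ _) _; rewrite exprVn mulrAC ler_pdivlMr ?exprn_gt0//.
have GB i s : `|chi i s| <= D * (2 * hstep R n)^-1 ^+ i * M i.
  apply: le_trans (chi_le _ _) _; apply: ler_wpM2r => //.
  apply: ler_wpM2l; first exact: ltW.
  rewrite lerXn2r ?nnegrE ?invr_ge0 ?(ltW h2)// lef_pV2 ?posrE//.
  by rewrite ler_piMr// hstep_le1.
have k0 : 0 <= (2 * hstep R n)^-1 by rewrite invr_ge0 ltW.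
have := leib_le M1 k0 S0 (ltW D_gt0) (FA^~ (t - x0 0 j)) (GB^~ (t - x0 0 j)) p 0 0.
rewrite !addn0 => /le_trans; apply; rewrite le_eqVlt; apply/orP; left; apply/eqP.
rewrite invfM exprMn [2^-1 ^+ p]exprVn.
have : (2 : R) ^+ p != 0 by rewrite expf_neq0.
by set q := 2 ^+ p; set k := (hstep R n)^-1 ^+ p => q0; field.
Qed.

(** The test function vanishes off the cube centered at [x0], so the weight at [x] may be replaced
    by a weight at [x0]. *)
Lemma test_le n (S Cs : R) N N' : 0 <= S -> 0 <= Cs ->
  (forall i, M a * (lam ^+ i / lam ^+ a) * (2 * hstep R n) ^+ i <= S * M i) ->
  (forall x y, cube y -> W N (x + y) <= Cs * W N' x) ->
  forall alpha x, hstep R n ^+ mlen alpha * `|mderiv alpha test x : Rcomplex R| * W N x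
    / M (mlen alpha) <= test_const * S * (Cs * W N' x0).
Proof.
move=> S0 Cs0 HS Hsh alpha x; have h0 := hstep_gt0 R n.
have Mp p : 0 <= M p by rewrite ltW// wseq_gt0.
have rhs0 : 0 <= test_const * S * (Cs * W N' x0).
  apply: mulr_ge0; apply: mulr_ge0 => //; first exact: ltW test_const_gt0.
  exact: ltW (wsys_gt0 _ _ _).
rewrite (mderiv_tensor factor_derive) /tensor Rcomplex_norm_real.
have [[j xj]|near] := pselect (exists j, 1 < `|x 0 j - x0 0 j|).
  by rewrite /rtensor (bigD1 j)//= factor_supp// mul0r normr0 mulr0 !mul0r.
have cx : cube (x - x0).
  move=> j; rewrite !mxE -ler_norml leNgt; apply/negP => xj.
  by apply: near; exists j.
have Wx : W N x <= Cs * W N' x0.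
  by have := Hsh x0 _ cx; rewrite addrC subrK.
have le_prod : `|rtensor factor alpha x| <=
    test_const * S * ((hstep R n)^-1 ^+ mlen alpha * M (mlen alpha)).
  rewrite /rtensor normr_prod.
  apply: (@le_trans _ _ (\prod_j ((if j == ord0 then S * M 0%N else 1) *
      (D * (hstep R n)^-1 ^+ alpha j * M (alpha j))))).
    by apply: ler_prod => j _; rewrite normr_ge0 factor_le.
  rewrite big_split/= big_ord_recl eqxx big1 // mulr1.
  under [X in _ * X]eq_bigr do rewrite -mulrA.
  rewrite big_split/= prodr_const card_ord big_split/= prodrXr -/(mlen alpha).
  have := prod_wseq alpha; rewrite -/(mlen alpha) => /ler_wpM2l H.
  have -> : test_const * S * ((hstep R n)^-1 ^+ mlen alpha * M (mlen alpha)) =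
    (S * M 0%N * D ^+ d.+1 * (hstep R n)^-1 ^+ mlen alpha) * (M 0%N ^+ d * M (mlen alpha)).
    by rewrite /test_const; ring.
  have c0 : 0 <= S * M 0%N * D ^+ d.+1 * (hstep R n)^-1 ^+ mlen alpha.
    have [Dn hn] : 0 <= D ^+ d.+1 /\ 0 <= (hstep R n)^-1 ^+ mlen alpha.
      by split; apply: exprn_ge0; rewrite ?invr_ge0 ltW.
    by rewrite !mulr_ge0.
  by apply: le_trans (H _ c0); rewrite !mulrA.
set h := hstep R n ^+ mlen alpha; have hp : 0 < h by rewrite exprn_gt0.
rewrite exprVn -/h in le_prod.
have Mm : 0 < M (mlen alpha) := wseq_gt0 _ _.
rewrite ler_pdivrMr//.
have -> : test_const * S * (Cs * W N' x0) * M (mlen alpha) =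
   h * (test_const * S * (h^-1 * M (mlen alpha))) * (Cs * W N' x0).
  by field; rewrite gt_eqF.
apply: ler_pM => //; first by rewrite mulr_ge0// ltW.
  by rewrite ltW// wsys_gt0.
by rewrite ler_pM2l.
Qed.

End Osc.
End TestFunctions.

(** * Size of the oscillation in early and late steps *)

Section OscBounds.
Context (R : realType) (M : weight_sequence R).
Hypothesis M1 : cond_M1 M.
Implicit Types (a i r q : nat) (L k : R).

Let M_ge0 p : 0 <= M p. Proof. by rewrite ltW// wseq_gt0. Qed.
Let w_ge0 p : 0 <= wquot M p. Proof. by rewrite ltW// wquot_gt0. Qed.

Lemma wseq_down a r : (r <= a)%N -> M a <= wquot M a ^+ r * M (a - r)%N.
Proof.
elim: r => [|r IH] ra; first by rewrite expr0 mul1r subn0.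
apply: le_trans (IH (ltnW ra)) _; rewrite exprSr -mulrA; apply: ler_wpM2l.
  by rewrite exprn_ge0.
have -> : (a - r)%N = (a - r.+1).+1 by rewrite subnSK.
by rewrite wseqS; apply: ler_wpM2r => //; apply: wquot_mono => //; rewrite subnSK// leq_subr.
Qed.

Lemma wseq_up a r : (0 < a)%N -> M a * wquot M a ^+ r <= M (a + r)%N.
Proof.
move=> a0; elim: r => [|r IH]; first by rewrite expr0 mulr1 addn0.
rewrite exprS mulrCA addnS wseqS; apply: ler_pM => //.
  by rewrite mulr_ge0// exprn_ge0.
by apply: wquot_mono => //; rewrite -addnS leq_addr.
Qed.

(** Raising the order by one multiplies the left side by [G m_a] and [M] by a quotient at least
    [m_a]. At most a factor [G] is lost each time, and none once the quotients have reached index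
    [Q a]. *)
Lemma wseq_up_growth a r Q (G : R) : (0 < a)%N -> (0 < Q)%N -> 1 <= G ->
  G * wquot M a <= wquot M (Q * a) ->
  M a * (G * wquot M a) ^+ r <= G ^+ (Q * a) * M (a + r)%N.
Proof.
move=> a0 Q0 G1 GQ; have G0 : 0 <= G by exact: le_trans G1.
suff H : M a * (G * wquot M a) ^+ r <= G ^+ minn r (Q * a) * M (a + r)%N.
  by apply: le_trans H _; rewrite ler_wpM2r// ler_weXn2l// geq_minr.
elim: r => [|r IH]; first by rewrite min0n !expr0 mulr1 mul1r addn0.
rewrite exprS mulrCA.
have Gw0 : 0 <= G * wquot M a by rewrite mulr_ge0.
apply: le_trans (ler_wpM2l Gw0 IH) _; rewrite addnS wseqS.
have [rQ|Qr] := ltnP r (Q * a).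
  rewrite (minn_idPl rQ) [G ^+ r.+1]exprS.
  have : wquot M a <= wquot M (a + r).+1 by apply: wquot_mono; rewrite // -addnS leq_addr.
  move: (wquot M (a + r).+1) (wquot M a) => w' w ww'; rewrite -!mulrA; apply: ler_wpM2l => //.
  rewrite [leLHS]mulrCA; apply: ler_wpM2l; first by rewrite exprn_ge0.
  exact: ler_wpM2r.
rewrite (minn_idPr (leqW Qr)) [leLHS]mulrCA; apply: ler_wpM2l.
  by rewrite exprn_ge0.
apply: ler_wpM2r => //; apply: le_trans GQ _.
have Qa0 : (0 < Q * a)%N by rewrite muln_gt0 Q0.
by apply: wquot_mono => //; rewrite (leq_trans Qr)// -addnS addnC; exact: leqW (leq_addr _ _).
Qed.

Lemma osc_low a i L k : 0 < L -> 0 <= k -> (i <= a)%N ->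
  M a * ((L * wquot M a) ^+ i / (L * wquot M a) ^+ a) * k ^+ i <=
  L^-1 ^+ (a - i) * k ^+ i * M i.
Proof.
move=> L0 k0 ia; have w0 := wquot_gt0 M a.
have := wseq_down (leq_subr i a); rewrite subKn//; move: (wquot M a) w0 => w w0 H.
have Lw0 : 0 < L * w by rewrite mulr_gt0.
have -> : (L * w) ^+ i / (L * w) ^+ a = L^-1 ^+ (a - i) * (w ^+ (a - i))^-1.
  have -> : (L * w) ^+ a = (L * w) ^+ (a - i) * (L * w) ^+ i by rewrite -exprD subnK.
  by rewrite invfM mulrCA divff ?mulr1 ?expf_neq0 ?gt_eqF// exprMn invfM exprVn.
have wn : 0 < w ^+ (a - i) by rewrite exprn_gt0.
rewrite -ler_pdivrMl// mulrC in H.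
have -> : M a * (L^-1 ^+ (a - i) * (w ^+ (a - i))^-1) * k ^+ i =
  L^-1 ^+ (a - i) * k ^+ i * (M a / w ^+ (a - i)) by ring.
by apply: ler_wpM2l => //; rewrite mulr_ge0 ?exprn_ge0// invr_ge0 ltW.
Qed.

Lemma osc_high a r L k : 0 < L ->
  M a * ((L * wquot M a) ^+ (a + r) / (L * wquot M a) ^+ a) * k ^+ (a + r) =
  k ^+ a * (M a * ((L * k) * wquot M a) ^+ r).
Proof.
move=> L0; have w0 := wquot_gt0 M a.
move: (wquot M a) w0 => w w0.
have lw : (L * w) ^+ a != 0 by rewrite expf_neq0// mulf_neq0 ?gt_eqF.
have -> : (L * w) ^+ (a + r) / (L * w) ^+ a = (L * w) ^+ r.
  by rewrite exprD mulrAC divff// mul1r.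
by rewrite exprD !exprMn; ring.
Qed.

(** Meant for [h] the parameter of the middle step and [k] twice that of a late one. Since a
    derivative of order [a] counts with the factor [h ^+ a] in the middle step, the bound
    [(h / 2) ^+ a] leaves a gain of [2^-a]. *)
Lemma osc_small a i (h k : R) : (0 < a)%N -> 0 < h -> 0 <= k -> k <= h / 2 ->
  M a * ((2 / h * wquot M a) ^+ i / (2 / h * wquot M a) ^+ a) * k ^+ i <= (h / 2) ^+ a * M i.
Proof.
move=> a0 h0 k0 kh; have L0 : 0 < 2 / h by rewrite divr_gt0.
have h20 : 0 <= h / 2 by rewrite divr_ge0// ltW.
have [ia|/ltnW ai] := leqP i a.
  apply: le_trans (osc_low L0 k0 ia) _; apply: ler_wpM2r => //.
  rewrite invf_div -{2}(subnK ia) exprD; apply: ler_wpM2l; first by rewrite exprn_ge0.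
  by rewrite lerXn2r// nnegrE.
rewrite -(subnKC ai) osc_high//; apply: ler_pM => //.
- by rewrite exprn_ge0.
- by rewrite mulr_ge0// exprn_ge0// mulr_ge0// mulr_ge0// ltW.
- by rewrite lerXn2r// nnegrE.
- apply: le_trans (wseq_up _ a0); apply: ler_wpM2l => //.
  have k1 : 2 / h * k <= 1.
    by rewrite mulrAC ler_pdivrMr// mul1r mulrC -ler_pdivlMr.
  have k2 : 0 <= 2 / h * k by rewrite mulr_ge0// ltW.
  by apply: lerXn2r; rewrite ?nnegrE ?ler_piMl// mulr_ge0.
Qed.

(** The parameter 2 is twice that of step 0. The oscillation is not small there, but the growth of
    the quotients of [M] keeps the loss geometric in [a]. *)
Lemma osc_big a i Q L : (0 < a)%N -> (0 < Q)%N -> 1 <= L -> 2 * L * wquot M a <= wquot M (Q * a) ->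
  M a * ((L * wquot M a) ^+ i / (L * wquot M a) ^+ a) * 2 ^+ i <=
  (2 * (2 * L) ^+ Q) ^+ a * M i.
Proof.
move=> a0 Q0 L1 LQ; have L0 : 0 < L by exact: lt_le_trans L1.
have G1 : 1 <= 2 * L by lra.
rewrite [(2 * _ ^+ Q) ^+ a]exprMn -exprM.
have [ia|/ltnW ai] := leqP i a.
  apply: le_trans (osc_low L0 _ ia) _ => //; apply: ler_wpM2r => //.
  have L1' : L^-1 ^+ (a - i) <= 1 by rewrite exprn_ile1 ?invr_ge0 ?(ltW L0)// invf_le1.
  have i0 : 0 <= 2 ^+ i :> R by rewrite exprn_ge0.
  apply: le_trans (ler_wpM2r i0 L1') _; rewrite mul1r.
  apply: (@le_trans _ _ (2 ^+ a)); first by rewrite ler_weXn2l// ler1n.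
  by rewrite ler_peMr ?exprn_ge0// exprn_ege1.
rewrite -(subnKC ai) osc_high// -[leRHS]mulrA; apply: ler_wpM2l; first by rewrite exprn_ge0.
by rewrite [L * 2]mulrC; exact: wseq_up_growth.
Qed.

(** Over [a <= p < (q + 1) a], monotonicity makes the sum of [1 / m_p] at least [q a / m_((q+1) a)],
    while (M.3) bounds it by [C a / m_a]; it remains to take [q >= C G]. *)
Lemma M3_growth (G : R) : cond_M3 M -> exists Q, (0 < Q)%N /\ forall a, (0 < a)%N ->
  G * wquot M a <= wquot M (Q * a).
Proof.
move=> M3; have [C C1 H] := M3_sum M3.
have C0 : 0 < C by exact: lt_le_trans C1.
pose q := (Num.truncn `|C * G|).+1.
exists q.+1; split=> // a a0.
have w0 := wquot_gt0 M; have aR : 0 < a%:R :> R by rewrite ltr0n.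
have := H a (q.+1 * a)%N a0.
have : (q * a)%:R / wquot M (q.+1 * a) <= \sum_(a <= p < q.+1 * a) (wquot M p)^-1.
  apply: (@le_trans _ _ (\sum_(a <= p < q.+1 * a) (wquot M (q.+1 * a))^-1)).
    have cE (v : R) : \sum_(a <= p < q.+1 * a) v = (q * a)%:R * v.
      by rewrite big_const_nat iter_addr_0 mulSn addKn mulr_natl.
    by rewrite cE.
  rewrite !big_nat; apply: ler_sum => p /andP[ap pq].
  rewrite lef_pV2 ?posrE//; apply: wquot_mono => //; last exact: ltnW.
  exact: leq_trans ap.
move=> /le_trans K /K; rewrite natrM ler_pdivrMr// mulrAC ler_pdivlMr//.
rewrite mulrAC => {}K.
have {}K : q%:R * wquot M a <= C * wquot M (q.+1 * a).
  rewrite -(ler_pM2r aR); apply: le_trans (le_trans _ K) _; rewrite le_eqVlt; apply/orP; left; apply/eqP; ring.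
have Gq : C * G <= q%:R.
  by apply: le_trans (ler_norm _) _; rewrite ltW// truncnS_gt.
rewrite -(ler_pM2l C0) mulrA; apply: le_trans K; apply: ler_wpM2r => //.
Qed.

End OscBounds.

Lemma cond_shiftP (R : realType) (d : nat) (W : weight_system R d) : cond_shift W ->
  forall N, exists N' (C : R), 0 < C /\ forall x y, cube y -> W N (x + y) <= C * W N' x.
Proof.
move=> sh N; have [N' _ [C C0 H]] := sh N; exists N', C; split=> // x y cy.
by rewrite -lee_fin; apply: le_trans (H x); apply: ereal_sup_ubound; exists y.
Qed.

(* Tested on the functions [test] oscillating near [x] with frequency
   proportional to [wquot M a], [norm_wQ] interpolates [W N] between two other
   weights, with parameter [a]. *)
Lemma wQ_interp (R : realType) (d : nat) (M : weight_sequence R) (W : weight_system R d.+1) :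
  cond_M1 M -> cond_M3 M -> cond_shift W -> norm_wQ M W ->
  exists N (t : R), 1 <= t /\ forall N', exists K (C : R), 0 < C /\ forall x a, (0 < a)%N ->
    W N' x <= C * (t ^+ a * W N x + 2^-1 ^+ a * W K x).
Proof.
move=> M1 M3 /cond_shiftP sh wQ.
have [D [D0 [chi [chiD chiB chiS chi1 chi0]]]] := weighted_cutoff M3.
have [N0 [m [_ Hm]]] := wQ 0%N.
set h := hstep R m; have h0 : 0 < h := hstep_gt0 R m.
have h1 : h <= 1 := hstep_le1 R m.
(* The frequency will be [L m_a], as [osc_small] demands. *)
pose L := 2 / h.
have L1 : 1 <= L by rewrite ler_pdivlMr// mul1r (le_trans h1)// ler1n.
have [Q [Q0 HQ]] := M3_growth M1 (2 * L) M3.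
have [N [Cs [Cs0 Hs]]] := sh N0.
have h4 : 0 < h / 4 by rewrite divr_gt0.
have [n0 hn0] := hstep_small h4.
pose k := maxn m.+1 n0.
have mk : (m < k)%N by exact: leq_maxl.
have hk : 2 * hstep R k <= h / 2.
  have : hstep R k <= h / 4 by apply: le_trans hn0; apply: hstep_le; exact: leq_maxr.
  lra.
pose t0 : R := 2 * (2 * L) ^+ Q.
have t01 : 1 <= t0.
  have : 1 <= (2 * L) ^+ Q by rewrite exprn_ege1//; lra.
  by rewrite /t0; lra.
(* The loss [t0 ^+ a] in step 0 is divided by the factor [h ^+ a] of the middle step. *)
exists N, (t0 / h); split; first by rewrite ler_pdivlMr// mul1r (le_trans h1).
move=> N'; have [K0 [C [C0 HC]]] := Hm k N' mk.
have [K [Ck [Ck0 Hk]]] := sh K0.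
have B0 := test_const_gt0 d M D0; set B := test_const d M D in B0.
exists K, (C * B * (Cs + Ck)); split=> [|x a a0].
  by apply: mulr_gt0; [exact: mulr_gt0|exact: addr_gt0].
pose lam := L * wquot M a.
have lam0 : 0 < lam by rewrite mulr_gt0 ?wquot_gt0// (lt_le_trans ltr01).
pose f := test M chi a lam x.
have S0i i : M a * (lam ^+ i / lam ^+ a) * (2 * hstep R 0) ^+ i <= t0 ^+ a * M i.
  rewrite /hstep invr1 mulr1; exact: osc_big (HQ a a0).
have Ski i : M a * (lam ^+ i / lam ^+ a) * (2 * hstep R k) ^+ i <= (h / 2) ^+ a * M i.
  by apply: osc_small => //; rewrite mulr_ge0// ltW// hstep_gt0.
have t0a : 0 <= t0 ^+ a by rewrite exprn_ge0// (le_trans ler01).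
have h2a : 0 <= (h / 2) ^+ a by rewrite exprn_ge0// divr_ge0// ltW.
have tl n S0 Cs' N1 N2 := @test_le R d M W M1 D chi D0 chiD chiB chiS a lam x lam0 n S0 Cs' N1 N2.
have f0 : f \in BW_pred M W (1%:R^-1)%:pos.
  apply/asboolP; split=> [|N1]; first exact: (smooth_test M chiD a lam x).
  have [N2 [C2 [C20 H2]]] := sh N1.
  by apply/bnorm_ltyP; eexists; apply/bnorm_leP; exact: (tl 0%N _ _ _ _ t0a (ltW C20) S0i H2).
pose F : BR M W := BW_incl (BWFun f0 : BW M W (1%:R^-1)%:pos).
have F0 : stp 0 F by apply/stpP.
have FN : sn 0 N0 (B * t0 ^+ a * (Cs * W N x)) F.
  by apply/snP; exact: (tl 0%N _ _ _ _ t0a (ltW Cs0) S0i Hs).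
have FK : sn k K0 (B * (h / 2) ^+ a * (Ck * W K x)) F.
  by apply/snP; exact: (tl k _ _ _ _ h2a (ltW Ck0) Ski Hk).
have wN := wsys_gt0 W N x; have wK := wsys_gt0 W K x.
pose q1 := B * t0 ^+ a * (Cs * W N x); pose q2 := B * (h / 2) ^+ a * (Ck * W K x).
have t0a' : 0 < t0 ^+ a by rewrite exprn_gt0// (lt_le_trans ltr01).
have q10 : 0 < q1 := mulr_gt0 (mulr_gt0 B0 t0a') (mulr_gt0 Cs0 wN).
have q20 : 0 <= q2 := mulr_ge0 (mulr_ge0 (ltW B0) h2a) (mulr_ge0 (ltW Ck0) (ltW wK)).
(* Dividing the test function by [q1 + q2] brings both its norms below 1, so the conclusion of
   [norm_wQ] is additive in the two weights. *)
have q0 : 0 < q1 + q2 by rewrite ltr_wpDr.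
have e1 : sn 0 N0 1 (((q1 + q2)^-1)%:C%C *: F).
  by apply: sn_scale q0 _ FN; rewrite mulr1 lerDl.
have e2 : sn k K0 1 (((q1 + q2)^-1)%:C%C *: F).
  by apply: sn_scale q0 _ FK; rewrite mulr1 lerDr ltW.
have [alpha [alphaE fE]] := test_at M chiD chi1 chi0 a x lam0.
have /(snV q0)/snP/(_ alpha x) := HC _ (stpZ ((q1 + q2)^-1)%:C%C F0) e1 e2.
rewrite alphaE [X in _ * X * _ / _](_ : _ = M a)//.
rewrite -/h mulrAC mulfK ?gt_eqF ?wseq_gt0// => Hx.
have ha : 0 < h ^+ a by rewrite exprn_gt0.
rewrite -(ler_pM2l ha); apply: le_trans Hx _; rewrite -subr_ge0 /q1 /q2.
rewrite [(t0 / h) ^+ a]exprMn [(h / 2) ^+ a]exprMn [h^-1 ^+ a]exprVn [2^-1 ^+ a]exprVn.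
have a2 : (2 : R) ^+ a != 0 by rewrite expf_neq0.
set A := t0 ^+ a in t0a t0a' *; set z := h ^+ a in ha *; set y := 2 ^+ a in a2 *.
have -> : z * (C * B * (Cs + Ck) * (A / z * W N x + y^-1 * W K x)) -
    (B * A * (Cs * W N x) + B * (z / y) * (Ck * W K x)) * C =
    C * B * (Ck * (A * W N x) + Cs * (z / y * W K x)).
  by field; rewrite a2 gt_eqF.
have zy : 0 <= z / y by move: h2a; rewrite exprMn [2^-1 ^+ a]exprVn.
apply: mulr_ge0; first by rewrite mulr_ge0// ltW.
by apply: addr_ge0; apply: mulr_ge0; rewrite ?(ltW Ck0) ?(ltW Cs0)//; apply: mulr_ge0 => //; exact: ltW.
Qed.

(** Bernoulli's inequality for [(1 + 1/s)^s], with denominators cleared. *)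
Lemma expn_double s : (0 < s)%N -> (2 * s ^ s <= s.+1 ^ s)%N.
Proof.
move=> s0.
have H j : (s ^ j * (s + j) <= s * s.+1 ^ j)%N.
  elim: j => [|j IH]; first by rewrite addn0 !expn0 mul1n muln1.
  rewrite !expnS; nia.
have := H s; rewrite addnn -muln2 mulnCA leq_pmul2l//; lia.
Qed.

(** In terms of [U n = W n / W N], [a] is chosen so that the second term is at most half of the left
    side, leaving [U N' <= 2 C t^a]. As [t <= 2^s], this reads [U N' ^ (s + 1) <= C' U K ^ s].
    Iterating [s] times brings the ratio of exponents to at least 2, which is (DN). *)
Lemma interp_DN (R : realType) (d : nat) (W : weight_system R d) (N : nat) (t : R) :
  1 <= t -> (forall N', exists K (C : R), 0 < C /\ forall x a, (0 < a)%N ->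
    W N' x <= C * (t ^+ a * W N x + 2^-1 ^+ a * W K x)) -> cond_DN W.
Proof.
move=> t1 H; have w0 := wsys_gt0 W.
have [s [s0 ts]] : exists s, (0 < s)%N /\ t <= 2 ^+ s.
  exists (Num.truncn t).+1; split=> //; apply: ltW; apply: lt_le_trans (truncnS_gt t) _.
  by rewrite -natrX ler_nat ltnW// ltn_expl.
pose U n x := W n x / W N x.
have U0 n x : 0 < U n x by rewrite divr_gt0.
have step N' : exists K (C : R), 0 < C /\ forall x, U N' x ^+ s.+1 <= C * U K x ^+ s.
  have [K0 [C0 [C00 HC]]] := H N'.
  pose K := maxn K0 N'; pose C := Num.max C0 1.
  have C1 : 1 <= C by rewrite le_max lexx orbT.
  have Cp : 0 < C by exact: lt_le_trans C1.
  exists K, (2 * C * (4 * C) ^+ s); split=> [|x].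
    by rewrite !mulr_gt0// exprn_gt0// mulr_gt0.
  pose r := 2 * C * U K x / U N' x.
  have UNK : U N' x <= U K x.
    by rewrite /U ler_pM2r ?invr_gt0//; apply: wsys_le; exact: leq_maxr.
  have r2 : 2 <= r.
    rewrite /r ler_pdivlMr// -mulrA ler_pM2l//; apply: le_trans UNK _.
    by rewrite ler_peMl// ltW.
  (* [2 ^ a] is comparable with [r]: the lower bound makes the second term absorbable, the upper one
     keeps [t ^+ a] under control. *)
  have [a [a0 ra ar]] : exists a, [/\ (0 < a)%N, r <= 2 ^+ a & 2 ^+ a <= 2 * r].
    have ex : exists a, r <= 2 ^+ a.
      exists (Num.truncn r).+1; apply: ltW; apply: lt_le_trans (truncnS_gt r) _.
      by rewrite -natrX ler_nat ltnW// ltn_expl.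
    have [a ra mina] := ex_minnP ex.
    have a0 : (0 < a)%N.
      by rewrite lt0n; apply: contraTneq ra => ->; rewrite expr0 -ltNge; lra.
    exists a; split=> //; rewrite -(prednK a0) exprS ler_pM2l//.
    by rewrite leNgt; apply/negP => /ltW/mina; rewrite -ltnS prednK// ltnn.
  have HU : U N' x <= C * (t ^+ a + 2^-1 ^+ a * U K x).
    rewrite /U ler_pdivrMr//; apply: le_trans (HC x a a0) _.
    have -> : C * (t ^+ a + 2^-1 ^+ a * (W K x / W N x)) * W N x =
        C * (t ^+ a * W N x + 2^-1 ^+ a * W K x).
      by field; rewrite gt_eqF.
    have ta : 0 <= t ^+ a by rewrite exprn_ge0// (le_trans ler01).
    have ha : 0 <= 2^-1 ^+ a :> R by rewrite exprn_ge0// invr_ge0.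
    apply: ler_pM; rewrite ?(ltW C00)//.
    - by rewrite addr_ge0// mulr_ge0// ltW.
    - by rewrite le_max lexx.
    - by rewrite lerD2l ler_wpM2l//; apply: wsys_le; exact: leq_maxl.
  have half : C * (2^-1 ^+ a * U K x) <= U N' x / 2.
    have a2 : 0 < 2 ^+ a :> R by rewrite exprn_gt0.
    rewrite exprVn mulrCA mulrC ler_pdivrMr//.
    have := ra; rewrite /r ler_pdivrMr// => ra'; lra.
  have Ut : U N' x <= 2 * C * t ^+ a by move: HU half; rewrite mulrDr; lra.
  have tr : t ^+ a <= (2 * r) ^+ s.
    apply: (@le_trans _ _ ((2 ^+ a) ^+ s)).
      rewrite -exprM mulnC exprM; apply: lerXn2r; rewrite ?nnegrE ?exprn_ge0//.
      exact: le_trans t1.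
    by apply: lerXn2r; rewrite ?nnegrE ?exprn_ge0// mulr_ge0// (le_trans _ r2).
  have UN0 := U0 N' x; have UNs : 0 < U N' x ^+ s by rewrite exprn_gt0.
  rewrite exprSr.
  apply: (@le_trans _ _ (U N' x ^+ s * (2 * C * (2 * r) ^+ s))).
    rewrite ler_pM2l//; apply: le_trans Ut _; rewrite ler_pM2l//.
    by rewrite mulr_gt0.
  rewrite /r; have -> : 2 * (2 * C * U K x / U N' x) = 4 * C * U K x / U N' x.
    by field; rewrite gt_eqF.
  rewrite [(4 * C * _ / _) ^+ s]exprMn [(4 * C * _) ^+ s]exprMn exprVn.
  rewrite le_eqVlt; apply/orP; left; apply/eqP.
  by field; rewrite gt_eqF.
have iter j : forall N', exists K (C : R), 0 < C /\
    forall x, U N' x ^+ (s.+1 ^ j) <= C * U K x ^+ (s ^ j).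
  elim: j => [|j IH] N'.
    by exists N', 1; split=> // x; rewrite !expn0 !expr1 mul1r.
  have [K [C [C0 HC]]] := IH N'; have [K' [C' [C'0 HC']]] := step K.
  exists K', (C ^+ s.+1 * C' ^+ (s ^ j)); split=> [|x].
    by rewrite mulr_gt0// exprn_gt0.
  rewrite expnSr exprM.
  apply: (@le_trans _ _ ((C * U K x ^+ (s ^ j)) ^+ s.+1)).
    by apply: lerXn2r; rewrite ?nnegrE ?mulr_ge0 ?exprn_ge0 ?(ltW C0) ?(ltW (U0 _ _)).
  rewrite exprMn -mulrA ler_pM2l ?exprn_gt0// -exprM mulnC exprM.
  rewrite expnSr [(s ^ j * s)%N]mulnC exprM -exprMn.
  by apply: lerXn2r; rewrite ?nnegrE ?mulr_ge0 ?exprn_ge0 ?(ltW C'0) ?(ltW (U0 _ _)).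
exists N => N' NN'.
have [K0 [C0 [C00 HC]]] := iter s N'.
exists (maxn K0 N'.+1); first exact: leq_maxr.
pose C := Num.max C0 1.
have C1 : 1 <= C by rewrite le_max lexx orbT.
have Cp : 0 < C by exact: lt_le_trans C1.
exists C => // x; set K := maxn _ _.
have UK : U K0 x <= U K x.
  by rewrite /U ler_pM2r ?invr_gt0//; apply: wsys_le; exact: leq_maxl.
have U1 : 1 <= U N' x by rewrite ler_pdivlMr// mul1r; apply: wsys_le; exact: ltnW.
have q0 : (0 < s ^ s)%N by rewrite expn_gt0 s0.
(* Because [U N' x >= 1], the exponent [(s + 1)^s] may be lowered to [2 s^s]; the inequality is then
   the [s^s]-th power of the desired one. *)
have sq : U N' x ^+ 2 <= C * U K x.
  have A0 : 0 <= U N' x ^+ 2 by exact: sqr_ge0.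
  have B0 : 0 <= C * U K x := mulr_ge0 (ltW Cp) (ltW (U0 K x)).
  rewrite -(ler_pXn2r q0) ?nnegrE//.
  rewrite -exprM; apply: (@le_trans _ _ (U N' x ^+ (s.+1 ^ s))).
    by apply: ler_weXn2l => //; exact: expn_double.
  apply: le_trans (HC x) _; rewrite [(C * _) ^+ _]exprMn; apply: ler_pM.
  - exact: ltW.
  - by rewrite exprn_ge0// ltW.
  - apply: (@le_trans _ _ C); first by rewrite le_max lexx.
    by rewrite -(prednK q0) exprS ler_peMr ?exprn_ege1// ltW.
  - by apply: lerXn2r; rewrite ?nnegrE ?(ltW (U0 _ _)).
have wN := w0 N x.
have -> : W N' x ^+ 2 = U N' x ^+ 2 * W N x ^+ 2 by rewrite /U; field; rewrite gt_eqF.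
have -> : C * W N x * W K x = C * U K x * W N x ^+ 2 by rewrite /U; field; rewrite gt_eqF.
by rewrite ler_pM2r// exprn_gt0.
Qed.

(** The space is a single point, so the constant can be read off from the values of the weights
    there. *)
Lemma cond_DN_dim0 (R : realType) (W : weight_system R 0) : cond_DN W.
Proof.
have w0 n := wsys_gt0 W n 0.
exists 0%N => N' _; exists N'.+1 => //.
exists (W N' 0 ^+ 2 / (W 0%N 0 * W N'.+1 0)) => [|x].
  by rewrite divr_gt0 ?exprn_gt0// mulr_gt0.
have -> : x = 0 by apply/rowP => -[].
by rewrite -mulrA divfK// mulf_neq0// gt_eqF.
Qed.

Theorem theorem3p6 (R : realType) (d : nat)
    (M : weight_sequence R) (W : weight_system R d) :
  [/\ cond_DN W -> lf_boundedly_retractive (@BR_emb R d M W),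
      lf_boundedly_retractive (@BR_emb R d M W) -> lc_complete (BR M W),
      lc_complete (BR M W) -> lf_regular (@BR_emb R d M W),
      lf_regular (@BR_emb R d M W) -> lf_wQ (@BR_emb R d M W) &
      lf_wQ (@BR_emb R d M W) -> lf_boundedly_retractive (@BR_emb R d M W)] /\
  (cond_M1 M -> cond_M2 M -> cond_M3 M -> cond_shift W ->
   lf_wQ (@BR_emb R d M W) -> cond_DN W).
Proof.
have wQ_br : norm_wQ M W -> lf_boundedly_retractive (@BR_emb R d M W).
  by move=> /norm_wQ_nested[F]; exact: nested_boundedly_retractive F.
split; first split.
- by move=> /(DN_norm_wQ M).
(* Bounded retractivity yields regularity, hence the norm inequality, and thereby the nested sets on
   which the completeness proof rests. *)
- by move=> /boundedly_retractive_regular/regular_norm_wQ/norm_wQ_nested[F]; exact: nested_complete F.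
- exact: complete_regular.
- by move=> /regular_norm_wQ/lf_wQP.
- by move=> /lf_wQP.
- move=> M1 _ M3 sh /lf_wQP wQ; case: d W sh wQ {wQ_br} => [|d'] W' sh wQ.
    exact: cond_DN_dim0.
  have [N [t [t1 H]]] := wQ_interp M1 M3 sh wQ.
  exact: interp_DN t1 H.
Qed.
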